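(* Let $\omega\in\mathbb T^1\setminus\mathbb Q$ and $f\in\mathcal V_\omega$, with SNA $\phi^+$ and SNR $\phi^-$. Then the measures $\mu_{\phi^+}$ and $\mu_{\phi^-}$ on $\mathbb T^2$ are $1$-rectifiable.
   Context: Notation: $\mathbb T^1=\mathbb R/\mathbb Z$, $d$ the usual distance on $\mathbb T^1$, $\pi_1,\pi_2$ the coordinate projections of $\mathbb T^2=\mathbb T^1\times\mathbb T^1$, $\mathrm{Leb}$ Lebesgue measure on $\mathbb T^1$. Skew products: for irrational $\omega$, $\mathcal F_\omega$ is the set of $C^1$-diffeomorphisms $f$ of $\mathbb T^2$ homotopic to the identity of the form $f(\theta,x)=(\theta+\omega,f_\theta(x))$. Write $f^k_\theta(x)=\pi_2(f^k(\theta,x))$ for $k\in\mathbb Z$. Invariant graphs: a measurable $\phi:\mathbb T^1\to\mathbb T^1$ is an invariant graph if $f_\theta(\phi(\theta))=\phi(\theta+\omega)$ for Lebesgue-a.e. $\theta$; graphs agreeing a.e. are identified. Its Lyapunov exponent is $\lambda(\phi)=\int_{\mathbb T^1}\log|\partial_xf_\theta(\phi(\theta))|\,d\theta$. It is an SNA (resp. SNR) if $\lambda(\phi)<0$ (resp. $>0$) and there is no continuous function a.e. equal to $\phi$. The associated measure is $\mu_\phi(A)=\mathrm{Leb}(\pi_1(A\cap\Phi))$, $\Phi=\{(\theta,\phi(\theta))\}$. The class $\mathcal V_\omega$: $f\in\mathcal F_\omega$ belongs to $\mathcal V_\omega$ if the following hold for some choice of data. (i) There are disjoint closed intervals $C=[c^-,c^+]$,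 $E=[e^-,e^+]\subseteq\mathbb T^1$ and a set $\mathcal I_0\subseteq\mathbb T^1$ which is a union of $\mathcal N$ disjoint open intervals, and constants $\alpha>4$, $S>0$, such that: $f_\theta(x)\in\mathrm{int}(C)$ whenever $x\notin(e^-,e^+)$ and $\theta\notin\mathcal I_0$; for all $\theta,\theta',x,x'$: $\alpha^{-2}d(x,x')\le d(f_\theta(x),f_\theta(x'))\le\alpha^2d(x,x')$ and $d(f_\theta(x),f_{\theta'}(x))\le S\,d(\theta,\theta')$; $|\partial_xf_\theta(x)|\le\alpha^{-1}$ for $x\in C$; $|\partial_xf_\theta(x)|\ge\alpha$ for $x\in E$. (ii) Integers $\kappa\ge2$, $K_0\ge1$, $K_n=K_0\kappa^n$, $b_0=1$, $b_n=(1-1/K_{n-1})b_{n-1}$, with $b=\lim_n b_n>\sqrt{5/6}$. A super-exponentially increasing integer sequence $(M_n)_{n\ge0}$ with $M_0\ge2$ and $M_{n+1}\le2\alpha^{M_n/16}$. A non-increasing positive sequence $(\varepsilon_n)$ with $\varepsilon_0\le1$ and $\varepsilon_{n+1}\le2\alpha^{-M_n/4}/s$ for a fixed $s>0$. Moreover $\alpha\ge\alpha_*$ and $\varepsilon_0\le\varepsilon_*$, where $\alpha_*>1,\varepsilon_*>0$ are thresholds guaranteeing $\sum_{n\ge0}(2K_nM_n+1)\mathcal N\varepsilon_n\le\sum_{n\ge0}\varepsilon_n^{1/2}<1/16$; and each component of $\mathcal I_0$ has length $<\varepsilon_0$. (iii) Critical regions: recursively $\mathcal A_n=(\mathcal I_n-(M_n-1)\omega)\times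 C$, $\mathcal B_n=(\mathcal I_n+(M_n+1)\omega)\times E$, $\mathcal I_{n+1}=\mathrm{int}\,\pi_1\big(f^{M_n-1}(\mathcal A_n)\cap f^{-(M_n+1)}(\mathcal B_n)\big)$. Let $\mathcal W_n^+=\bigcup_{j=0}^n\bigcup_{l=1}^{M_j+1}(\mathcal I_j+l\omega)$, $\mathcal W_n^-=\bigcup_{j=0}^n\bigcup_{l=-(M_j-1)}^{0}(\mathcal I_j+l\omega)$, $\mathcal W_{-1}^\pm=\emptyset$. For every $n\in\mathbb N$: $\mathcal I_j\ne\emptyset$ for $j\le n$; $\mathcal I_j\cap\bigcup_{k=1}^{2K_jM_j}(\mathcal I_j+k\omega)=\emptyset$ for $j=0,\dots,n$; $\big((\mathcal I_j-(M_j-1)\omega)\cup(\mathcal I_j+(M_j+1)\omega)\big)\cap(\mathcal W_{j-1}^+\cup\mathcal W_{j-1}^-)=\emptyset$ for $j=1,\dots,n$; and $\mathcal I_n$ has exactly $\mathcal N$ connected components, each of length $<\varepsilon_n$. (iv) $f$ has an SNA $\phi^+$ and an SNR $\phi^-$, and $\mu_{\phi^+},\mu_{\phi^-}$ are the only $f$-invariant ergodic probability measures. (v) $f$ is minimal. Rectifiability: $\mathcal H^1$ is the one-dimensional Hausdorff measure on $\mathbb T^2$. A Borel set $A\subseteq\mathbb T^2$ is countably $1$-rectifiable if there are Lipschitz maps $g_i:A_i\subseteq\mathbb R\to\mathbb T^2$ with $\mathcal H^1(A\setminus\bigcup_ig_i(A_i))=0$. A finite Borel measure $\mu$ is $1$-rectifiable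 if $\mu=\Theta\,\mathcal H^1|_A$ for a countably $1$-rectifiable $A$ and a Borel density $\Theta:A\to[0,\infty)$. *)

(* Defs.v *)
(* Conventions:
   - T^1 = R/Z is represented by R ("lifts"); a subset of T^1 is a 1-periodic
     subset of R; a map T^1 -> T^1 by a real function read modulo 1.
   - T^2 is represented by R*R; Borel subsets of T^2 are Borel subsets of the
     fundamental domain [0,1)^2 ([dom2]); points are reduced by [red2].
   - A skew product f(θ,x) = (θ+ω, f_θ(x)) homotopic to the identity is given by
     the lift g of its fibre maps (g θ x = lift of f_θ(x)), with
     g (θ+1) x = g θ x and g θ (x+1) = g θ x + 1, and h is the lift of the
     fibre maps of f^{-1}. *)
From mathcomp Require Import all_boot all_order all_algebra.
From mathcomp Require Import all_classical all_reals all_analysis.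
Set Implicit Arguments.
Unset Strict Implicit.
Unset Printing Implicit Defensive.
Import Order.TTheory GRing.Theory Num.Theory.
Import numFieldNormedType.Exports.
Local Open Scope classical_set_scope.
Local Open Scope ring_scope.

Section Defs.
Variable R : realType.
Implicit Types (x y t θ ω : R) (p q : R * R).

Definition fracR x : R := x - (Num.floor x)%:~R.
Definition eqZ x y : Prop := exists k : int, x = y + k%:~R.
Definition dT x y : R := Num.min (fracR (x - y)) (1 - fracR (x - y)).
Definition closed_arc (a b : R) : set R :=
  [set x | exists k : int, a <= x + k%:~R <= b].
Definition open_arc (a b : R) : set R :=
  [set x | exists k : int, a < x + k%:~R < b].
Definition shiftS (A : set R) t : set R := [set x | A (x - t)].
(* A is a union of N pairwise disjoint (nonempty) open arcs, each of length < eps;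
   for eps <= 1 these arcs are exactly the connected components of A *)
Definition union_arcs (A : set R) (N : nat) (eps : R) : Prop :=
  exists a b : nat -> R,
    (forall i, (i < N)%N -> a i < b i /\ b i - a i < eps) /\
    (forall i j, (i < N)%N -> (j < N)%N -> i <> j ->
        open_arc (a i) (b i) `&` open_arc (a j) (b j) = set0) /\
    A = [set x | exists2 i, (i < N)%N & open_arc (a i) (b i) x].

Definition dom2 : set (R * R) := [set p | 0 <= p.1 < 1 /\ 0 <= p.2 < 1].
Definition red2 p : R * R := (fracR p.1, fracR p.2).
Definition eq2 p q : Prop := eqZ p.1 q.1 /\ eqZ p.2 q.2.
Definition dT2 p q : R := Num.sqrt (dT p.1 q.1 ^+ 2 + dT p.2 q.2 ^+ 2).

Definition C1_2 (u : R -> R -> R) : Prop :=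
  exists u1 u2 : R -> R -> R,
    continuous (fun p : R * R => u1 p.1 p.2) /\
    continuous (fun p : R * R => u2 p.1 p.2) /\
    (forall t x, is_derive t 1 (fun s => u s x) (u1 t x)) /\
    (forall t x, is_derive x 1 (u t) (u2 t x)).

(* f(θ,x) = (θ+ω, g θ x mod 1) is a C^1 diffeomorphism of T^2 homotopic to the
   identity, with inverse (θ,y) |-> (θ-ω, h (θ-ω) y mod 1) *)
Definition skew_C1_diffeo (g h : R -> R -> R) : Prop :=
  (forall t x, g (t + 1) x = g t x) /\ (forall t x, g t (x + 1) = g t x + 1) /\
  C1_2 g /\ C1_2 h /\
  (forall t x, h t (g t x) = x) /\ (forall t y, g t (h t y) = y).

Definition dx (g : R -> R -> R) t x : R := derive1 (g t) x.

Fixpoint fit (ω : R) (g : R -> R -> R) (n : nat) p : R * R :=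
  match n with
  | 0 => p
  | n'.+1 => let q := fit ω g n' p in (q.1 + ω, g q.1 q.2)
  end.
Fixpoint bit (ω : R) (h : R -> R -> R) (n : nat) p : R * R :=
  match n with
  | 0 => p
  | n'.+1 => let q := bit ω h n' p in (q.1 - ω, h (q.1 - ω) q.2)
  end.
Definition fint (ω : R) (g h : R -> R -> R) (n : int) p : R * R :=
  match n with
  | Posz k => fit ω g k p
  | Negz k => bit ω h k.+1 p
  end.

Definition fpre ω (g : R -> R -> R) (B : set (R * R)) : set (R * R) :=
  [set p | dom2 p /\ B (red2 (fit ω g 1 p))].

Definition inv_graph ω (g : R -> R -> R) (phi : R -> R) : Prop :=
  measurable_fun setT phi /\ (forall t, eqZ (phi (t + 1)) (phi t)) /\
  {ae (@lebesgue_measure R), forall t, eqZ (g t (phi t)) (phi (t + ω))}.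

Definition lyap (g : R -> R -> R) (phi : R -> R) : \bar R :=
  (\int[@lebesgue_measure R]_(t in `[0%R, 1%R]) (ln `|dx g t (phi t)|)%:E)%E.

Definition not_ae_continuous (phi : R -> R) : Prop :=
  ~ exists psi : R -> R, continuous psi /\
      {ae (@lebesgue_measure R), forall t, eqZ (psi t) (phi t)}.

Definition SNA ω g phi : Prop :=
  inv_graph ω g phi /\ (lyap g phi < 0)%E /\ not_ae_continuous phi.
Definition SNR ω g phi : Prop :=
  inv_graph ω g phi /\ (0 < lyap g phi)%E /\ not_ae_continuous phi.

Definition muphi (phi : R -> R) (B : set (R * R)) : \bar R :=
  @lebesgue_measure R [set t | 0 <= t < 1 /\ B (t, fracR (phi t))].

Definition inv_erg_prob ω g (nu : set (R * R) -> \bar R) : Prop :=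
  nu dom2 = 1%E /\ nu (~` dom2) = 0%E /\
  (forall B, measurable B -> B `<=` dom2 -> nu (fpre ω g B) = nu B) /\
  (forall B, measurable B -> B `<=` dom2 -> fpre ω g B = B ->
      nu B = 0%E \/ nu B = 1%E).

Definition Kseq (K0 kappa : nat) (n : nat) : nat := (K0 * kappa ^ n)%N.
Definition bseq (K0 kappa : nat) (n : nat) : R :=
  \prod_(i < n) (1 - ((Kseq K0 kappa i)%:R)^-1).

Definition superexp (M : nat -> nat) : Prop :=
  (forall n, (M n < M n.+1)%N) /\
  (forall c : R, 1 < c -> \forall n \near \oo, c ^+ n <= (M n)%:R).

Fixpoint Iseq ω (g : R -> R -> R) (C E : set R) (M : nat -> nat) (I0 : set R)
    (n : nat) : set R :=
  match n with
  | 0 => I0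
  | n'.+1 =>
      let In := Iseq ω g C E M I0 n' in
      let A := [set p : R * R | In (p.1 + ((M n')%:R - 1) * ω) /\ C p.2] in
      let B := [set p : R * R | In (p.1 - ((M n')%:R + 1) * ω) /\ E p.2] in
      interior [set t | exists x,
        (exists2 p, A p & eq2 (fit ω g (M n' - 1) p) (t, x)) /\
        B (fit ω g (M n' + 1) (t, x))]
  end.

Definition Wplus ω g C E M I0 (n : nat) : set R :=
  [set t | exists j l, (j <= n)%N /\ (1 <= l <= M j + 1)%N /\
     shiftS (Iseq ω g C E M I0 j) (l%:R * ω) t].
Definition Wminus ω g C E M I0 (n : nat) : set R :=
  [set t | exists j m, (j <= n)%N /\ (m <= M j - 1)%N /\
     shiftS (Iseq ω g C E M I0 j) (- (m%:R * ω)) t].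

Definition minimal ω (g h : R -> R -> R) : Prop :=
  forall p q (e : R), 0 < e -> exists n : int, dT2 (fint ω g h n p) q < e.

Definition V_data ω (g h : R -> R -> R) (cm cp em ep : R) (I0 : set R)
    (N : nat) (alpha S : R) (kappa K0 : nat) (M : nat -> nat) (eps : nat -> R)
    (s : R) (phip phim : R -> R) : Prop :=
  let C := closed_arc cm cp in
  let E := closed_arc em ep in
  let I := Iseq ω g C E M I0 in
  let K := Kseq K0 kappa in
  [/\ cm <= cp, cp - cm < 1, em <= ep, ep - em < 1 & C `&` E = set0] /\
  union_arcs I0 N (eps 0%N) /\
  4 < alpha /\ 0 < S /\
  (forall t x, ~ open_arc em ep x -> ~ I0 t -> open_arc cm cp (g t x)) /\
  (forall t t' x x', alpha ^- 2 * dT x x' <= dT (g t x) (g t x') /\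
                     dT (g t x) (g t x') <= alpha ^+ 2 * dT x x' /\
                     dT (g t x) (g t' x) <= S * dT t t') /\
  (forall t x, C x -> `|dx g t x| <= alpha^-1) /\
  (forall t x, E x -> alpha <= `|dx g t x|) /\
  (2 <= kappa)%N /\ (1 <= K0)%N /\
  Num.sqrt (5 / 6) < limn (bseq K0 kappa) /\
  superexp M /\ (2 <= M 0%N)%N /\
  (forall n, (M n.+1)%:R <= 2 * alpha `^ ((M n)%:R / 16)) /\
  0 < s /\
  (forall n, 0 < eps n) /\ (forall n, eps n.+1 <= eps n) /\ eps 0%N <= 1 /\
  (forall n, eps n.+1 <= 2 * alpha `^ (- ((M n)%:R / 4)) / s) /\
  (\sum_(0 <= n <oo) (((2 * K n * M n + 1) * N)%:R * eps n)%:E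
     <= \sum_(0 <= n <oo) (Num.sqrt (eps n))%:E)%E /\
  (\sum_(0 <= n <oo) (Num.sqrt (eps n))%:E < (1 / 16)%:E)%E /\
  (forall n : nat,
     (forall j, (j <= n)%N -> I j !=set0) /\
     (forall j, (j <= n)%N ->
        I j `&` [set t | exists k, (1 <= k <= 2 * K j * M j)%N /\
                                   shiftS (I j) (k%:R * ω) t] = set0) /\
     (forall j, (1 <= j <= n)%N ->
        ([set t | I j (t + ((M j)%:R - 1) * ω)] `|`
         [set t | I j (t - ((M j)%:R + 1) * ω)]) `&`
        (Wplus ω g C E M I0 j.-1 `|` Wminus ω g C E M I0 j.-1) = set0) /\
     union_arcs (I n) N (eps n)) /\
  SNA ω g phip /\ SNR ω g phim /\
  inv_erg_prob ω g (muphi phip) /\ inv_erg_prob ω g (muphi phim) /\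
  (forall mu : {measure set (R * R) -> \bar R}, inv_erg_prob ω g mu ->
     (forall B, measurable B -> B `<=` dom2 -> mu B = muphi phip B) \/
     (forall B, measurable B -> B `<=` dom2 -> mu B = muphi phim B)) /\
  minimal ω g h.

Definition diam2 (U : set (R * R)) : \bar R :=
  ereal_sup ([set 0%E] `|` [set (dT2 pq.1 pq.2)%:E | pq in U `*` U]).

Definition H1delta (delta : R) (A : set (R * R)) : \bar R :=
  ereal_inf [set (\sum_(0 <= i <oo) diam2 (U i))%E | U in
    [set U : nat -> set (R * R) |
       A `<=` \bigcup_i U i /\ forall i, (diam2 (U i) <= delta%:E)%E]].

Definition H1 (A : set (R * R)) : \bar R :=
  ereal_sup [set H1delta delta A | delta in [set delta : R | 0 < delta]].

Definition countably_1_rectifiable (A : set (R * R)) : Prop :=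
  exists (G : nat -> R -> R * R) (D : nat -> set R),
    (forall i, exists L : R, forall u v, D i u -> D i v ->
        dT2 (G i u) (G i v) <= L * `|u - v|) /\
    H1 (A `\` [set q | exists i u, D i u /\ q = red2 (G i u)]) = 0%E.

Definition rectifiable_measure (nu : set (R * R) -> \bar R) : Prop :=
  exists (A : set (R * R)) (Theta : R * R -> R),
    measurable A /\ A `<=` dom2 /\ countably_1_rectifiable A /\
    measurable_fun setT Theta /\ (forall p, A p -> 0 <= Theta p) /\
    (forall B, measurable B -> B `<=` dom2 ->
       nu B = (\int[H1]_(p in B `&` A) (Theta p)%:E)%E).

End Defs.

(* Main.v *)
Require Import Defs.
From HB Require Import structures.
From mathcomp Require Import all_boot all_order all_algebra.
From mathcomp Require Import all_classical all_reals all_analysis.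
From mathcomp Require Import measurable_realfun.
From mathcomp Require Import lra zify ring.
Set Implicit Arguments.
Unset Strict Implicit.
Unset Printing Implicit Defensive.
Import Order.TTheory GRing.Theory Num.Theory.
Import numFieldNormedType.Exports.
Local Open Scope classical_set_scope.
Local Open Scope ring_scope.

(** At a base point whose backward orbit avoids the critical regions at the
    appropriate times, the return structure of the sets I_n forces the orbit of
    the attractor into the contracting arc C, except during short excursions
    whose total proportion is at most 1/12 because the product of the
    1 - 1/K_n exceeds sqrt(5/6). If two such base points lie at distance d, one
    compares their orbits over a past of length proportional to |log d|: the
    excursions are too short to let the orbits separate beyond the scale at
    which C contracts, and the contraction beats the loss. Hence the graph is
    Lipschitz at small scales on each of countably many sets, which exhaust the
    circle by the Borel-Cantelli lemma. The sign of the Lyapunov exponent and the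
    ergodicity of the rotation show that the graph does visit C. Its measure is
    then absolutely continuous with respect to the Hausdorff measure on a
    countable union of Lipschitz graphs, and the Radon-Nikodym theorem gives the
    density. The repeller is the attractor of the inverse map, with C and E
    exchanged. *)

(** * Distance on the circle *)

(** Rates are written in powers of a, the sixth root of alpha: a step inside the arc gains [a ^- 6],
    any other loses at most [a ^+ 12]. Two orbits that each leave C for at most 1/12 of the time are
    both in C for 5/6 of it, so the mean exponent per step is 12/6 - 6 * 5/6 = -3; this is where
    1/12 comes from. The obstacle is that contraction holds only below a fixed distance eta, while
    two past points of the graph are merely both in C, possibly far apart. An intermediate orbit
    therefore starts from the past point of one orbit but runs over the base points of the other.
    Against the first orbit only the base point differs, and the error is linear in d; against the
    second only the starting point differs, and the whole arc C has been contracted to length of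
    order [a ^- (3 * m)]. With d of order [a ^- (90 * k)], a past m between 30k and 42k serves both:
    the contraction [a ^- (3 * m)] is at most d, and the worst expansion, about [a ^+ (2 * m)],
    keeps d times m below eta. *)

Section CircleDistance.
Variable R : realType.
Implicit Types x y z : R.

Lemma fracR_itv x : 0 <= fracR x < 1.
Proof.
have /andP[a b] := floor_itv x.
rewrite intrD in b; move: a b; rewrite /fracR /=; set f := (_%:~R); lra.
Qed.

Lemma fracRE x : exists k : int, fracR x = x + k%:~R.
Proof. by exists (- Num.floor x); rewrite /fracR mulrNz. Qed.

Lemma int_abs_lt1 (k : int) : `|k%:~R : R| < 1 -> k = 0.
Proof.
rewrite -intr_norm -[1]/(1%:~R) ltr_int => h.
by apply/eqP; rewrite -normr_le0; move: h; lia.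
Qed.

Lemma fracR_uniq x y (k : int) : 0 <= y < 1 -> x = y + k%:~R -> fracR x = y.
Proof.
move=> /andP[y0 y1] ->.
have [l E] := fracRE (y + k%:~R); have /andP[a b] := fracR_itv (y + k%:~R).
suff kl : k + l = 0 by rewrite E -addrA -intrD kl addr0.
apply: int_abs_lt1; rewrite intrD.
by move: E a b; set f := fracR _ => E a b; rewrite ltr_norml; apply/andP; split; lra.
Qed.

Lemma fracR_id x : 0 <= x < 1 -> fracR x = x.
Proof. by move=> h; apply: (@fracR_uniq x x 0) => //; rewrite addr0. Qed.

Lemma eqZ_refl x : eqZ x x.
Proof. by exists 0; rewrite addr0. Qed.

Lemma eqZ_sym x y : eqZ x y -> eqZ y x.
Proof. by case=> k ->; exists (- k); rewrite mulrNz addrK. Qed.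

Lemma eqZ_trans y x z : eqZ x y -> eqZ y z -> eqZ x z.
Proof. by case=> k -> [l ->]; exists (l + k); rewrite intrD addrA. Qed.

Lemma eqZ_fracR x : eqZ (fracR x) x.
Proof. by have [k ->] := fracRE x; exists k. Qed.

Lemma dT_ex x y : exists k : int, dT x y = `|x - y + k%:~R|.
Proof.
rewrite /dT; have [k E] := fracRE (x - y); have /andP[a b] := fracR_itv (x - y).
rewrite /Num.min; case: ifP => _; first by exists k; rewrite -E ger0_norm.
exists (k - 1); rewrite intrB addrA -E distrC ger0_norm //; lra.
Qed.

Lemma dT_le x y (k : int) : dT x y <= `|x - y + k%:~R|.
Proof.
rewrite /dT; have [l E] := fracRE (x - y); have /andP[a b] := fracR_itv (x - y).
have -> : x - y + k%:~R = fracR (x - y) + (k - l)%:~R by rewrite E intrB; ring.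
move: a b; set f := fracR _ => a b; rewrite ge_min; apply/orP.
have [h|h] : (0 <= k - l) \/ (k - l <= -1) by lia.
  by left; rewrite -(ler_int R) in h; rewrite ger0_norm; lra.
by right; rewrite -(ler_int R) intrN in h; rewrite ler0_norm; lra.
Qed.

Lemma dT_le0 x y : dT x y <= `|x - y|.
Proof. by have := dT_le x y 0; rewrite addr0. Qed.

Lemma dT_ge0 x y : 0 <= dT x y.
Proof. by have [k ->] := dT_ex x y. Qed.

Lemma dT_sym x y : dT x y = dT y x.
Proof.
suff H (u v : R) : dT u v <= dT v u by apply/eqP; rewrite eq_le !H.
have [k ->] := dT_ex v u.
have -> : v - u + k%:~R = - (u - v + (- k)%:~R) by rewrite intrN; ring.
by rewrite normrN; apply: dT_le.
Qed.

Lemma dT_tri y x z : dT x z <= dT x y + dT y z.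
Proof.
have [k ->] := dT_ex x y; have [l ->] := dT_ex y z.
apply: le_trans (dT_le x z (k + l)) _; apply: le_trans (ler_normD _ _).
by rewrite intrD le_eqVlt; apply/orP; left; apply/eqP; congr `|_|; ring.
Qed.

Lemma dT_xx x : dT x x = 0.
Proof.
by apply/eqP; rewrite eq_le dT_ge0 andbT; have := dT_le0 x x; rewrite subrr normr0.
Qed.

Lemma dT_eqZ0 x y : eqZ x y -> dT x y = 0.
Proof.
case=> k ->; apply/eqP; rewrite eq_le dT_ge0 andbT.
have := dT_le (y + k%:~R) y (- k); rewrite intrN.
have -> : y + k%:~R - y - k%:~R = 0 by ring.
by rewrite normr0.
Qed.

Lemma dT_eq0 x y : dT x y = 0 -> eqZ x y.
Proof.
have [k ->] := dT_ex x y; move=> /normr0_eq0 h; exists (- k); rewrite intrN; lra.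
Qed.

Lemma dT_eqZl x x' y : eqZ x x' -> dT x y = dT x' y.
Proof.
move=> h; have h1 := dT_eqZ0 h; have h2 := dT_eqZ0 (eqZ_sym h).
by apply/eqP; rewrite eq_le; have := dT_tri x' x y; have := dT_tri x x' y;
   rewrite h1 h2 !add0r => -> ->.
Qed.

Lemma dT_eqZr x y y' : eqZ y y' -> dT x y = dT x y'.
Proof. by move=> h; rewrite dT_sym (dT_eqZl _ h) dT_sym. Qed.

Lemma dT_ge x y : `|x - y| <= 1 -> Num.min `|x - y| (1 - `|x - y|) <= dT x y.
Proof.
move=> h; have [k ->] := dT_ex x y; rewrite ge_min.
have [->|k0] := eqVneq k 0; first by rewrite addr0 lexx.
apply/orP; right.
have k1 : 1 <= `|k%:~R : R|.
  by rewrite leNgt; apply: contra k0 => /int_abs_lt1 ->.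
by have := lerB_normD (k%:~R) (x - y); rewrite (addrC (k%:~R)); lra.
Qed.

Lemma dT_small x y : `|x - y| <= 1 / 2 -> dT x y = `|x - y|.
Proof.
move=> h; apply/eqP; rewrite eq_le dT_le0 /=.
by apply: le_trans (dT_ge _); rewrite ?le_min ?lexx /=; lra.
Qed.

(** For lifts taken in one arc of length 1 - eta, the other translates stay at distance at least
    eta, so a circle distance below eta is the distance of the lifts. This is what lets the mean
    value theorem act inside an arc. *)
Lemma dT_lift_small x y (eta : R) :
  `|x - y| <= 1 - eta -> dT x y < eta -> dT x y = `|x - y|.
Proof.
move=> h d; have e0 : 0 < eta by apply: le_lt_trans d; apply: dT_ge0.
apply/eqP; rewrite eq_le dT_le0 /=.
have := @dT_ge x y; rewrite ge_min => /(_ ltac:(lra)) /orP[//|]; lra.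
Qed.

Lemma dT_add x y z : dT (x + z) (y + z) = dT x y.
Proof. by rewrite /dT; congr (Num.min (fracR _) (1 - fracR _)); ring. Qed.

Lemma dT_near x y : exists2 x', eqZ x' x & dT x y = `|x' - y|.
Proof.
have [k E] := dT_ex x y; exists (x + k%:~R); first by exists k.
by rewrite E; congr `|_|; ring.
Qed.

Lemma dT2_ge1 (p q : R * R) : dT p.1 q.1 <= dT2 p q.
Proof.
by rewrite /dT2 -{1}(ger0_norm (dT_ge0 p.1 q.1)) -sqrtr_sqr ler_wsqrtr // lerDl sqr_ge0.
Qed.

Lemma dT2_ge2 (p q : R * R) : dT p.2 q.2 <= dT2 p q.
Proof.
by rewrite /dT2 -{1}(ger0_norm (dT_ge0 p.2 q.2)) -sqrtr_sqr ler_wsqrtr // lerDr sqr_ge0.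
Qed.

Lemma dT2_leD (p q : R * R) : dT2 p q <= dT p.1 q.1 + dT p.2 q.2.
Proof.
have h1 := dT_ge0 p.1 q.1; have h2 := dT_ge0 p.2 q.2.
rewrite /dT2 -[leRHS]ger0_norm ?addr_ge0 // -sqrtr_sqr ler_wsqrtr //.
by rewrite sqrrD -addrA lerD2l lerDr mulrn_wge0 ?mulr_ge0.
Qed.

End CircleDistance.

(** * Orbits of the trapping arc *)

Section OrbitLemma.
Variables (R : realType) (rho : R) (F : R -> R -> R).

Fixpoint orb (t x : R) (n : nat) : R :=
  if n is m.+1 then F (t + m%:R * rho) (orb t x m) else x.

Lemma orb_add t x m n :
  orb t x (m + n) = orb (t + m%:R * rho) (orb t x m) n.
Proof.
elim: n => [|n IH]; first by rewrite addn0.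
by rewrite addnS /= IH natrD mulrDl addrA.
Qed.

Lemma orb_recl t x n : orb t x n.+1 = orb (t + rho) (F t x) n.
Proof. by rewrite -add1n orb_add /= mul0r addr0 mul1r. Qed.

Variables (J : nat -> set R) (C Eo : set R) (p q : nat -> nat).
Hypothesis q_inc : forall n, (q n < q n.+1)%N.
Hypothesis q_gt0 : (0 < q 0)%N.
Hypothesis J_return : forall j t k,
  (1 <= k <= p j + q j)%N -> J j t -> ~ J j (t + k%:R * rho).
Hypothesis J_before : forall i j t l, (i < j)%N -> (1 <= l <= q i)%N ->
  J j t -> ~ J i (t - (p j + l)%:R * rho).
Hypothesis J_after : forall i j t l, (i < j)%N -> (1 <= l <= q i)%N ->
  J j t -> ~ J i (t + (q j)%:R * rho - l%:R * rho).
Hypothesis J_after' : forall i j t l, (i < j)%N -> (l <= p i)%N ->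
  J j t -> ~ J i (t + (q j)%:R * rho + l%:R * rho).
Hypothesis C_notE : forall x, C x -> ~ Eo x.
Hypothesis F_trap : forall t x, ~ J 0%N t -> ~ Eo x -> C (F t x).
Hypothesis F_cross : forall n t y, J n t -> ~ J n.+1 t -> C y ->
  ~ Eo (orb (t - (p n)%:R * rho) y (p n + q n)).

(** A start at t leaves the full run-up of [p j] steps before any visit to [J j], as the crossing
    hypothesis [F_cross] requires. *)
Definition safe (t : R) := forall j l, (l < p j)%N -> ~ J j (t + l%:R * rho).

Definition wandering (t : R) :=
  exists j l, (1 <= l <= q j)%N /\ J j (t - l%:R * rho).

(** Strong induction on k. A time is busy if it lies at most [q j] steps after a visit to [J j]. The
    only delicate step is the first free time after a busy one: [F_cross] keeps the orbit out of
    [Eo] there, provided that the orbit was in C when the run-up of length [p j] began. The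
    separation hypotheses make that earlier time free, so the induction hypothesis applies to it. *)
Lemma orbit_in_C t0 x0 k : safe t0 -> C x0 ->
  C (orb t0 x0 k) \/
  exists j L, [/\ (L < k)%N, (k - L <= q j)%N & J j (t0 + L%:R * rho)].
Proof.
move=> st Cx0; pose T (k : nat) : R := t0 + k%:R * rho.
have TD a b : T (a + b)%N = T a + b%:R * rho by rewrite /T natrD mulrDl addrA.
have TB a b : (b <= a)%N -> T (a - b)%N = T a - b%:R * rho.
  by move=> ba; rewrite -{2}(subnK ba) TD addrK.
pose busy k := exists j L, [/\ (L < k)%N, (k - L <= q j)%N & J j (T L)].
rewrite -/(busy k); have [bk|nbk] := pselect (busy k); [by right|left].
elim/ltn_ind: k nbk => -[//|k] IH nbk /=.
have nJ0 : ~ J 0%N (T k).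
  by move=> Jk; apply: nbk; exists 0%N, k; rewrite ltnSn subSnn.
apply: F_trap => //.
have [[j [L [Lk kL JL]]]|nb] := pselect (busy k); last first.
  by apply: C_notE; apply: IH.
have qj : (q j < k.+1 - L)%N.
  by rewrite ltnNge; apply/negP => h; apply: nbk; exists j, L; split=> //; apply: ltnW.
have {kL}kE : k = (L + q j)%N by lia.
(* A visit to the deeper set would keep the next time busy, since [q] is strictly increasing. *)
have nJS : ~ J j.+1 (T L).
  move=> JS; apply: nbk; exists j.+1, L; split=> //; first by apply: ltnW.
  by have := q_inc j; lia.
have pL : (p j <= L)%N.
  by rewrite leqNgt; apply/negP => h; exact: (st j L h JL).
have CL : C (orb t0 x0 (L - p j)).
  apply: IH; first by lia.
  case=> i [L' [L'L h JL']].
  have LE : T L = T L' + (L - L')%:R * rho by rewrite -TD subnKC //; lia.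
  (* No visit to [J i] at [L'] can cover the time [L - p j]. A lower level is excluded just before a
     run-up; a higher level must have its busy window end by time k, hence near a visit to [J j],
     which [J_after] and [J_after'] forbid; the same level would return too soon. *)
  have [ij|ji|ij] := ltngtP i j.
  - apply: (@J_before i j (T L) (L - p j - L')%N) => //; first by lia.
    have e : (p j + (L - p j - L') = L - L')%N by lia.
    by rewrite e LE addrK.
  - have h1 : (q i < k.+1 - L')%N.
      by rewrite ltnNge; apply/negP => h'; apply: nbk; exists i, L'; split=> //; lia.
    have [le|lt] := leqP (L' + q i) L.
    + apply: (@J_after' j i (T L') (L - (L' + q i))%N ji) => //; first by lia.
      by rewrite -!TD subnKC.
    + apply: (@J_after j i (T L') (L' + q i - L)%N ji) => //; first by lia.
      by rewrite -TD -TB; [rewrite subKn // ltnW | lia].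
  - subst i; apply: (@J_return j (T L') (L - L')%N) => //; first by lia.
    by rewrite -LE.
have := @F_cross j (T L) _ JL nJS CL.
by rewrite -TB // -orb_add kE; congr (~ Eo (orb _ _ _)); lia.
Qed.

Lemma orbit_in_C_wandering t0 x0 k : safe t0 -> C x0 ->
  C (orb t0 x0 k) \/ wandering (t0 + k%:R * rho).
Proof.
move=> st Cx; have [|[j [L [Lk kL JL]]]] := orbit_in_C k st Cx; [by left|right].
exists j, (k - L)%N; split; first by lia.
by rewrite natrB ?(ltnW Lk) // mulrBl opprB addrCA addrK addrC.
Qed.

End OrbitLemma.

(** * Densities of wandering and unsafe times *)

Section Counting.

Definition cnt (P : nat -> Prop) (m : nat) : nat := (\sum_(s < m) `[< P s >])%N.

Lemma cntS P m : cnt P m.+1 = (cnt P m + `[< P m >])%N.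
Proof. by rewrite /cnt big_ord_recr. Qed.

Lemma cnt_le (P Q : nat -> Prop) m :
  (forall s, (s < m)%N -> P s -> Q s) -> (cnt P m <= cnt Q m)%N.
Proof.
move=> PQ; apply: leq_sum => s _; case: (asboolP (P s)) => // Ps.
by rewrite asboolT //; apply: PQ.
Qed.

Lemma cnt_mono P m n : (m <= n)%N -> (cnt P m <= cnt P n)%N.
Proof.
move=> /subnK <-; elim: (n - m)%N => // k IH.
by rewrite addSn cntS; apply: leq_trans IH (leq_addr _ _).
Qed.

Lemma cntU (P Q : nat -> Prop) m : (cnt (fun s => P s \/ Q s) m <= cnt P m + cnt Q m)%N.
Proof.
rewrite /cnt -big_split /=; apply: leq_sum => s _.
by case: (asboolP (P s \/ Q s)) => // -[h|h]; rewrite (asboolT h) ?addn1.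
Qed.

Lemma cnt_ltn P m c : (cnt (fun s => (s < c)%N \/ P s) m <= c + cnt P m)%N.
Proof.
apply: leq_trans (cntU _ _ m) _; rewrite leq_add2r.
elim: m => [|m IH]; first by rewrite /cnt big_ord0.
rewrite cntS; case: asboolP => [mc|_]; last by rewrite addn0.
suff : (cnt (fun s => (s < c)%N) m <= m)%N by lia.
by elim: m {IH mc} => [|m IH]; rewrite ?cntS; [rewrite /cnt big_ord0|case: asboolP; lia].
Qed.

Lemma cnt_exists n (P : nat -> nat -> Prop) m :
  (cnt (fun s => exists2 i, (i < n)%N & P i s) m <= \sum_(i < n) cnt (P i) m)%N.
Proof.
elim: n => [|n IH].
  by rewrite big_ord0 /cnt big1 // => s _; case: asboolP => // -[i].
rewrite big_ord_recr /=; apply: leq_trans (leq_add IH (leqnn _)).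
apply: leq_trans (cntU _ _ m); apply: cnt_le => s _ [i].
by rewrite ltnS leq_eqVlt => /orP[/eqP->|h Pi]; [right|left; exists i].
Qed.

Lemma cnt_window a W m : (cnt (fun s => (a <= s < a + W)%N) m <= W)%N.
Proof.
suff : (cnt (fun s => (a <= s < a + W)%N) m <= minn W (m - a))%N by lia.
elim: m => [|m IH]; first by rewrite /cnt big_ord0.
by rewrite cntS; case: asboolP; lia.
Qed.

(** Turns a count of excursion times into a count of visits: each visit accounts for one window of W
    times. *)
Lemma cnt_cover (P H : nat -> Prop) (lo : nat -> nat) W m n :
  (forall s, (s < m)%N -> P s ->
     exists t, [/\ (t < n)%N, H t & (lo t <= s < lo t + W)%N]) ->
  (cnt P m <= W * cnt H n)%N.
Proof.
elim: n P => [|n IH] P PH.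
  rewrite [leqLHS](_ : _ = 0%N) // /cnt big1 // => s _; case: asboolP => // Ps.
  by have [t []] := PH s (ltn_ord s) Ps.
pose P' s := exists t, [/\ (t < n)%N, H t & (lo t <= s < lo t + W)%N].
have IH' : (cnt P' m <= W * cnt H n)%N by apply: IH.
rewrite cntS mulnDr; case: (asboolP (H n)) => Hn; last first.
  rewrite muln0 addn0; apply: leq_trans IH'; apply: cnt_le => s sm Ps.
  have [t [tn Ht ts]] := PH s sm Ps; exists t; split=> //.
  by rewrite ltnS leq_eqVlt in tn; case/orP: tn => // /eqP tn; subst t.
rewrite muln1; apply: leq_trans (leq_add IH' (cnt_window (lo n) W m)).
apply: leq_trans (cntU _ _ m); apply: cnt_le => s sm Ps.
have [t [tn Ht ts]] := PH s sm Ps.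
rewrite ltnS leq_eqVlt in tn; case/orP: tn => [/eqP tn|tn]; first by right; subst t.
by left; exists t.
Qed.

Lemma cnt_gap (H : nat -> Prop) P b n : (0 < P)%N ->
  (forall t, H t -> (b <= t)%N) ->
  (forall t k, H t -> (0 < k < P)%N -> ~ H (t + k)%N) ->
  (P * cnt H n <= n + P - 1 - b)%N.
Proof.
move=> P0 Hb gap; elim/ltn_ind: n => -[|n] IH; first by rewrite /cnt big_ord0 muln0.
rewrite cntS; case: (asboolP (H n)) => Hn; last first.
  by rewrite addn0; have := IH n (ltnSn n); lia.
have bn := Hb n Hn.
(* The P - 1 times before a hit contain no hit, so the induction may jump back by P. *)
have E : (cnt H n <= cnt H (n.+1 - P))%N.
  have : forall k, (n - k >= n.+1 - P)%N -> (k <= n)%N ->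
      (cnt H n <= cnt H (n - k))%N.
    elim=> [|k IHk] h kn; first by rewrite subn0.
    apply: leq_trans (IHk _ _) _; [lia|lia|].
    rewrite (_ : (n - k)%N = (n - k.+1).+1); last by lia.
    rewrite cntS; case: asboolP; last by rewrite addn0.
    move=> Ht; exfalso; apply: (gap _ k.+1 Ht); first by lia.
    by rewrite subnK.
  by move=> /(_ (n - (n.+1 - P))%N) h; apply: leq_trans (h _ _) _; [lia|lia|apply: cnt_mono; lia].
have [nP|Pn] := leqP P n.+1; last first.
  have : cnt H (n.+1 - P) = 0%N by rewrite (_ : (n.+1 - P = 0)%N) ?/cnt ?big_ord0 //; lia.
  nia.
have := IH (n.+1 - P)%N ltac:(lia); nia.
Qed.

(** Visits are more than 2KM apart and each costs at most M + 1 times. The overshoot M of the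
    observation window is absorbed by replacing 2K with 2K - 1, and M >= 2 gives 2(M + 1) <= 3M; the
    proportion is thus 3 / (2(2K - 1)), up to one extra window. *)
Lemma cnt_level (H : nat -> Prop) (K M W m n c : nat) : (0 < K)%N -> (2 <= M)%N ->
  (W <= M + 1)%N -> (n <= m + M + 1)%N -> (c <= W * cnt H n)%N ->
  (forall t k, H t -> (0 < k <= 2 * K * M)%N -> ~ H (t + k)%N) ->
  (2 * (2 * K - 1) * c <= 3 * m + 2 * (2 * K - 1) * (M + 1))%N.
Proof.
move=> K0 M2 WM nm cW gap.
have := @cnt_gap H (2 * K * M).+1 0 n isT (fun _ _ => isT).
move=> /(_ (fun t k Ht => gap t k Ht)); move: cW; set Q := cnt H n => cW h.
have {}h : ((2 * K * M).+1 * Q <= m + M + 1 + 2 * K * M)%N by lia.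
have [Q0|Qp] := posnP Q; first by move: cW; rewrite Q0 muln0 leqn0 => /eqP ->; rewrite muln0.
have h2 : ((2 * K - 1) * M * (Q - 1) <= m)%N by nia.
have h3 : (2 * W * (Q - 1) <= 3 * M * (Q - 1))%N by nia.
have h4 : (c <= (M + 1) + W * (Q - 1))%N by nia.
nia.
Qed.

(** Without early visits the extra window of [cnt_level] disappears. This matters because the bound
    is later summed over unboundedly many levels. *)
Lemma cnt_level0 (H : nat -> Prop) (K M W m n c : nat) : (0 < K)%N -> (2 <= M)%N ->
  (W <= M + 1)%N -> (n <= m + M + 1)%N -> (c <= W * cnt H n)%N ->
  (forall t, (t <= 2 * K * M)%N -> ~ H t) ->
  (forall t k, H t -> (0 < k <= 2 * K * M)%N -> ~ H (t + k)%N) ->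
  (2 * (2 * K - 1) * c <= 3 * m)%N.
Proof.
move=> K0 M2 WM nm cW H0 gap.
have := @cnt_gap H (2 * K * M).+1 (2 * K * M).+1 n isT.
have Hb t : H t -> ((2 * K * M).+1 <= t)%N.
  by move=> Ht; rewrite ltnNge; apply/negP => h; apply: (H0 t h Ht).
move=> /(_ Hb (fun t k Ht => gap t k Ht)); move: cW; set Q := cnt H n => cW h.
have {}h : ((2 * K * M).+1 * Q <= m + M)%N by lia.
have [Q0|Qp] := posnP Q; first by move: cW; rewrite Q0 muln0 leqn0 => /eqP ->; rewrite muln0.
have h2 : ((2 * K - 1) * M * Q <= m)%N by nia.
have h3 : (2 * W * Q <= 3 * M * Q)%N by nia.
nia.
Qed.

End Counting.

Section Density.
Variables (R : realType) (rho : R) (J : nat -> set R) (p q K M : nat -> nat).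
Hypothesis p_le : forall n, (p n <= M n)%N.
Hypothesis q_le : forall n, (q n <= M n + 1)%N.
Hypothesis M_ge2 : forall n, (n + 2 <= M n)%N.
Hypothesis J_return : forall j t k,
  (1 <= k <= 2 * K j * M j)%N -> J j t -> ~ J j (t + k%:R * rho).
Hypothesis K_sum : forall n, \sum_(i < n) (K i)%:R^-1 <= 191 / 2000 :> R.
Hypothesis K_gt0 : forall n, (0 < K n)%N.

(** Two-sided: the past controls wandering times, while a run-up that has begun before the present
    may end at a visit in the future. *)
Definition good (j : nat) : set R := [set t | forall i l,
  (j <= i)%N -> (l <= 2 * K i * M i)%N -> ~ J i (t - l%:R * rho) /\ ~ J i (t + l%:R * rho)].

(** Additive error from the levels below j: a window of [M i + 1] times, plus at most [M i] times
    for a run-up that straddles the present. *)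
Definition slack (j : nat) : nat := (\sum_(i < j) (2 * M i + 1))%N.

Lemma K_ge10 n : (10 <= K n)%N.
Proof.
have := K_sum n.+1; rewrite big_ord_recr /= => h.
have h0 : 0 <= \sum_(i < n) ((K i)%:R^-1 : R) by apply: sumr_ge0.
have h1 : (K n)%:R^-1 <= 191 / 2000 :> R by lra.
have Kp : 0 < (K n)%:R :> R by rewrite ltr0n.
rewrite leqNgt; apply/negP => Kn.
have : (K n)%:R <= 9 :> R by rewrite (ler_nat R _ 9); lia.
have : (K n)%:R * (K n)%:R^-1 = 1 :> R by rewrite divff ?gt_eqF.
move: h1 Kp; set x := (K n)%:R; set y := x^-1 => h1 Kp xy x9; nra.
Qed.

(** For K >= 10 the level proportion 3 / (2(2K - 1)) is at most 15 / (19 K), and 15/19 * 191/2000 is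
    less than 1/12. *)
Lemma density_sum (P : nat -> nat -> Prop) j m n : (j <= n)%N ->
  (forall i, (2 * (2 * K i - 1) * cnt (P i) m <=
     3 * m + (if (i < j) then 2 * (2 * K i - 1) * (2 * M i + 1) else 0))%N) ->
  (12 * cnt (fun s => exists2 i, (i < n)%N & P i s) m <= m + 12 * slack j)%N.
Proof.
move=> jn h.
have hi i : (cnt (P i) m)%:R <= 15 / 19 * m%:R * (K i)%:R^-1 +
    (if (i < j)%N then (2 * M i + 1)%:R else 0) :> R.
  have {}h := h i; have K10 := K_ge10 i.
  have {}h : (19 * K i * cnt (P i) m <=
      15 * m + 19 * K i * (if (i < j) then 2 * M i + 1 else 0))%N.
    by move: h; case: ifP => _ h; nia.
  have Kp : 0 < (K i)%:R :> R by rewrite ltr0n.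
  have -> : (if (i < j)%N then (2 * M i + 1)%:R else 0) =
      (if (i < j)%N then (2 * M i + 1)%N else 0%N)%:R :> R by case: ifP.
  move: h; set u := (if _ then _ else _); set c := cnt _ _.
  rewrite -(ler_nat R) natrD !natrM => h.
  have E : (K i)%:R * (K i)%:R^-1 = 1 :> R by rewrite divff ?gt_eqF.
  rewrite -(ler_pM2l Kp) mulrDr [X in X + _]mulrCA E mulr1; lra.
have : (\sum_(i < n) cnt (P i) m)%:R <= m%:R / 12 + (slack j)%:R :> R.
  rewrite natr_sum; apply: le_trans; first by apply: ler_sum => i _; exact: hi.
  rewrite big_split /= -mulr_sumr; apply: lerD.
    have := K_sum n; have : 0 <= m%:R :> R by [].
    set x := \sum_(i < n) _; set y := m%:R; nra.
  rewrite /slack natr_sum -(subnKC jn) big_split_ord /= [X in _ + X]big1 ?addr0.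
    by apply: ler_sum => i _ /=; rewrite ltn_ord.
  by move=> i _; rewrite /= ltnNge leq_addr.
have := cnt_exists n P m; rewrite -(ler_nat R) => h1 h2.
rewrite -(ler_nat R) natrD !natrM; lra.
Qed.

Lemma gap_hits j t : forall s k, J j (t - s%:R * rho) -> (0 < k <= 2 * K j * M j)%N ->
  ~ J j (t - (s + k)%:R * rho).
Proof.
move=> s k Js kK Jsk; apply: (J_return kK Jsk).
by rewrite natrD mulrDl opprD addrA subrK.
Qed.

Lemma wandering_density j t m : good j t ->
  (12 * cnt (fun s => wandering rho J q (t - s%:R * rho)) m <= m + 12 * slack j)%N.
Proof.
move=> gt.
pose P i s := exists2 l, (1 <= l <= q i)%N & J i (t - (s + l)%:R * rho).
pose n := (j + m)%N.
apply: leq_trans (_ : (12 * cnt (fun s => exists2 i, (i < n)%N & P i s) m <= _)%N).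
  rewrite leq_mul2l /=; apply: cnt_le => s sm [i [l [lq Jl]]].
  have {}Jl : J i (t - (s + l)%:R * rho).
    by move: Jl; rewrite natrD mulrDl opprD addrA.
  exists i; last by exists l.
  (* A level i >= j + m is visited at no time up to [2 * K i * M i], which exceeds [m + q i] since
     [M i] is at least i + 2; only finitely many levels contribute. *)
  rewrite ltnNge; apply/negP => ni.
  have := gt i (s + l)%N ltac:(lia); have := K_ge10 i; have := M_ge2 i; have := q_le i.
  by move=> h1 h2 h3 /(_ ltac:(nia)) [].
apply: density_sum => [|i]; first by lia.
have K0 := K_gt0 i; have M2 : (2 <= M i)%N by have := M_ge2 i; lia.
have cov : (cnt (P i) m <= q i * cnt (fun s => J i (t - s%:R * rho)%R) (m + q i))%N.
  apply: (@cnt_cover _ _ (fun s => (s - q i)%N)) => s sm [l lq Jl].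
  by exists (s + l)%N; split=> //; lia.
have qM := q_le i; have nm : (m + q i <= m + M i + 1)%N by lia.
have gap := @gap_hits i t.
case: ifP => ij.
  have := cnt_level K0 M2 qM nm cov gap.
  by move/leq_trans; apply; rewrite leq_add2l leq_mul2l; apply/orP; right; lia.
rewrite addn0; apply: (cnt_level0 K0 M2 qM nm cov _ gap) => s sK.
by have [] := gt i s ltac:(lia) sK.
Qed.

Lemma unsafe_density j t m : good j t ->
  (12 * cnt (fun s => ~ safe rho J p (t - s%:R * rho)) m <= m + 12 * slack j)%N.
Proof.
move=> gt.
pose P i s := exists2 l, (l < p i)%N & J i (t - s%:R * rho + l%:R * rho).
pose n := (j + m)%N.
apply: leq_trans (_ : (12 * cnt (fun s => exists2 i, (i < n)%N & P i s) m <= _)%N).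
  rewrite leq_mul2l /=; apply: cnt_le => s sm /existsNP[i /existsNP[l]].
  move=> /not_implyP[lp /contrapT Jl].
  exists i; last by exists l.
  rewrite ltnNge; apply/negP => ni.
  have := K_ge10 i; have := M_ge2 i; have := p_le i => h1 h2 h3.
  have [sl|ls] := leqP s l.
    have [_ []] := gt i (l - s)%N ltac:(lia) ltac:(nia).
    by move: Jl; rewrite natrB // mulrBl addrAC addrA.
  have [nJ _] := gt i (s - l)%N ltac:(lia) ltac:(nia); apply: nJ.
  by move: Jl; rewrite natrB ?(ltnW ls) // mulrBl opprB addrA addrAC.
apply: density_sum => [|i]; first by lia.
have K0 := K_gt0 i; have M2 : (2 <= M i)%N by have := M_ge2 i; lia.
pose P' s := exists l, [/\ (l < p i)%N, (l <= s)%N & J i (t - (s - l)%:R * rho)].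
have cov : (cnt P' m <= p i * cnt (fun s => J i (t - s%:R * rho)%R) m)%N.
  apply: (@cnt_cover _ _ id) => s sm [l [lp ls Jl]].
  by exists (s - l)%N; split=> //; lia.
have pM : (p i <= M i + 1)%N by have := p_le i; lia.
have nm : (m <= m + M i + 1)%N by lia.
have PP' s : P i s -> P' s \/ exists2 l, (s < l < p i)%N & J i (t + (l - s)%:R * rho).
  case=> l lp Jl; have [ls|sl] := leqP l s.
    left; exists l; split=> //.
    by move: Jl; rewrite natrB // mulrBl opprB addrA addrAC.
  right; exists l; first by rewrite sl.
  by move: Jl; rewrite natrB ?(ltnW sl) // mulrBl addrAC addrA.
have gap := @gap_hits i t.
case: ifP => ij.
  have c1 : (cnt (P i) m <= p i + cnt P' m)%N.
    apply: leq_trans (cnt_ltn _ _ _); apply: cnt_le => s sm /PP'[?|[l sl _]]; [by right|left].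
    by lia.
  have := cnt_level K0 M2 pM nm cov gap; have := p_le i; move: c1.
  set a := cnt _ _; set b := cnt _ _; nia.
rewrite addn0.
have c1 : (cnt (P i) m <= cnt P' m)%N.
  apply: cnt_le => s sm /PP'[//|[l sl Jl]]; exfalso.
  have := p_le i => h; have [_ []] := gt i (l - s)%N ltac:(lia) ltac:(nia).
  exact: Jl.
have := cnt_level0 K0 M2 pM nm cov _ gap.
move=> /(_ (fun s sK => (gt i s ltac:(lia) sK).1)); apply: leq_trans.
by rewrite leq_mul2l c1 orbT.
Qed.

End Density.

(** * Contraction along orbits *)

Section ContractionEstimate.
Variables (R : realType) (a kick eta : R) (D : nat -> R) (bad : nat -> Prop) (m c : nat).
Hypothesis a_gt1 : 1 < a.
Hypothesis a_exp3 : 2 <= a ^+ 3.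
Hypothesis kick_ge0 : 0 <= kick.
Hypothesis D_ge0 : forall s, 0 <= D s.
Hypothesis D_step : forall s, (s < m)%N -> D s <= a ^+ 12 * D s.+1 + kick.
Hypothesis D_contr : forall s, (s < m)%N -> ~ bad s -> D s.+1 < eta ->
  D s <= a ^- 6 * D s.+1 + kick.
Hypothesis bad_density : forall s, (s <= m)%N -> (6 * cnt bad s <= s + 6 * c)%N.
Hypothesis D_small : (D m + kick * m%:R) * a ^+ (2 * m + 12 * c) < eta.

Let a_ge1 : 1 <= a. Proof. exact: ltW. Qed.
Let a_ge0 : 0 <= a. Proof. by apply: le_trans a_ge1. Qed.

(** Bootstrap for the local contraction: good steps are counted as neutral and bad ones as
    [a ^+ 12]. With at most m/6 + c bad steps the total factor is at most [a ^+ (2 * m + 12 * c)],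
    and [D_small] keeps every distance below eta. *)
Lemma D_bounded k : (k <= m)%N ->
  D (m - k) <= (D m + kick * k%:R) * a ^+ (12 * (cnt bad m - cnt bad (m - k))) /\
  D (m - k) < eta.
Proof.
have small k' : (k' <= m)%N ->
    (D m + kick * k'%:R) * a ^+ (12 * (cnt bad m - cnt bad (m - k'))) < eta.
  move=> km; apply: le_lt_trans D_small; apply: ler_pM.
  - by rewrite addr_ge0 // mulr_ge0.
  - by rewrite exprn_ge0.
  - by rewrite lerD2l ler_wpM2l // ler_nat.
  - rewrite ler_weXn2l //; have := bad_density (leqnn m); lia.
suff H k' : (k' <= m)%N -> D (m - k') <= (D m + kick * k'%:R) *
    a ^+ (12 * (cnt bad m - cnt bad (m - k'))).
  by move=> km; split; [apply: H|apply: le_lt_trans (H _ km) (small _ km)].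
elim: k' => [_|k' IH km].
  by rewrite subn0 subnn muln0 expr0 mulr1 mulr0 addr0.
have {}IH := IH (ltnW km); have sm := small k' (ltnW km).
have E : (m - k')%N = (m - k'.+1).+1 by lia.
move: IH sm; rewrite E; set r := (m - k'.+1)%N => IH sm.
have rm : (r < m)%N by rewrite /r; lia.
have crm : (cnt bad r.+1 <= cnt bad m)%N by apply: cnt_mono.
have cr := cntS bad r.
set Q := (cnt bad m - cnt bad r)%N; rewrite -natr1 mulrDr mulr1 addrA.
have Q1 : 1 <= a ^+ (12 * Q) by rewrite exprn_ege1.
rewrite mulrDl; case: (asboolP (bad r)) cr => br cr.
  have -> : a ^+ (12 * Q) = a ^+ 12 * a ^+ (12 * (cnt bad m - cnt bad r.+1)).
    by rewrite -exprD; congr (_ ^+ _); rewrite /Q; lia.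
  rewrite mulrCA; apply: le_trans (D_step rm) _; apply: lerD.
    by rewrite ler_wpM2l // exprn_ge0.
  by rewrite ler_peMr // -exprD exprn_ege1.
have -> : Q = (cnt bad m - cnt bad r.+1)%N by rewrite /Q cr addn0.
apply: le_trans (D_contr rm br (le_lt_trans IH sm)) _; apply: lerD.
  apply: le_trans IH; rewrite ler_piMl // invf_le1 ?exprn_ege1 ?exprn_gt0 //.
  exact: lt_le_trans a_ge1.
by rewrite ler_peMr // exprn_ege1.
Qed.

Let rate s := if `[< bad s >] then a ^+ 12 else a ^- 6.
Let gain s := \prod_(r < s) rate r.

Lemma gainE s : gain s * a ^+ (6 * s) = a ^+ (18 * cnt bad s).
Proof.
have a0 : a != 0 by rewrite gt_eqF // (lt_le_trans _ a_ge1).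
elim: s => [|s IH]; first by rewrite /gain big_ord0 /cnt big_ord0 !muln0 !expr0 mulr1.
rewrite /gain big_ord_recr /= -/(gain s) cntS mulnDr exprD -IH mulnS exprD.
rewrite /rate; case: ifP => _ /=.
  have -> : a ^+ (18 * true) = a ^+ 12 * a ^+ 6 by rewrite -exprD.
  ring.
by rewrite muln0 expr0 mulr1 mulrA mulfVK // expf_neq0.
Qed.

Lemma gain_le s : (s <= m)%N -> gain s <= a ^+ (18 * c) * a ^- (3 * s).
Proof.
move=> sm; have a0 : 0 < a by apply: lt_le_trans a_ge1.
have := gainE s; have E : a ^+ (6 * s) = a ^+ (3 * s) * a ^+ (3 * s).
  by rewrite -exprD; congr (_ ^+ _); lia.
rewrite E mulrA => h.
rewrite -(ler_pM2r (exprn_gt0 (3 * s) a0)) mulfVK ?expf_neq0 ?gt_eqF //.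
rewrite -(ler_pM2r (exprn_gt0 (3 * s) a0)) h -exprD ler_weXn2l //.
by have := bad_density sm; lia.
Qed.

(** Now that every step is covered by its rate, the inequalities multiply out. The product over s
    steps is [a] to the power 18 times the number of bad steps minus 6s, hence at most 18c - 3s; as
    [a ^+ 3] is at least 2, the kicks form a geometric series with sum below 2. *)
Lemma contraction_estimate :
  D 0%N <= a ^+ (18 * c) * (a ^- (3 * m) * D m + 2 * kick).
Proof.
have a0 : 0 < a by apply: lt_le_trans a_ge1.
have rate_ge0 s : 0 <= rate s by rewrite /rate; case: ifP => _; rewrite ?invr_ge0 exprn_ge0.
have gain_ge0 s : 0 <= gain s by apply: prodr_ge0.
have step s : (s < m)%N -> D s <= rate s * D s.+1 + kick.
  move=> sm; rewrite /rate; case: asboolP => bs; first exact: D_step.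
  apply: D_contr => //.
  have := (@D_bounded (m - s.+1)%N ltac:(lia)).2.
  by rewrite subKn.
have H s : (s <= m)%N -> D 0%N <= gain s * D s + kick * \sum_(r < s) gain r.
  elim: s => [_|s IH sm]; first by rewrite /gain !big_ord0 mul1r mulr0 addr0.
  apply: le_trans (IH (ltnW sm)) _.
  rewrite [X in _ <= _ + kick * X]big_ord_recr /= mulrDr.
  rewrite [leRHS]addrCA [leLHS]addrC lerD2l.
  rewrite {2}/gain big_ord_recr /= -/(gain s).
  apply: le_trans (ler_wpM2l (gain_ge0 s) (step s sm)) _.
  by rewrite mulrDr -mulrA (mulrC kick) addrC.
apply: le_trans (H m (leqnn m)) _; rewrite mulrDr; apply: lerD.
  by rewrite [leRHS]mulrA; apply: ler_wpM2r => //; apply: gain_le.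
rewrite [leRHS]mulrA [leRHS]mulrC; apply: ler_wpM2l => //.
have G : \sum_(r < m) gain r <= \sum_(r < m) a ^+ (18 * c) * (2^-1) ^+ r.
  apply: ler_sum => r _; apply: le_trans (gain_le (ltnW (ltn_ord r))) _.
  rewrite ler_wpM2l ?exprn_ge0 // exprM -exprVn lerXn2r ?nnegrE ?invr_ge0 ?exprn_ge0 //.
  by rewrite lef_pV2 ?posrE ?exprn_gt0.
apply: le_trans G _; rewrite -mulr_sumr; apply: ler_wpM2l; rewrite ?exprn_ge0 //.
suff -> : \sum_(r < m) (2^-1 : R) ^+ r = 2 - 2 * 2^-1 ^+ m.
  by rewrite gerBl mulr_ge0 // exprn_ge0.
elim: (m) => [|k IH]; first by rewrite big_ord0 expr0; lra.
by rewrite big_ord_recr /= IH exprS; lra.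
Qed.

End ContractionEstimate.

(** * Trapping systems and Lipschitz dependence of their invariant graphs *)

Section Trapping.
Variable R : realType.

Lemma closed_arc_eqZ (b c x y : R) : eqZ x y -> closed_arc b c x -> closed_arc b c y.
Proof.
by move=> /eqZ_sym[k ->] [l h]; exists (l - k); rewrite intrB addrACA subrr addr0 in h *.
Qed.

Lemma open_arc_eqZ (b c x y : R) : eqZ x y -> open_arc b c x -> open_arc b c y.
Proof.
by move=> /eqZ_sym[k ->] [l h]; exists (l - k); rewrite intrB addrACA subrr addr0 in h *.
Qed.

Lemma open_arc_sub (b c : R) : open_arc b c `<=` closed_arc b c.
Proof. by move=> x [k /andP[h1 h2]]; exists k; rewrite !ltW. Qed.

(* Here a is the sixth root of alpha, so that every rate below is an integer
   power of a. [fst_step] tells whether a fibre map contracts along a step that starts in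
   the arc [cm, cp] (the case of f) or along one that ends in it (the case of
   the inverse of f, which contracts where it lands in E). *)
Record trapping (rho : R) (F : R -> R -> R) (J : nat -> set R) (cm cp : R)
    (Eo : set R) (p q K M : nat -> nat) (a S eta : R) (fst_step : bool) : Prop := {
  tr_q_inc : forall n, (q n < q n.+1)%N;
  tr_q_gt0 : (0 < q 0)%N;
  tr_p_le : forall n, (p n <= M n)%N;
  tr_q_le : forall n, (q n <= M n + 1)%N;
  tr_M_ge : forall n, (n + 2 <= M n)%N;
  tr_return : forall j t k,
    (1 <= k <= 2 * K j * M j)%N -> J j t -> ~ J j (t + k%:R * rho);
  tr_before : forall i j t l, (i < j)%N -> (1 <= l <= q i)%N ->
    J j t -> ~ J i (t - (p j + l)%:R * rho);
  tr_after : forall i j t l, (i < j)%N -> (1 <= l <= q i)%N ->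
    J j t -> ~ J i (t + (q j)%:R * rho - l%:R * rho);
  tr_after' : forall i j t l, (i < j)%N -> (l <= p i)%N ->
    J j t -> ~ J i (t + (q j)%:R * rho + l%:R * rho);
  tr_CE : forall x, closed_arc cm cp x -> ~ Eo x;
  tr_trap : forall t x, ~ J 0%N t -> ~ Eo x -> closed_arc cm cp (F t x);
  tr_cross : forall n t y, J n t -> ~ J n.+1 t -> closed_arc cm cp y ->
    ~ Eo (orb rho F (t - (p n)%:R * rho) y (p n + q n));
  tr_K_sum : forall n, \sum_(i < n) (K i)%:R^-1 <= 191 / 2000 :> R;
  tr_K_gt0 : forall n, (0 < K n)%N;
  tr_cmp1 : cp - cm <= 1;
  tr_a : 1 < a;
  tr_a3 : 2 <= a ^+ 3;
  tr_S : 0 <= S;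
  tr_eta : 0 < eta;
  tr_lip : forall t t' x x', dT (F t x) (F t' x') <= a ^+ 12 * dT x x' + S * dT t t';
  tr_contr : forall t t' x x',
    (if fst_step then closed_arc cm cp x /\ closed_arc cm cp x'
     else closed_arc cm cp (F t x) /\ closed_arc cm cp (F t' x')) ->
    dT x x' < eta -> dT t t' < eta ->
    dT (F t x) (F t' x') <= a ^- 6 * dT x x' + S * dT t t' }.

Variables (rho : R) (F : R -> R -> R) (J : nat -> set R) (cm cp : R)
  (Eo : set R) (p q K M : nat -> nat) (a S eta : R) (fst_step : bool).
Hypothesis sys : trapping rho F J cm cp Eo p q K M a S eta fst_step.

Local Notation C := (closed_arc cm cp).
Local Notation wand := (wandering rho J q).
Local Notation safe := (safe rho J p).
Local Notation good := (good rho J K M).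
Local Notation orb := (orb rho F).

Let a_gt0 : 0 < a. Proof. by apply: lt_trans (tr_a sys). Qed.

Lemma F_eqZ t x x' : eqZ x x' -> eqZ (F t x) (F t x').
Proof.
move=> xx'; apply: dT_eq0; apply/eqP; rewrite eq_le dT_ge0 andbT.
by apply: le_trans (tr_lip sys _ _ _ _) _; rewrite dT_xx (dT_eqZ0 xx') !mulr0 addr0.
Qed.

Lemma orb_eqZ t x x' m : eqZ x x' -> eqZ (orb t x m) (orb t x' m).
Proof. by move=> xx'; elim: m => //= m IH; apply: F_eqZ. Qed.

Lemma trapped t0 x0 k : safe t0 -> C x0 -> C (orb t0 x0 k) \/ wand (t0 + k%:R * rho).
Proof.
apply: (@orbit_in_C_wandering R rho F J C Eo p q) => //; try by case: sys.
move=> j t l h; apply: (tr_return sys).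
have := K_ge10 (tr_K_sum sys) (tr_K_gt0 sys) j.
have := tr_p_le sys j; have := tr_q_le sys j; have := tr_M_ge sys j; nia.
Qed.

(** Twice the slack for two orbits; the 1 pays for the index shift when contraction is read off at
    the start of a step. *)
Let pair_slack j := (2 * slack M j + 1)%N.

Lemma cnt_shift (P : nat -> Prop) m : (cnt (fun s => P s.+1) m <= cnt P m.+1)%N.
Proof. by rewrite /cnt [leqRHS]big_ord_recl leq_addl. Qed.

Lemma wand_density j t m : good j t ->
  (12 * cnt (fun s => wand (t - s%:R * rho)) m <= m + 12 * slack M j)%N.
Proof. by apply: wandering_density; case: sys. Qed.

Lemma pair_estimate j t t' (x x' : nat -> R) m :
  good j t -> good j t' ->
  (forall s, (s < m)%N -> eqZ (x s) (F (t - s.+1%:R * rho) (x s.+1))) ->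
  (forall s, (s < m)%N -> eqZ (x' s) (F (t' - s.+1%:R * rho) (x' s.+1))) ->
  (forall s, (s <= m)%N -> C (x s) \/ wand (t - s%:R * rho)) ->
  (forall s, (s <= m)%N -> C (x' s) \/ wand (t' - s%:R * rho)) ->
  dT t t' < eta ->
  (dT (x m) (x' m) + S * dT t t' * m%:R) * a ^+ (2 * m + 12 * pair_slack j) < eta ->
  dT (x 0%N) (x' 0%N) <=
    a ^+ (18 * pair_slack j) * (a ^- (3 * m) * dT (x m) (x' m) + 2 * (S * dT t t')).
Proof.
move=> gt gt' xs xs' Cx Cx' dtt small.
pose sh s := if fst_step then s.+1 else s.
pose bad s := (~ C (x (sh s))) \/ (~ C (x' (sh s))).
have dtE s : dT (t - s%:R * rho) (t' - s%:R * rho) = dT t t' by rewrite dT_add.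
apply: (@contraction_estimate R a (S * dT t t') eta (fun s => dT (x s) (x' s)) bad).
- exact: tr_a sys.
- exact: tr_a3 sys.
- by rewrite mulr_ge0 ?dT_ge0 // (tr_S sys).
- by move=> s; apply: dT_ge0.
- move=> s sm; rewrite (dT_eqZl _ (xs s sm)) (dT_eqZr _ (xs' s sm)).
  by have := tr_lip sys (t - s.+1%:R * rho) (t' - s.+1%:R * rho) (x s.+1) (x' s.+1); rewrite dtE.
- move=> s sm /not_orP[/contrapT b1 /contrapT b2] De.
  rewrite (dT_eqZl _ (xs s sm)) (dT_eqZr _ (xs' s sm)) -(dtE s.+1).
  apply: (tr_contr sys) => //; last by rewrite dtE.
  move: b1 b2; rewrite /sh; case: ifP => // _ b1 b2; split.
    by apply: closed_arc_eqZ b1; apply: xs.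
  by apply: closed_arc_eqZ b2; apply: xs'.
- move=> s sm.
  have B (u : R) (y : nat -> R) : (forall s, (s <= m)%N -> C (y s) \/ wand (u - s%:R * rho)) ->
      (cnt (fun s => ~ C (y (sh s))) s <= cnt (fun s => wand (u - s%:R * rho)) s.+1)%N.
    move=> Cy; rewrite /sh; case: (fst_step).
      apply: leq_trans (cnt_shift _ _); apply: cnt_le => r rs nC.
      by have [] := Cy r.+1 ltac:(lia).
    apply: leq_trans (cnt_mono _ (leqnSn s)); apply: cnt_le => r rs nC.
    by have [] := Cy r ltac:(lia).
  have := B _ _ Cx; have := B _ _ Cx'; have := wand_density s.+1 gt; have := wand_density s.+1 gt'.
  have : (cnt bad s <= cnt (fun s => ~ C (x (sh s))) s +
                       cnt (fun s => ~ C (x' (sh s))) s)%N by apply: cntU.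
  rewrite /pair_slack; lia.
- exact: small.
Qed.

Lemma orb_back t x m s : (s < m)%N ->
  orb (t - m%:R * rho) x (m - s) = F (t - s.+1%:R * rho) (orb (t - m%:R * rho) x (m - s.+1)).
Proof.
move=> sm; rewrite (_ : (m - s)%N = (m - s.+1).+1) /=; last by lia.
by congr F; rewrite natrB // mulrBl addrA subrK.
Qed.

Lemma trapped_back t x m s : safe (t - m%:R * rho) -> C x -> (s <= m)%N ->
  C (orb (t - m%:R * rho) x (m - s)) \/ wand (t - s%:R * rho).
Proof.
move=> st Cx sm; have := @trapped (t - m%:R * rho) x (m - s) st Cx.
by rewrite natrB // mulrBl addrA subrK.
Qed.

(* Interpolating between u and v inside the arc keeps neighbouring orbits closer
   than eta, where the local contraction of [tr_contr] is available. *)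
Lemma arc_contraction j t u v m : good j t -> safe (t - m%:R * rho) -> C u -> C v ->
  dT (orb (t - m%:R * rho) u m) (orb (t - m%:R * rho) v m) <=
    a ^+ (18 * pair_slack j) * a ^- (3 * m).
Proof.
move=> gt st [k ku] [l lv]; set t0 := t - _.
set A := a ^+ _ * _.
have A0 : 0 <= A by rewrite mulr_ge0 // ?invr_ge0 exprn_ge0 // ltW.
pose u' := u + k%:~R; pose v' := v + l%:~R.
have -> : dT (orb t0 u m) (orb t0 v m) = dT (orb t0 u' m) (orb t0 v' m).
  rewrite (@dT_eqZl _ _ (orb t0 u' m)); last by apply: orb_eqZ; apply: eqZ_sym; exists k.
  by apply: dT_eqZr; apply: orb_eqZ; apply: eqZ_sym; exists l.
have vu1 : `|v' - u'| <= 1.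
  by rewrite ler_norml; have := tr_cmp1 sys; move: ku lv; rewrite -/u' -/v'; lra.
pose B := a ^+ (2 * m + 12 * pair_slack j).
have B0 : 0 < B by rewrite exprn_gt0.
have e0 := tr_eta sys.
(* B is the worst expansion over m steps, so pieces of length 1/N stay below eta all along. Each
   piece ends with length at most A/N, and N of them give A, whatever N is. *)
pose N := (Num.truncn (B / eta)).+1.
have NB : B / eta < N%:R by rewrite /N truncnS_gt.
have N0 : 0 < N%:R :> R by rewrite ltr0n.
pose z i := u' + (v' - u') * (i%:R / N%:R).
have Cz i : (i <= N)%N -> C (z i).
  move=> iN; exists 0; rewrite addr0 /z.
  have h0 : 0 <= i%:R / N%:R :> R by rewrite divr_ge0.
  have h1 : i%:R / N%:R <= 1 :> R by rewrite ler_pdivrMr // mul1r ler_nat.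
  move: ku lv h0 h1; rewrite -/u' -/v'; set y := _ / _.
  move=> /andP[h1 h2] /andP[h3 h4] h5 h6.
  have g1 : 0 <= (1 - y) * (u' - cm) by rewrite mulr_ge0; lra.
  have g2 : 0 <= y * (v' - cm) by rewrite mulr_ge0; lra.
  have g3 : 0 <= (1 - y) * (cp - u') by rewrite mulr_ge0; lra.
  have g4 : 0 <= y * (cp - v') by rewrite mulr_ge0; lra.
  apply/andP; split; lra.
have zz i : dT (z i) (z i.+1) <= N%:R^-1.
  apply: le_trans (dT_le0 _ _) _.
  have -> : z i - z i.+1 = - ((v' - u') * N%:R^-1) by rewrite /z -natr1; field; lra.
  have Ni : 0 <= N%:R^-1 :> R by rewrite invr_ge0 ltW.
  rewrite normrN normrM (ger0_norm Ni).
  exact: ler_piMl.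
have step i : (i < N)%N -> dT (orb t0 (z i) m) (orb t0 (z i.+1) m) <= A * N%:R^-1.
  move=> iN.
  have := @pair_estimate j t t (fun s => orb t0 (z i) (m - s))
    (fun s => orb t0 (z i.+1) (m - s)) m gt gt.
  rewrite dT_xx !mulr0 mul0r !addr0 subnn subn0 mulrA -/A /= => H.
  apply: le_trans (H _ _ _ _ _ _) _ => //.
  - by move=> s sm; rewrite /t0 orb_back //; apply: eqZ_refl.
  - by move=> s sm; rewrite /t0 orb_back //; apply: eqZ_refl.
  - by move=> s sm; apply: trapped_back => //; apply: Cz; apply: ltnW.
  - by move=> s sm; apply: trapped_back => //; apply: Cz.
  - apply: le_lt_trans (ler_wpM2r (ltW B0) (zz i)) _.
    have NB' : B < N%:R * eta by rewrite -ltr_pdivrMr.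
    by rewrite [ltLHS]mulrC ltr_pdivrMr // [ltRHS]mulrC.
  - by rewrite ler_wpM2l.
have H i : (i <= N)%N -> dT (orb t0 (z 0%N) m) (orb t0 (z i) m) <= i%:R * (A * N%:R^-1).
  elim: i => [_|i IH iN]; first by rewrite dT_xx mul0r.
  apply: le_trans (dT_tri (orb t0 (z i) m) _ _) _; rewrite -natr1 mulrDl mul1r.
  by apply: lerD; [apply: IH; apply: ltnW|apply: step].
have := H N (leqnn N).
have -> : z 0%N = u' by rewrite /z mul0r mulr0 addr0.
have -> : z N = v' by rewrite /z divff ?gt_eqF // mulr1 addrC subrK.
by rewrite mulrCA divff ?mulr1 // gt_eqF.
Qed.

Variable phi : R -> R.

Definition tracked : set R := [set t | forall s : nat,
  eqZ (phi (t - s%:R * rho)) (F (t - s.+1%:R * rho) (phi (t - s.+1%:R * rho))) /\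
  (C (phi (t - s%:R * rho)) \/ wand (t - s%:R * rho))].

Lemma invariant_orb t m :
  (forall s : nat, eqZ (phi (t - s%:R * rho)) (F (t - s.+1%:R * rho) (phi (t - s.+1%:R * rho)))) ->
  eqZ (phi t) (orb (t - m%:R * rho) (phi (t - m%:R * rho)) m).
Proof.
move=> tt; rewrite -{1}[t]subr0 -(mul0r rho).
suff H s : (s <= m)%N -> eqZ (phi (t - (m - s)%:R * rho))
    (orb (t - m%:R * rho) (phi (t - m%:R * rho)) s).
  by have := H m (leqnn m); rewrite subnn.
elim: s => [_|s IH sm]; first by rewrite subn0; apply: eqZ_refl.
apply: eqZ_trans (tt (m - s.+1)%N) _ => /=.
have E : (m - s.+1).+1 = (m - s)%N by lia.
have E2 : t - (m - s)%:R * rho = t - m%:R * rho + s%:R * rho.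
  by rewrite natrB ?(ltnW sm) //; ring.
rewrite E -E2; apply: F_eqZ.
exact: IH (ltnW sm).
Qed.

Lemma tracked_orb t m : tracked t -> eqZ (phi t) (orb (t - m%:R * rho) (phi (t - m%:R * rho)) m).
Proof. by move=> tt; apply: invariant_orb => s; have [] := tt s. Qed.

(** The window holds 12k + 1 times. Each of the three exclusions takes at most (42k + 1)/12 plus the
    slack, and the slack is below k/2, so together they take fewer than 12k. The third exclusion
    lets an orbit over t' start afresh from C. *)
Lemma common_good_time j t t' k : good j t -> good j t' -> (2 * slack M j + 1 <= k)%N ->
  exists m, [/\ (30 * k <= m <= 42 * k)%N, ~ wand (t - m%:R * rho),
    ~ wand (t' - m%:R * rho) & safe (t' - m%:R * rho)].
Proof.
move=> gt gt' ck; apply: contrapT => H.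
pose P1 s := wand (t - s%:R * rho); pose P2 s := wand (t' - s%:R * rho).
pose P3 s := ~ safe (t' - s%:R * rho); pose m := (42 * k).+1.
have h1 : (12 * cnt P1 m <= m + 12 * slack M j)%N by apply: wand_density.
have h2 : (12 * cnt P2 m <= m + 12 * slack M j)%N by apply: wand_density.
have h3 : (12 * cnt P3 m <= m + 12 * slack M j)%N.
  by apply: (unsafe_density _ _ _ _ _ _ gt'); case: sys.
have h4 : (12 * k + 1 <= cnt (fun s => P1 s \/ P2 s \/ P3 s) m)%N.
  have G i : (i <= 12 * k + 1)%N ->
      (i <= cnt (fun s => P1 s \/ P2 s \/ P3 s) (30 * k + i))%N.
    elim: i => // i IH ik; rewrite addnS cntS asboolT ?addn1.
      by rewrite ltnS; apply: IH; lia.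
    apply: contrapT => /not_orP[n1 /not_orP[n2 /contrapT n3]].
    by apply: H; exists (30 * k + i)%N; split=> //; lia.
  by have := G (12 * k + 1)%N (leqnn _); rewrite (_ : (30 * k + _ = m)%N) // /m; lia.
have := cntU P1 (fun s => P2 s \/ P3 s) m; have := cntU P2 P3 m.
by move: h1 h2 h3 h4; rewrite /m; lia.
Qed.

Lemma expa_mono m n : (m <= n)%N -> a ^+ m <= a ^+ n.
Proof. by move=> mn; rewrite ler_weXn2l // ltW // (tr_a sys). Qed.

Lemma expaV_mono m n : (m <= n)%N -> a ^- n <= a ^- m.
Proof. by move=> mn; rewrite lef_pV2 ?posrE ?exprn_gt0 // expa_mono. Qed.

Lemma expa_ge (k : nat) : k%:R <= a ^+ (3 * k) /\ k%:R * k%:R <= a ^+ (6 * k).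
Proof.
have h : k%:R <= a ^+ (3 * k).
  rewrite exprM; apply: le_trans (_ : 2 ^+ k <= _); last first.
    by rewrite lerXn2r ?nnegrE ?exprn_ge0 ?(tr_a3 sys) // ltW.
  by rewrite -natrX ler_nat ltnW // ltn_expl.
split=> //; have -> : (6 * k = 3 * k + 3 * k)%N by lia.
by rewrite exprD ler_pM.
Qed.

Lemma tracked_lipschitz j : exists r L : R, 0 < r /\ forall t t',
  good j t -> good j t' -> tracked t -> tracked t' -> `|t - t'| < r ->
  dT (phi t) (phi t') <= L * `|t - t'|.
Proof.
pose c := pair_slack j.
have a0 := a_gt0; have an0 : a != 0 by rewrite gt_eqF.
have aX n : 0 < a ^+ n by rewrite exprn_gt0.
have S0 := tr_S sys; have e0 := tr_eta sys.
(* Chosen so that the accumulated base error, once d is below [a ^- (90 * k.-1)] and m is at most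
   42k, is at most [B * eta * k%:R * a ^- (6 * k)]. This is below eta as soon as k exceeds B,
   because k squared is at most [a ^+ (6 * k)]. *)
pose B := 42 * S * a ^+ (90 + 12 * c) / eta.
have B0 : 0 <= B.
  apply: divr_ge0; last exact: ltW.
  by apply: mulr_ge0; [apply: mulr_ge0|apply: ltW].
pose k0 := (2 * slack M j + 2 + (Num.truncn B).+1)%N.
have Bk : B < k0%:R.
  by apply: lt_le_trans (truncnS_gt B) _; rewrite ler_nat leq_addl.
pose r := Num.min eta (a ^- (90 * k0)).
exists r, (a ^+ (18 * c) * (1 + 2 * S)); split.
  by rewrite /r lt_min e0 invr_gt0 aX.
move=> t t' gt gt' Tt Tt' dr; set d := `|t - t'| in dr *.
have dT_d : dT t t' <= d by apply: dT_le0.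
have [d0|dn0] := eqVneq d 0.
  have -> : t = t' by apply/eqP; rewrite -subr_eq0 -normr_eq0; apply/eqP.
  by rewrite dT_xx d0 mulr0.
have dp : 0 < d by rewrite lt_neqAle eq_sym dn0 /d normr_ge0.
have /andP[d_eta d_k0] : (d < eta) && (d < a ^- (90 * k0)) by rewrite -lt_min.
have exk : exists k, a ^- (90 * k) <= d.
  pose k := (Num.truncn d^-1).+1; exists k.
  have kd : d^-1 < k%:R by apply: truncnS_gt.
  rewrite -[leRHS]invrK lef_pV2 ?posrE ?invr_gt0 //.
  apply: le_trans (ltW kd) _; apply: le_trans (expa_ge k).1 _.
  by apply: expa_mono; rewrite leq_mul2r orbT.
(* The least such k measures |log d|: d lies between [a ^- (90 * k)] and [a ^- (90 * k.-1)]. *)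
have [k kd kmin] := ex_minnP exk.
have k0k : (k0 < k)%N.
  rewrite ltnNge; apply/negP => kk0; move: d_k0; rewrite ltNge => /negP; apply.
  by apply: le_trans _ kd; apply: expaV_mono; rewrite leq_mul2l kk0 orbT.
have dk : d < a ^- (90 * k.-1).
  by rewrite ltNge; apply/negP => h; move: (kmin k.-1 h) k0k; clear; lia.
have [m [/andP[mk1 mk2] nw nw' sm]] := common_good_time gt gt' (k := k) ltac:(move: k0k; rewrite /k0; clear; lia).
have Cm : C (phi (t - m%:R * rho)) by have [] := (Tt m).2.
have Cm' : C (phi (t' - m%:R * rho)) by have [] := (Tt' m).2.
set u := phi (t - _) in Cm; set v := phi (t' - _) in Cm'.
(* The intermediate orbit: start u from the graph over t, base points of t'. It stays trapped
   because its initial base point is safe. *)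
pose y s := orb (t' - m%:R * rho) u (m - s).
have am : a ^- (3 * m) <= d.
  by apply: le_trans _ kd; apply: expaV_mono; move: mk1; clear; lia.
have small : S * d * m%:R * a ^+ (2 * m + 12 * c) < eta.
  have kp : 0 < k%:R :> R by rewrite ltr0n; move: k0k; clear; lia.
  have h1 : S * d * m%:R * a ^+ (2 * m + 12 * c) <=
      S * a ^- (90 * k.-1) * (42 * k%:R) * a ^+ (84 * k + 12 * c).
    apply: ler_pM; rewrite ?mulr_ge0 ?(ltW dp) ?(ltW (aX _)) //.
      apply: ler_pM; rewrite ?mulr_ge0 ?(ltW dp) //.
        by rewrite ler_wpM2l // ltW.
      by rewrite -natrM ler_nat.
    by apply: expa_mono; move: mk2; clear; lia.
  apply: le_lt_trans h1 _.
  have -> : S * a ^- (90 * k.-1) * (42 * k%:R) * a ^+ (84 * k + 12 * c) =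
      B * eta * k%:R * a ^- (6 * k).
    have -> : B * eta = 42 * S * a ^+ (90 + 12 * c) by rewrite /B mulfVK // gt_eqF.
    have E1 : a ^+ (84 * k + 12 * c) * a ^+ (6 * k) =
              a ^+ (90 * k.-1) * a ^+ (90 + 12 * c).
      by rewrite -!exprD; congr (_ ^+ _); move: k0k; clear; lia.
    have E2 : a ^+ (84 * k + 12 * c) =
              a ^+ (90 * k.-1) * a ^+ (90 + 12 * c) / a ^+ (6 * k).
      by rewrite -E1 mulfK // expf_neq0.
    rewrite E2; field.
    by rewrite !expf_neq0.
  rewrite ltr_pdivrMr //.
  have := (expa_ge k).2 => h2.
  have Bk' : B < k%:R by apply: lt_le_trans Bk _; rewrite ler_nat ltnW.
  apply: lt_le_trans (_ : k%:R * eta * k%:R <= _).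
    by rewrite ltr_pM2r // ltr_pM2r.
  by rewrite mulrAC mulrC ler_wpM2l // ltW.
have h1 : dT (phi t) (y 0%N) <= a ^+ (18 * c) * (2 * (S * d)).
  have := @pair_estimate j t t' (fun s => phi (t - s%:R * rho)) y m gt gt'.
  rewrite /y subnn dT_xx mulr0 !add0r mul0r subr0 => H.
  apply: le_trans (H _ _ _ _ _ _) _.
  - by move=> s _; apply: (Tt s).1.
  - by move=> s ss; rewrite orb_back //; apply: eqZ_refl.
  - by move=> s _; apply: (Tt s).2.
  - by move=> s ss; apply: trapped_back.
  - exact: le_lt_trans dT_d d_eta.
  - apply: le_lt_trans small; rewrite ler_wpM2r ?(ltW (aX _)) //.
    by rewrite ler_wpM2r // ler_wpM2l.
  - by rewrite ler_wpM2l ?(ltW (aX _)) // ler_wpM2l // ler_wpM2l.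
have h2 : dT (y 0%N) (phi t') <= a ^+ (18 * c) * d.
  rewrite (dT_eqZr _ (tracked_orb m Tt')) /y subn0.
  apply: le_trans (arc_contraction gt' sm Cm Cm') _.
  by rewrite ler_wpM2l ?(ltW (aX _)).
apply: le_trans (dT_tri (y 0%N) _ _) _; apply: le_trans (lerD h1 h2) _.
by rewrite le_eqVlt; apply/orP; left; apply/eqP; ring.
Qed.

End Trapping.

(** * The one-dimensional Hausdorff measure *)

Section Hausdorff.
Variable R : realType.
Local Notation T := (R * R)%type.
Implicit Types (A B X U : set T) (p q : T).

(* A copy of the plane on which every set is measurable, so that [mu_ext] takes
   infima over arbitrary covers. *)
Definition all_sets : Type := T.
HB.instance Definition _ := Pointed.copy all_sets T.
HB.instance Definition _ := @isMeasurable.Build default_measure_display all_sets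
  (@discrete_measurable all_sets) (@discrete_measurable0 all_sets)
  (@discrete_measurableC all_sets) (@discrete_measurableU all_sets).

Lemma diam2_ge0 U : (0 <= diam2 U)%E.
Proof. by apply: ereal_sup_ubound; left. Qed.

Lemma diam2_ub U p q : U p -> U q -> ((dT2 p q)%:E <= diam2 U)%E.
Proof. by move=> Up Uq; apply: ereal_sup_ubound; right; exists (p, q). Qed.

Lemma diam2_le U (d : R) : 0 <= d -> (forall p q, U p -> U q -> dT2 p q <= d) ->
  (diam2 U <= d%:E)%E.
Proof.
move=> d0 Ud; apply: ub_ereal_sup => _ [->|[[p q] [/= Up Uq] <-]]; rewrite lee_fin //.
exact: Ud.
Qed.

Lemma diam2_0 : diam2 (@set0 T) = 0%E.
Proof.
by apply/eqP; rewrite eq_le diam2_ge0 andbT; apply: diam2_le.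
Qed.

(** The value +oo on large sets encodes the constraint on diameters, so that [H1delta] becomes an
    unconstrained [mu_ext] and inherits its subadditivity. *)
Definition gauge (delta : R) (U : set all_sets) : \bar R :=
  if (diam2 U <= delta%:E)%E then diam2 U else +oo%E.

Lemma gauge_ge0 delta U : (0 <= gauge delta U)%E.
Proof. by rewrite /gauge; case: ifP => // _; apply: diam2_ge0. Qed.

Lemma H1delta_gauge delta A : 0 < delta -> H1delta delta A = mu_ext (gauge delta) A.
Proof.
move=> d0; apply/eqP; rewrite eq_le; apply/andP; split.
  apply: le_ereal_inf_tmp => _ [U [_ AU] <-].
  have [h|/existsNP[i hi]] := pselect (forall i, (diam2 (U i) <= delta%:E)%E).
    apply: ereal_inf_lbound; exists U; first by split.
    by apply: eq_eseriesr => i _; rewrite /gauge h.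
  rewrite (@eseries_pinfty _ _ _ i) ?leey // => [n _|].
    by rewrite -ltNye (lt_le_trans _ (gauge_ge0 _ _)).
  by rewrite /gauge; case: ifP => // /hi.
apply: le_ereal_inf_tmp => _ [U [AU Ud] <-].
apply: ereal_inf_lbound; exists U; first by split.
by apply: eq_eseriesr => i _; rewrite /gauge Ud.
Qed.

Lemma H1delta_le delta A : 0 < delta -> (H1delta delta A <= H1 A)%E.
Proof. by move=> d0; apply: ereal_sup_ubound; exists delta. Qed.

Lemma H1delta_ge0 delta A : (0 <= H1delta delta A)%E.
Proof.
apply: le_ereal_inf_tmp => _ [U _ <-].
by apply: nneseries_ge0 => n _ _; apply: diam2_ge0.
Qed.

Lemma le_H1delta delta A B : A `<=` B -> (H1delta delta A <= H1delta delta B)%E.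
Proof.
move=> AB; apply: le_ereal_inf_tmp => _ [U [BU Ud] <-].
by apply: ereal_inf_lbound; exists U => //; split=> //; apply: subset_trans BU.
Qed.

Lemma H1delta_anti d1 d2 A : d1 <= d2 -> (H1delta d2 A <= H1delta d1 A)%E.
Proof.
move=> d12; apply: le_ereal_inf_tmp => _ [U [AU Ud] <-].
apply: ereal_inf_lbound; exists U => //; split=> // i.
by apply: le_trans (Ud i) _; rewrite lee_fin.
Qed.

Lemma H1_ge0 A : (0 <= H1 A)%E.
Proof. by apply: le_trans (H1delta_le A (@ltr01 R)); apply: H1delta_ge0. Qed.

Lemma le_H1 A B : A `<=` B -> (H1 A <= H1 B)%E.
Proof.
move=> AB; apply: ub_ereal_sup => _ [d d0 <-].
by apply: le_trans (le_H1delta d AB) _; apply: H1delta_le.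
Qed.

Lemma H1delta0 delta : 0 < delta -> H1delta delta (@set0 T) = 0%E.
Proof.
move=> d0; rewrite H1delta_gauge // mu_ext0 //; last by apply: gauge_ge0.
by rewrite /gauge diam2_0 lee_fin (ltW d0).
Qed.

Lemma H1_0 : H1 (@set0 T) = 0%E.
Proof.
apply/eqP; rewrite eq_le H1_ge0 andbT; apply: ub_ereal_sup => _ [d d0 <-].
by rewrite H1delta0.
Qed.

Lemma H1_sigma_subadditive : sigma_subadditive (@H1 R).
Proof.
move=> F; apply: ub_ereal_sup => _ [d d0 <-].
rewrite H1delta_gauge //.
apply: le_trans (@mu_ext_sigma_subadditive _ all_sets R _ (gauge_ge0 d) F) _.
apply: lee_nneseries => [n _ _|n _]; rewrite -H1delta_gauge //; first exact: H1delta_ge0.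
exact: H1delta_le.
Qed.

HB.instance Definition _ := isOuterMeasure.Build R T (@H1 R) H1_0 H1_ge0 le_H1
  H1_sigma_subadditive.

(** A set of diameter below r cannot meet both A and B, so a cover of the union splits into two
    covers. *)
Lemma H1delta_sep delta (r : R) A B : 0 < delta -> delta < r ->
  (forall p q, A p -> B q -> r <= dT2 p q) ->
  (H1delta delta A + H1delta delta B <= H1delta delta (A `|` B))%E.
Proof.
move=> d0 dr AB; apply: le_ereal_inf_tmp => _ [U [ABU Ud] <-].
pose V (Z : set T) i := if `[< U i `&` Z !=set0 >] then U i else set0.
have Vd Z i : (diam2 (V Z i) <= delta%:E)%E.
  by rewrite /V; case: ifP => _ //; rewrite diam2_0 lee_fin ltW.
have VZ (Z : set T) : Z `<=` A `|` B -> (H1delta delta Z <= \sum_(0 <= i <oo) diam2 (V Z i))%E.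
  move=> ZAB; apply: ereal_inf_lbound; exists (V Z) => //; split=> //.
  move=> p Zp; have [i _ Uip] := ABU p (ZAB p Zp); exists i => //.
  by rewrite /V asboolT //; exists p.
apply: le_trans (leeD (VZ A (@subsetUl _ _ _)) (VZ B (@subsetUr _ _ _))) _.
rewrite -nneseriesD; [|by move=> *; apply: diam2_ge0|by move=> *; apply: diam2_ge0].
apply: lee_nneseries => [i _ _|i _]; first by rewrite adde_ge0 ?diam2_ge0.
rewrite /V; case: asboolP => [[p [Up Ap]]|_]; last first.
  by rewrite diam2_0 add0e; case: ifP => _ //; rewrite diam2_0 diam2_ge0.
rewrite asboolF ?diam2_0 ?adde0 // => -[q [Uq Bq]].
have := le_trans (diam2_ub Up Uq) (Ud i); rewrite lee_fin => h.
by have := AB p q Ap Bq; rewrite leNgt (le_lt_trans h dr).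
Qed.

Lemma H1_sep (r : R) A B : 0 < r -> (forall p q, A p -> B q -> r <= dT2 p q) ->
  (H1 A + H1 B <= H1 (A `|` B))%E.
Proof.
move=> r0 AB; have [->|foo] := eqVneq (H1 (A `|` B)) +oo%E; first by rewrite leey.
have fAB : H1 (A `|` B) \is a fin_num.
  by rewrite ge0_fin_numE ?H1_ge0 // lt_neqAle foo leey.
have fin Z : Z `<=` A `|` B -> H1 Z \is a fin_num.
  move=> ZAB; rewrite ge0_fin_numE ?H1_ge0 //; apply: le_lt_trans (le_H1 ZAB) _.
  by rewrite -ge0_fin_numE ?H1_ge0.
have fA := fin A (@subsetUl _ _ _); have fB := fin B (@subsetUr _ _ _).
have H d1 d2 : 0 < d1 -> 0 < d2 ->
    (H1delta d1 A + H1delta d2 B <= H1 (A `|` B))%E.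
  move=> d10 d20; pose d := Num.min d1 (Num.min d2 (r / 2)).
  have d0 : 0 < d by rewrite !lt_min d10 d20 divr_gt0.
  have dr : d < r.
    apply: le_lt_trans (_ : r / 2 < r); last by lra.
    by rewrite !ge_min lexx !orbT.
  apply: le_trans (_ : H1delta d A + H1delta d B <= _)%E.
    by apply: leeD; apply: H1delta_anti; rewrite !ge_min lexx ?orbT.
  by apply: le_trans (H1delta_sep d0 dr AB) _; apply: H1delta_le.
have fd d Z : 0 < d -> Z `<=` A `|` B -> H1delta d Z \is a fin_num.
  move=> d0 ZAB; rewrite ge0_fin_numE ?H1delta_ge0 //.
  apply: le_lt_trans (H1delta_le Z d0) _.
  by rewrite -ge0_fin_numE ?H1_ge0 // fin.
rewrite -leeBrDr //; apply: ub_ereal_sup => _ [d1 d10 <-].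
rewrite leeBrDr // addeC -leeBrDr ?fd //.
apply: ub_ereal_sup => _ [d2 d20 <-].
by rewrite leeBrDr ?fd // addeC H.
Qed.

(** * Caratheodory measurability of sublevel sets of 1-Lipschitz functions *)

Section Level.
Variables (f : T -> R) (r : R).
Hypothesis f_lip : forall p q, `|f p - f q| <= dT2 p q.

Lemma H1_shells X (E : nat -> set T) (lo hi : nat -> R) N :
  (forall n, E n `<=` X) -> (forall n p, E n p -> lo n <= f p < hi n) ->
  (forall n, hi n < lo n.+1) -> (forall n, hi n <= hi n.+1) ->
  (\sum_(0 <= n < N) H1 (E n) <= H1 X)%E.
Proof.
move=> EX Ef gap mono.
suff H : (\sum_(0 <= n < N) H1 (E n) <= H1 (\bigcup_(n in `I_N) E n))%E.
  by apply: le_trans H _; apply: le_H1 => p [n _] /EX.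
elim: N => [|N IH]; first by rewrite big_geq // H1_ge0.
rewrite big_nat_recr //=; apply: le_trans (leeD IH (lexx _)) _.
apply: le_trans (_ : H1 ((\bigcup_(n in `I_N) E n) `|` E N) <= _)%E; last first.
  apply: le_H1 => p [[n /= nN Ep]|Ep]; last by exists N => /=.
  by exists n => //=; apply: ltnW.
case: N {IH} => [|N]; first by rewrite II0 bigcup_set0 H1_0 add0e set0U.
apply: (@H1_sep (lo N.+1 - hi N)); first by rewrite subr_gt0.
move=> p q [n /= nN Ep] Eq; apply: le_trans (f_lip p q).
have /andP[_ h1] := Ef _ _ Ep; have /andP[h2 _] := Ef _ _ Eq.
have h3 : hi n <= hi N.
  rewrite ltnS in nN; rewrite -(subnKC nN); elim: (N - n)%N => [|k IHk].
    by rewrite addn0.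
  by rewrite addnS; apply: le_trans IHk _.
rewrite distrC ger0_norm; last by have := gap N; lra.
lra.
Qed.

(** Caratheodory's argument for metric outer measures. Shells between consecutive levels [u n] are
    separated when their indices differ by two, so the even and the odd shells each have total
    measure at most [H1 X]. The series converges, and its tail bounds what is lost when the part
    below r is replaced by the separated part below [u n]. *)
Lemma H1_level_caratheodory : (@H1 R).-caratheodory [set p | f p < r].
Proof.
apply: le_caratheodory_measurable => X /=; set V := [set p | _].
have [->|Xoo] := eqVneq (H1 X) +oo%E; first by rewrite leey.
have Xfin : H1 X \is a fin_num by rewrite ge0_fin_numE ?H1_ge0 // lt_neqAle Xoo leey.
pose u n : R := r - n.+1%:R^-1.
have umono n : u n < u n.+1.
  by rewrite /u ltrD2l ltrN2 ltf_pV2 ?posrE ?ltr0n // ltr_nat.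
have ur n : u n < r by rewrite /u gtrBl invr_gt0 ltr0n.
pose E n := X `&` [set p | u n <= f p < u n.+1].
have Ef n p : E n p -> u n <= f p < u n.+1 by case.
have EX n : E n `<=` X by move=> p [].
have even N : (\sum_(0 <= n < N) H1 (E (2 * n)%N) <= H1 X)%E.
  apply: (@H1_shells X _ (fun n => u (2 * n)%N) (fun n => u (2 * n).+1)) => //.
  - by move=> n p /Ef.
  - by move=> n /=; rewrite mulnS !addSn add0n.
  - by move=> n /=; rewrite mulnS !addSn add0n; apply: ltW; apply: lt_trans (umono _).
have odd N : (\sum_(0 <= n < N) H1 (E (2 * n).+1) <= H1 X)%E.
  apply: (@H1_shells X _ (fun n => u (2 * n).+1) (fun n => u (2 * n).+2)) => //.
  - by move=> n p /Ef.
  - by move=> n /=; rewrite mulnS !addSn add0n.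
  - by move=> n /=; rewrite mulnS !addSn add0n; apply: ltW; apply: lt_trans (umono _).
have sum2 N : (\sum_(0 <= n < 2 * N) H1 (E n) <=
    \sum_(0 <= n < N) H1 (E (2 * n)%N) + \sum_(0 <= n < N) H1 (E (2 * n).+1))%E.
  rewrite -big_split /=; elim: N => [|N IH]; first by rewrite muln0 !big_geq.
  by rewrite mulnS !addSn add0n !big_nat_recr //= -addeA; apply: leeD.
have sum_fin : (\sum_(0 <= n <oo) H1 (E n) < +oo)%E.
  apply: le_lt_trans (_ : H1 X + H1 X < +oo)%E; last first.
    by rewrite -ge0_fin_numE ?adde_ge0 ?H1_ge0 // fin_numD Xfin.
  apply: lime_le; first by apply: is_cvg_nneseries => n _ _; apply: H1_ge0.
  near=> N; apply: le_trans (_ : \sum_(0 <= n < 2 * N) H1 (E n) <= _)%E.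
    by apply: lee_sum_nneg_natr => //; [move=> *; apply: H1_ge0|rewrite leq_pmull].
  exact: le_trans (sum2 N) (leeD (even N) (odd N)).
have tail := nneseries_tail_cvg sum_fin (fun n _ => H1_ge0 _).
have sep n : (H1 (X `&` [set p | (f p < u n)%R]) + H1 (X `&` ~` V) <= H1 X)%E.
  apply: le_trans (_ : H1 ((X `&` [set p | (f p < u n)%R]) `|` (X `&` ~` V)) <= _)%E; last first.
    by apply: le_H1 => p [[]|[]].
  apply: (@H1_sep (r - u n)); first by rewrite subr_gt0.
  move=> p q [_ /= fp] [_ /negP]; rewrite -leNgt => fq.
  by apply: le_trans (f_lip p q); rewrite distrC ger0_norm; have := ur n; lra.
have cover n : (H1 (X `&` V) <= H1 (X `&` [set p | (f p < u n)%R]) +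
    \sum_(n <= k <oo) H1 (E k))%E.
  have sub : X `&` V `<=` (X `&` [set p | (f p < u n)%R]) `|` \bigcup_k E (k + n)%N.
    move=> p [Xp Vp]; have [h|h] := ltP (f p) (u n); first by left.
    right.
    have exk : exists k, f p < u k.
      have h0 : 0 < r - f p by rewrite subr_gt0.
      pose k := Num.truncn (r - f p)^-1; exists k.
      have hm : (r - f p)^-1 < k.+1%:R := truncnS_gt _.
      have : k.+1%:R^-1 < r - f p by rewrite -[ltRHS]invrK ltf_pV2 ?posrE ?invr_gt0 ?ltr0n.
      by rewrite /u ltrBrDr -ltrBrDl.
    have [k fk kmin] := ex_minnP exk.
    have nk : (n < k)%N.
      rewrite ltnNge; apply/negP => kn; move: h; rewrite leNgt => /negP; apply.
      apply: lt_le_trans fk _; rewrite -(subnKC kn); elim: (n - k)%N => [|i IH].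
        by rewrite addn0.
      by rewrite addnS; apply: le_trans IH (ltW (umono _)).
    exists (k.-1 - n)%N => //; rewrite subnK; last by lia.
    split=> //; rewrite /= prednK ?fk ?andbT; last by lia.
    by rewrite leNgt; apply/negP => h'; have := kmin _ h'; lia.
  apply: le_trans (le_H1 sub) _; apply: le_trans (outer_measureU2 _ _ _) _.
  rewrite leeD2l //; apply: le_trans (H1_sigma_subadditive _) _.
  rewrite (nneseries_addn (f := fun k => H1 (E k))) //.
  by move=> i; apply: H1_ge0.
have key n : (H1 (X `&` V) + H1 (X `&` ~` V) <= H1 X + \sum_(n <= k <oo) H1 (E k))%E.
  apply: le_trans (leeD (cover n) (lexx _)) _.
  by rewrite addeAC; apply: leeD (sep n) (lexx _).
have lim : (H1 X + \sum_(n <= k <oo) H1 (E k))%E @[n --> \oo] --> (H1 X + 0)%E.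
  by apply: cvgeD => //; [rewrite fin_num_adde_defl|apply: cvg_cst].
rewrite -[leRHS]adde0 -(cvg_lim _ lim) //.
apply: lime_ge; first by apply/cvg_ex; exists (H1 X + 0)%E.
by near=> n; apply: key.
Unshelve. all: by end_near. Qed.

End Level.
End Hausdorff.

(** * Rectifiability of graph measures *)

Section Rectifiable.
Variable R : realType.
Local Notation T := (R * R)%type.
Local Notation leb := (@lebesgue_measure R).

Lemma measurable_fracR : measurable_fun setT (@fracR R).
Proof.
apply: measurable_funB => //; apply: nondecreasing_measurable => //.
by move=> x y xy; rewrite ler_int; apply: le_floor.
Qed.

Lemma dom2_coord (pr : T -> R) : (pr = fst \/ pr = snd) ->
  forall p, dom2 p -> 0 <= pr p < 1.
Proof. by case=> -> p []. Qed.

(** A coordinate jumps at 0 on the circle and is not Lipschitz for [dT]; the distance to c/2 is, and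
    it cuts out the same interval apart from the point 0. *)
Lemma half_arc (c x : R) : 0 < c <= 1 -> 0 <= x < 1 ->
  (dT x (c / 2) < c / 2) = (0 < x < c).
Proof.
move=> /andP[c0 c1] /andP[x0 x1]; have b : `|x - c / 2| <= 1 by rewrite ler_norml; lra.
have h1 := dT_le0 x (c / 2); have h2 := dT_ge b.
apply/idP/idP.
  move=> h3; have : Num.min `|x - c / 2| (1 - `|x - c / 2|) < c / 2 by apply: le_lt_trans h2 h3.
  rewrite gt_min => /orP[|h].
    by rewrite ltr_norml => /andP[h4 h5]; apply/andP; split; lra.
  have : 1 - c / 2 < `|x - c / 2| by lra.
  by rewrite ltr_normr => /orP[|]; lra.
move=> /andP[h3 h4]; apply: le_lt_trans h1 _; rewrite ltr_norml; apply/andP; split; lra.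
Qed.

Section OnSubset.
Variable A : set T.
Hypothesis A_dom : A `<=` @dom2 R.

(** On the whole plane [dT2] vanishes between points equal modulo integers, and [H1] is not additive
    on Borel sets. Restricted to a subset of the fundamental domain it is. *)
Definition H1on (X : set T) : \bar R := H1 (X `&` A).

Lemma H1on_0 : H1on set0 = 0%E. Proof. by rewrite /H1on set0I H1_0. Qed.

Lemma H1on_ge0 X : (0 <= H1on X)%E. Proof. exact: H1_ge0. Qed.

Lemma le_H1on : {homo H1on : X Y / X `<=` Y >-> (X <= Y)%E}.
Proof. by move=> X Y XY; apply: le_H1; apply: setSI. Qed.

Lemma H1on_sigma_subadditive : sigma_subadditive H1on.
Proof. by move=> F; rewrite /H1on setI_bigcupl; apply: H1_sigma_subadditive. Qed.

HB.instance Definition _ := isOuterMeasure.Build R T H1on H1on_0 H1on_ge0 le_H1on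
  H1on_sigma_subadditive.

Lemma H1on_caratheodory_sub (X : set T) : (@H1 R).-caratheodory X ->
  H1on.-caratheodory X.
Proof. by move=> HX Y; rewrite /H1on (HX (Y `&` A)) -!setIA !(setIC A). Qed.

Lemma H1on_caratheodory_eq (X Y : set T) : X `&` A = Y `&` A ->
  H1on.-caratheodory X -> H1on.-caratheodory Y.
Proof.
move=> XY HX; apply: le_caratheodory_measurable => Z; rewrite [leRHS](HX Z).
apply: leeD; apply: le_H1 => p [[Zp Yp] Ap]; split=> //; split=> //.
  by have : (Y `&` A) p by []; rewrite -XY => -[].
by move=> Xp; apply: Yp; have : (X `&` A) p by []; rewrite XY => -[].
Qed.

Lemma H1on_halfplane (pr : T -> R) (c : R) : (pr = fst \/ pr = snd) ->
  H1on.-caratheodory [set p | pr p < c].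
Proof.
move=> prE; have pd p : A p -> 0 <= pr p < 1 by move=> /A_dom; apply: dom2_coord.
have V (d : R) : H1on.-caratheodory [set p | dT (pr p) (d / 2) < d / 2].
  apply: H1on_caratheodory_sub; apply: H1_level_caratheodory => p q.
  have h : dT (pr p) (pr q) <= dT2 p q by case: prE => ->; [apply: dT2_ge1|apply: dT2_ge2].
  have h1 := dT_tri (pr q) (pr p) (d / 2); have h2 := dT_tri (pr p) (pr q) (d / 2).
  by rewrite (dT_sym (pr q) (pr p)) in h2; rewrite ler_norml; apply/andP; split; lra.
have [c0|c0] := leP c 0.
  apply: (@H1on_caratheodory_eq set0); last exact: caratheodory_measurable_set0.
  by rewrite set0I; apply/esym; rewrite -subset0 => p [/= h /pd /andP[h1 _]]; have := lt_le_trans h c0; rewrite ltNge h1.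
have [c1|c1] := ltP 1 c.
  apply: (@H1on_caratheodory_eq (~` set0)).
    by rewrite setC0 setTI; apply/seteqP; split=> p /=; [move=> Ap; split=> //; have /andP[_ h] := pd p Ap; apply: lt_trans h c1|case].
  by apply: caratheodory_measurable_setC; apply: caratheodory_measurable_set0.
(* The first set is the line where the coordinate is 0, the second the open strip between 0 and
   c. *)
apply: (@H1on_caratheodory_eq (~` [set p | dT (pr p) (1 / 2) < 1 / 2] `|`
                                  [set p | dT (pr p) (c / 2) < c / 2])).
  apply/seteqP; split=> p /= [h Ap]; split=> //; move: h; have p01 := pd p Ap;
    rewrite !half_arc ?ltr01 ?lexx ?c0 ?c1 //.
    by case=> [|/andP[]//]; have /andP[p0 ->] := p01; rewrite andbT => /negP; rewrite -leNgt => /le_lt_trans; apply.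
  move=> h; have [p0|p0] := ltP 0 (pr p); first by right; rewrite h.
  by left; apply/negP.
by apply: caratheodory_measurable_setU; [apply: caratheodory_measurable_setC|]; apply: V.
Qed.

Lemma H1on_preimage (pr : T -> R) (B : set R) : (pr = fst \/ pr = snd) ->
  measurable B -> H1on.-caratheodory (pr @^-1` B).
Proof.
move=> prE mB; have {mB} : <<s @RGenInftyO.G R >> B.
  suff : (@RGenInftyO.G R).-sigma.-measurable B by [].
  by rewrite -RGenInftyO.measurableE.
move: B; apply: smallest_sub.
  split.
  - by rewrite /= preimage_set0; apply: caratheodory_measurable_set0.
  - by move=> B MB /=; rewrite setTD preimage_setC; apply: caratheodory_measurable_setC.
  - by move=> F MF /=; rewrite preimage_bigcup; apply: caratheodory_measurable_bigcup.
move=> _ [x ->] /=; rewrite (_ : _ @^-1` _ = [set p | pr p < x]); first exact: H1on_halfplane.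
by apply/seteqP; split=> p /=; rewrite in_itv.
Qed.

Lemma H1on_borel (B : set T) : measurable B -> H1on.-caratheodory B.
Proof.
rewrite measurable_prod_measurableType; move: B; apply: smallest_sub.
  split.
  - exact: caratheodory_measurable_set0.
  - by move=> B MB; rewrite setTD; apply: caratheodory_measurable_setC.
  - by move=> F MF; apply: caratheodory_measurable_bigcup.
move=> _ [X mX [Y mY <-]].
rewrite (_ : X `*` Y = (fst @^-1` X) `&` (snd @^-1` Y)) //.
by apply: caratheodory_measurable_setI; apply: H1on_preimage => //; [left|right].
Qed.

Lemma H1on_sigma_additive : semi_sigma_additive (H1on : set T -> \bar R).
Proof.
move=> F mF tF mUF.
apply: (@caratheodory_measure_sigma_additive R T H1on) => // [i|].
  exact: H1on_borel.
exact: H1on_borel.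
Qed.

End OnSubset.

Import HBNNSimple.

(** Needed because the density formula integrates against [H1], which is only a set function here. A
    simple function below a function vanishing off D has its nonzero level sets inside D, where the
    two set functions agree. *)
Lemma eq_measure_integral_sub (m1 m2 : set T -> \bar R) (D : set T) (f : T -> \bar R) :
  (forall Y, Y `<=` D -> m1 Y = m2 Y) ->
  (\int[m1]_(x in D) f x = \int[m2]_(x in D) f x)%E.
Proof.
move=> m12.
pose nn (m : set T -> \bar R) (g : T -> \bar R) := ereal_sup
  [set sintegral m k | k in [set k : {nnsfun T >-> R} | forall x, ((k x)%:E <= g x)%E]].
suff H (g : T -> \bar R) : (forall x, ~ D x -> g x = 0%E) -> nn m1 g = nn m2 g.
  have D0 s x : ~ D x -> (f \_ D) x = s -> s = 0%E by move=> nDx <-; rewrite patchE memNset.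
  congr (_ - _)%E; apply: H => x /D0 /(_ erefl) D0x;
    by rewrite ?funeposE ?funenegE D0x ?oppe0 maxxx.
move=> g0; congr ereal_sup; apply/seteqP; split=> _ [k kg <-];
  exists k => //; apply: eq_fsbigr => r _;
  (have [->|r0] := eqVneq r 0; first by rewrite !mul0e); congr (_ * _)%E;
  rewrite m12 // => x /= kx; apply: contrapT => /g0 gx; have := kg x; rewrite gx kx lee_fin;
  have : 0 <= k x by []; by rewrite kx => h1 h2; move: r0; rewrite eq_le h1 h2.
Qed.

Variable phi : R -> R.
Hypothesis mphi : measurable_fun setT phi.

Definition graph_over (Z : set R) : set T := [set p | Z p.1 /\ p.2 = fracR (phi p.1)].

Let mfphi : measurable_fun setT (fun t => fracR (phi t)).
Proof. exact: measurableT_comp measurable_fracR mphi. Qed.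

Let mgr : measurable_fun setT (fun t : R => (t, fracR (phi t))).
Proof. exact: measurable_fun_pair. Qed.

Lemma measurable_graph_over Z : measurable Z -> measurable (graph_over Z).
Proof.
move=> mZ; rewrite (_ : graph_over Z = (fst @^-1` Z) `&`
    ((fun p : T => p.2 - fracR (phi p.1)) @^-1` [set 0])).
  apply: measurableI; first by rewrite -[X in measurable X]setTI; apply: measurable_fst.
  rewrite -[X in measurable X]setTI.
  have : measurable_fun setT (fun p : T => p.2 - fracR (phi p.1)).
    apply: measurable_funB; first exact: measurable_snd.
    exact: measurableT_comp mfphi measurable_fst.
  by apply => //; apply: measurable_set1.
apply/seteqP; split=> p /= [Zp]; first by move=> ->; rewrite subrr.
by move=> /eqP; rewrite subr_eq0 => /eqP.
Qed.

Lemma muphiE (B : set T) :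
  muphi phi B = leb ((`[0, 1[ : set R) `&` (fun t : R => (t, fracR (phi t))) @^-1` B).
Proof. by rewrite /muphi; congr (leb _); apply/seteqP; split=> t /=; rewrite in_itv /=. Qed.

Let m01 : measurable (`[0%R, 1%R[%classic : set R). Proof. exact: measurable_itv. Qed.

Let mpre (B : set T) : measurable B -> measurable ((fun t : R => (t, fracR (phi t))) @^-1` B).
Proof. by move=> mB; rewrite -[X in measurable X]setTI; apply: mgr. Qed.

Lemma muphi_0 : muphi phi set0 = 0%E.
Proof. by rewrite muphiE preimage_set0 setI0 measure0. Qed.

Lemma muphi_ge0 (B : set T) : (0 <= muphi phi B)%E.
Proof. by rewrite muphiE. Qed.

Lemma muphi_sigma_additive : semi_sigma_additive (muphi phi : set T -> \bar R).
Proof.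
move=> F mF tF mUF; rewrite muphiE preimage_bigcup setI_bigcupr.
rewrite (_ : (fun n => _) = (fun n => \sum_(0 <= i < n)
   leb (`[0%R, 1%R[%classic `&` (fun t : R => (t, fracR (phi t))) @^-1` F i))%E); last first.
  by apply/funext => n; apply: eq_bigr => i _; rewrite muphiE.
apply: measure_semi_sigma_additive.
- by move=> i; apply: measurableI => //; apply: mpre.
- apply/trivIsetP => i j _ _ ij; rewrite setIACA setIid -preimage_setI.
  by move/trivIsetP : tF => /(_ _ _ Logic.I Logic.I ij) ->; rewrite preimage_set0 setI0.
- by apply: bigcup_measurable => i _; apply: measurableI => //; apply: mpre.
Qed.

HB.instance Definition _ := isMeasure.Build _ _ _ (muphi phi : set T -> \bar R)
  muphi_0 muphi_ge0 muphi_sigma_additive.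

Lemma muphi_le1 (B : set T) : measurable B -> (muphi phi B <= 1)%E.
Proof.
move=> mB; rewrite muphiE; apply: le_trans (_ : leb (`[0%R, 1%R[%classic) <= _)%E.
  by apply: le_measure; rewrite ?inE //; apply: measurableI => //; apply: mpre.
by rewrite lebesgue_measure_itv /= lte_fin ltr01 sube0.
Qed.

Lemma muphi_fin : fin_num_fun (muphi phi : set T -> \bar R).
Proof.
move=> B mB; rewrite ge0_fin_numE ?muphi_ge0 //.
by apply: le_lt_trans (muphi_le1 mB) _; rewrite ltry.
Qed.

HB.instance Definition _ := Measure_isFinite.Build _ _ _ (muphi phi : set T -> \bar R)
  muphi_fin.

Variables (D : nat -> set R) (L : nat -> R).
Hypothesis mD : forall i, measurable (D i).
Hypothesis D01 : forall i t, D i t -> 0 <= t < 1.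
Hypothesis L_ge0 : forall i, 0 <= L i.
Hypothesis D_lip : forall i u v, D i u -> D i v -> dT (phi u) (phi v) <= L i * `|u - v|.
Hypothesis D_full : leb ((`[0, 1[ : set R) `\` \bigcup_i D i) = 0%E.

Let A := graph_over (\bigcup_i D i).

Lemma graph_dom2 Z : (forall t, Z t -> 0 <= t < 1) -> graph_over Z `<=` @dom2 R.
Proof. by move=> Z01 [t x] [/= Zt ->]; split; [apply: Z01|apply: fracR_itv]. Qed.

Let A_dom : A `<=` @dom2 R.
Proof. by apply: graph_dom2 => t [i _ /D01]. Qed.

Let mA : measurable A.
Proof. by apply: measurable_graph_over; apply: bigcup_measurable. Qed.

Lemma graph_dist i p q : graph_over (D i) p -> graph_over (D i) q ->
  dT2 p q <= (1 + L i) * `|p.1 - q.1|.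
Proof.
move=> [Dp Ep] [Dq Eq]; apply: le_trans (dT2_leD _ _) _; rewrite mulrDl mul1r.
apply: lerD; first exact: dT_le0.
by rewrite Ep Eq (dT_eqZl _ (eqZ_fracR _)) (dT_eqZr _ (eqZ_fracR _)) D_lip.
Qed.

(** Cut into n vertical strips, the Lipschitz graph splits into pieces of diameter at most (1 +
    L)/n, with total at most 1 + L. This gives the sigma-finiteness used by Radon-Nikodym. *)
Lemma H1_graph_fin i : (H1 (graph_over (D i)) < +oo)%E.
Proof.
have L1 : 0 < 1 + L i by have := L_ge0 i; lra.
apply: le_lt_trans (_ : (1 + L i)%:E < +oo)%E; last by rewrite ltry.
apply: ub_ereal_sup => _ [d d0 <-].
pose n := (Num.truncn ((1 + L i) / d)).+1.
have n0 : 0 < n%:R :> R by rewrite ltr0n.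
have nd : (1 + L i) / n%:R <= d.
  rewrite ler_pdivrMr // mulrC -ler_pdivrMr //; apply: ltW; exact: truncnS_gt.
pose U k := if (k < n)%N then graph_over (D i) `&` [set p | k%:R / n%:R <= p.1 < k.+1%:R / n%:R]
            else set0.
have dU k : (diam2 (U k) <= ((1 + L i) / n%:R)%:E)%E.
  apply: diam2_le; first by rewrite divr_ge0 // ltW.
  rewrite /U; case: ifP => // _ p q [Gp /andP[p1 p2]] [Gq /andP[q1 q2]].
  apply: le_trans (graph_dist Gp Gq) _; rewrite ler_pM2l //.
  have e : k.+1%:R / n%:R = k%:R / n%:R + n%:R^-1 :> R by rewrite -natr1 mulrDl mul1r.
  by move: p1 p2 q1 q2; rewrite e; set y := n%:R^-1; set x := k%:R * y; rewrite ler_norml => *; apply/andP; split; lra.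
apply: le_trans (_ : \sum_(0 <= k <oo) diam2 (U k) <= _)%E.
  apply: ereal_inf_lbound; exists U => //; split; last first.
    by move=> k; apply: le_trans (dU k) _; rewrite lee_fin.
  move=> p Gp; have /andP[p0 p1] := D01 Gp.1.
  have pn0 : 0 <= p.1 * n%:R by rewrite mulr_ge0 // ltW.
  exists (Num.truncn (p.1 * n%:R)) => //.
  have /andP[t1 t2] := truncn_itv pn0.
  have tn : (Num.truncn (p.1 * n%:R) < n)%N.
    by rewrite -(ltr_nat R); apply: le_lt_trans t1 _; rewrite gtr_pMl.
  by rewrite /U tn; split=> //=; rewrite ler_pdivrMr // t1 ltr_pdivlMr.
rewrite (nneseries_split 0 n); last by move=> k _; apply: diam2_ge0.
rewrite add0n eseries0 ?adde0; last first.
  by move=> k nk _; rewrite /U ltnNge nk /= diam2_0.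
apply: le_trans; first by apply: lee_sum => k _; apply: dU.
rewrite sumEFin lee_fin big_const_nat subn0 iter_addr_0 -[leLHS]mulr_natr.
by rewrite mulfVK // gt_eqF.
Qed.

Local Notation m := (H1on A).

HB.instance Definition _ := isMeasure.Build _ _ _ (m : set T -> \bar R)
  (H1on_0 A) (H1on_ge0 A) (H1on_sigma_additive A_dom).

Lemma H1on_sigma_finite : sigma_finite setT (m : set T -> \bar R).
Proof.
exists (fun i => if i is k.+1 then graph_over (D k) else ~` A).
  apply/seteqP; split=> p // _; have [Ap|nAp] := pselect (A p); last by exists 0%N.
  by have [[i _ Di] E] := Ap; exists i.+1.
case=> [|i]; split.
- exact: measurableC.
- by rewrite /H1on setICl H1_0 ltry.
- exact: measurable_graph_over.
- apply: le_lt_trans (H1_graph_fin i); apply: le_H1; exact: subIsetl.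
Qed.

HB.instance Definition _ := Measure_isSigmaFinite.Build _ _ _ (m : set T -> \bar R)
  H1on_sigma_finite.

(** Projection to the base does not increase distances, so a cover of B by sets of small total
    diameter yields a cover of its projection by short intervals. *)
Lemma H1_null_projection (B : set T) : measurable B -> H1 B = 0%E -> muphi phi B = 0%E.
Proof.
move=> mB B0; apply/eqP; rewrite eq_le muphi_ge0 andbT.
apply/lee_addgt0Pr => e e0; rewrite add0e.
have Bd : H1delta (1 / 4) B = 0%E.
  apply/eqP; rewrite eq_le H1delta_ge0 andbT -B0; apply: H1delta_le; lra.
have e6 : 0 < e / 6 by lra.
have : H1delta (1 / 4) B \is a fin_num by rewrite Bd.
move=> /(lb_ereal_inf_adherent e6)[_ [U [BU Ud] <-]].
rewrite -/(H1delta _ B) Bd add0e => Ulte.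
have Ufin i : diam2 (U i) \is a fin_num.
  by rewrite ge0_fin_numE ?diam2_ge0 //; apply: le_lt_trans (Ud i) _; rewrite ltry.
pose d i := fine (diam2 (U i)).
have dE i : diam2 (U i) = (d i)%:E by rewrite fineK.
have d0 i : 0 <= d i by rewrite -lee_fin -dE diam2_ge0.
have d4 i : d i <= 1 / 4 by rewrite -lee_fin -dE.
pose x i := xget 0 [set fracR p.1 | p in U i].
pose I (y : R) i : set R := `[y - d i, y + d i]%classic.
have mI y i : measurable (I y i) by exact: measurable_itv.
(* Three translates account for sets that wrap around 0; their total length 6d explains the choice
   of e/6. *)
pose V i : set R := I (x i) i `|` (I (x i - 1) i `|` I (x i + 1) i).
have mV i : measurable (V i) by apply: measurableU => //; apply: measurableU.
have itvd (y : R) i : (leb (I y i) <= (2 * d i)%R%:E)%E.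
  rewrite lebesgue_measure_itv /= lte_fin; case: ifP => _.
    by rewrite -EFinB lee_fin; lra.
  by rewrite lee_fin mulr_ge0.
have Vle i : (leb (V i) <= (6 * d i)%R%:E)%E.
  have mI2 : measurable (I (x i - 1) i `|` I (x i + 1) i) by exact: measurableU.
  apply: le_trans; first exact: (measureU2 leb (mI (x i) i) mI2).
  rewrite (_ : 6 * d i = 2 * d i + (2 * d i + 2 * d i)); last by ring.
  rewrite EFinD; apply: leeD; first exact: itvd.
  apply: le_trans; first exact: (measureU2 leb (mI (x i - 1) i) (mI (x i + 1) i)).
  by rewrite EFinD; apply: leeD; apply: itvd.
rewrite muphiE.
apply: le_trans (_ : leb (\bigcup_i V i) <= _)%E.
  apply: le_measure; rewrite ?inE //.
  - by apply: measurableI => //; apply: mpre.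
  - by apply: bigcup_measurable => k _; apply: mV.
  move=> t [/=]; rewrite in_itv /= => t01 /BU [i _ Ui]; exists i => //.
  have [p Up px] : [set fracR p.1 | p in U i] (x i).
    by apply: (@xgetPex _ 0); exists (fracR t); exists (t, fracR (phi t)).
  have h : dT t (x i) <= d i.
    rewrite -px (dT_eqZr _ (eqZ_fracR _)).
    apply: le_trans (dT2_ge1 (t, fracR (phi t)) p) _.
    by rewrite -lee_fin -dE; apply: diam2_ub.
  have x01 : 0 <= x i < 1 by rewrite -px fracR_itv.
  have [k E] := dT_ex t (x i); have di := d4 i.
  have hk : `|k%:~R : R| < 2.
    move: h; rewrite E; have := t01; have := x01; move: (x i) (d i) di => y z di.
    by move=> /andP[? ?] /andP[? ?]; rewrite !ler_norml !ltr_norml => /andP[? ?]; apply/andP; split; lra.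
  have {hk} : k = 0 \/ k = -1 \/ k = 1.
    by move: hk; rewrite -intr_norm -[2]/(2%:~R) ltr_int; lia.
  move: h; rewrite E ler_norml => /andP[h1 h2].
  case=> [k0|[k0|k0]]; rewrite k0 ?mulr0z ?mulrN1z ?mulr1z in h1 h2.
  - by left; rewrite /I /= in_itv /=; apply/andP; split; lra.
  - by right; right; rewrite /I /= in_itv /=; apply/andP; split; lra.
  - by right; left; rewrite /I /= in_itv /=; apply/andP; split; lra.
have mUV : measurable (\bigcup_i V i) by apply: bigcup_measurable => k _; apply: mV.
apply: le_trans; first exact: (measure_sigma_subadditive leb mV mUV (@subset_refl _ _)).
apply: le_trans (_ : \sum_(0 <= i <oo) (6%:E * diam2 (U i)) <= _)%E.
  by apply: lee_nneseries => [i _ _|i _]; [exact: measure_ge0|rewrite dE -EFinM; exact: Vle].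
rewrite nneseriesZl //; last by move=> i _; apply: diam2_ge0.
apply: le_trans (lee_wpmul2l _ (ltW Ulte)) _ => //.
by rewrite -EFinM lee_fin; lra.
Qed.

Lemma muphi_setI_graph (B : set T) : measurable B -> muphi phi (B `&` A) = muphi phi B.
Proof.
move=> mB; rewrite !muphiE preimage_setI setIA.
set Z := _ `&` _ @^-1` B.
have mZ : measurable Z by apply: measurableI => //; apply: mpre.
apply/eqP; rewrite eq_le; apply/andP; split.
  by apply: le_measure; rewrite ?inE //; apply: measurableI => //; apply: mpre.
have mI : measurable (Z `&` (fun t : R => (t, fracR (phi t))) @^-1` A).
  by apply: measurableI => //; apply: mpre.
have mF : measurable ((`[0, 1[ : set R) `\` \bigcup_i D i).
  by apply: measurableD => //; apply: bigcup_measurable.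
rewrite -[leRHS]adde0 -D_full; apply: le_trans (measureU2 leb mI mF).
apply: le_measure; rewrite ?inE //; first exact: measurableU.
move=> t Zt; have [Dt|nDt] := pselect ((\bigcup_i D i) t); first by left; split.
by right; split => //; case: Zt.
Qed.

Lemma muphi_dominated : (muphi phi : set T -> \bar R) `<< m.
Proof.
move=> B Bnull X mX XB; rewrite -muphi_setI_graph //.
apply: H1_null_projection; first exact: measurableI.
exact: Bnull.
Qed.

Theorem rectifiable_muphi : rectifiable_measure (muphi phi).
Proof.
have [f [f0 ffin fint fE]] := radon_nikodym_sigma_finite muphi_dominated.
exists A, (fun p => fine (f p)); split=> //; split=> //; split.
  exists (fun i t => (t, phi t)), D; split.
    move=> i; exists (1 + L i) => u v Du Dv.
    apply: le_trans (dT2_leD _ _) _; rewrite mulrDl mul1r /=.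
    by apply: lerD; [apply: dT_le0|apply: D_lip].
  rewrite (_ : _ `\` _ = set0) ?H1_0 // -subset0 => -[t x] [[[i _ Di] /= ->]]; apply.
  by exists i, t; split=> //; rewrite /red2 /= (fracR_id (D01 Di)).
split.
  by apply: measurableT_comp => //; apply: measurable_int fint.
split; first by move=> p _; apply: fine_ge0.
move=> B mB _; rewrite -muphi_setI_graph // fE; last exact: measurableI.
transitivity (\int[m]_(x in B `&` A) (fine (f x))%:E)%E.
  by apply: eq_integral => x _; rewrite fineK.
apply: eq_measure_integral_sub => Y YA; rewrite /H1on; congr H1.
by apply: setIidl => p /YA [].
Qed.

End Rectifiable.

(** * Periodic sets, ergodicity and integrals on the circle *)

Section CircleMeasure.
Variable R : realType.
Local Notation leb := (@lebesgue_measure R).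
Implicit Types (Y Z : set R) (a b t x y : R).

Definition periodic Y := forall x y, eqZ x y -> Y x -> Y y.

Lemma measurable_shiftS Y a : measurable Y -> measurable (shiftS Y a).
Proof.
move=> mY; rewrite (_ : shiftS Y a = (fun x => x - a) @^-1` Y) //.
rewrite -[X in measurable X]setTI.
have : measurable_fun setT (fun x : R => x - a) by apply: measurable_funB.
by apply.
Qed.

Lemma periodic_shiftS Y a : periodic Y -> periodic (shiftS Y a).
Proof. by move=> pY x y [k ->]; apply: pY; exists k; ring. Qed.

(** Packaged as a measure so that uniqueness of Lebesgue measure yields translation invariance. *)
Definition translated a (Y : set (measurableTypeR R)) : \bar R := leb (shiftS Y a).

Lemma translated_0 a : translated a set0 = 0%E.
Proof. by rewrite /translated (_ : shiftS set0 a = set0) ?measure0. Qed.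

Lemma translated_ge0 a Y : (0 <= translated a Y)%E.
Proof. exact: measure_ge0. Qed.

Lemma translated_sigma_additive a : semi_sigma_additive (translated a).
Proof.
move=> F mF tF mUF; rewrite /translated.
have -> : shiftS (\bigcup_n F n) a = \bigcup_n shiftS (F n) a by [].
apply: measure_semi_sigma_additive.
- by move=> i; apply: measurable_shiftS; apply: mF.
- apply/trivIsetP => i j _ _ ij; apply/seteqP; split=> // x [Fi Fj].
  by move/trivIsetP : tF => /(_ _ _ Logic.I Logic.I ij) E; have : (F i `&` F j) (x - a) by []; rewrite E.
- exact: (measurable_shiftS a mUF).
Qed.

HB.instance Definition _ a := isMeasure.Build _ (measurableTypeR R) R (translated a)
  (translated_0 a) (translated_ge0 a) (@translated_sigma_additive a).

Lemma lebesgue_shiftS Y a : measurable Y -> leb (shiftS Y a) = leb Y.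
Proof.
move=> mY; suff H : forall A, measurable A -> leb A = translated a A by rewrite (H Y).
apply: (@lebesgue_measure_unique R (translated a)) => _ [[b c] /= bc <-].
rewrite /translated (_ : shiftS _ _ = `]b + a, c + a]%classic); last first.
  by apply/seteqP; split=> x; rewrite /shiftS /= !in_itv /= ltrBrDr lerBlDr.
rewrite !lebesgue_measure_itv /= !lte_fin ltrD2r; case: ifP => // _.
by rewrite -!EFinB; congr (_%:E); ring.
Qed.

Lemma negligible_shiftS Y a : leb.-negligible Y -> leb.-negligible (shiftS Y a).
Proof.
move=> [Z [mZ Z0 YZ]]; exists (shiftS Z a); split.
- exact: measurable_shiftS.
- by rewrite lebesgue_shiftS.
- by move=> x /YZ.
Qed.

Definition circ Y : \bar R := leb ((`[0, 1[ : set R) `&` Y).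

Let m01 : measurable (`[0%R, 1%R[%classic : set R). Proof. exact: measurable_itv. Qed.

Lemma circ_ge0 Y : (0 <= circ Y)%E. Proof. exact: measure_ge0. Qed.

Lemma le_circ Y Z : measurable Y -> measurable Z -> Y `<=` Z -> (circ Y <= circ Z)%E.
Proof.
by move=> mY mZ YZ; apply: le_measure; rewrite ?inE; [apply: measurableI..|apply: setIS].
Qed.

Lemma circT : circ setT = 1%E.
Proof. by rewrite /circ setIT lebesgue_measure_itv /= lte_fin ltr01 sube0. Qed.

Lemma circ_le1 Y : measurable Y -> (circ Y <= 1)%E.
Proof. by move=> mY; rewrite -circT; apply: le_circ. Qed.

Lemma circ_fin Y : measurable Y -> circ Y \is a fin_num.
Proof.
by move=> mY; rewrite ge0_fin_numE ?circ_ge0 //; apply: le_lt_trans (circ_le1 mY) _; rewrite ltry.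
Qed.

Lemma circU Y Z : measurable Y -> measurable Z -> (circ (Y `|` Z) <= circ Y + circ Z)%E.
Proof.
move=> mY mZ; rewrite /circ setIUr.
by apply: (measureU2 leb); apply: measurableI.
Qed.

Lemma circ_bigcup (F : nat -> set R) : (forall i, measurable (F i)) ->
  (circ (\bigcup_i F i) <= \sum_(0 <= i <oo) circ (F i))%E.
Proof.
move=> mF; rewrite /circ setI_bigcupr.
have mI i : measurable ((`[0, 1[ : set R) `&` F i) by apply: measurableI.
apply: (measure_sigma_subadditive leb mI) => //.
by apply: bigcup_measurable => i _; exact: mI.
Qed.

Lemma circ_bigcup_ord (F : nat -> set R) n : (forall i, measurable (F i)) ->
  (circ (\bigcup_(i in `I_n) F i) <= \sum_(0 <= i < n) circ (F i))%E.
Proof.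
move=> mF; elim: n => [|n IH]; first by rewrite II0 bigcup_set0 big_geq // /circ setI0 measure0.
rewrite big_nat_recr //=; apply: le_trans (leeD IH (lexx _)).
have mB : measurable (\bigcup_(i in `I_n) F i) by apply: bigcup_measurable.
apply: le_trans (circU mB (mF n)); apply: le_circ.
- by apply: bigcup_measurable.
- exact: measurableU.
move=> t [i /= ni Fi]; move: ni; rewrite ltnS leq_eqVlt => /orP[/eqP <-|ni]; first by right.
by left; exists i.
Qed.

Lemma circ_shiftS Y a : measurable Y -> periodic Y -> circ (shiftS Y a) = circ Y.
Proof.
move=> mY pY.
wlog a01 : a / 0 <= a < 1.
  move=> H; rewrite -(H (fracR a)) ?fracR_itv //; congr circ.
  have [k E] := fracRE a.
  by apply/seteqP; split=> x; apply: pY; rewrite E; [exists k|exists (- k)]; rewrite ?intrN; ring.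
have /andP[a0 a1] := a01.
have e1 : - a <= 0 by lra.
have e2 : 0 <= 1 - a by lra.
have e3 : 1 - a <= 1 by lra.
rewrite /circ.
have -> : (`[0, 1[ : set R) `&` shiftS Y a = shiftS ((`[- a, 1 - a[ : set R) `&` Y) a.
  by apply/seteqP; split=> x [h Yx]; split=> //; move: h; rewrite /= !in_itv /= => /andP[h1 h2];
    apply/andP; split; lra.
have mJ b c : measurable ((`[b, c[ : set R) `&` Y) by apply: measurableI => //; apply: measurable_itv.
rewrite lebesgue_shiftS //.
have split_itv b c d : b <= c -> c <= d ->
    leb ((`[b, d[ : set R) `&` Y) = (leb ((`[b, c[ : set R) `&` Y) + leb ((`[c, d[ : set R) `&` Y))%E.
  move=> bc cd.
  have dis : ((`[b, c[ : set R) `&` Y) `&` ((`[c, d[ : set R) `&` Y) = set0.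
    apply/seteqP; split=> // x [[/= h1 _] [h2 _]]; move: h1 h2; rewrite /= !in_itv /=.
    by move=> /andP[_ xc] /andP[cx _]; move: xc; rewrite ltNge cx.
  rewrite -(measureU leb (mJ b c) (mJ c d) dis).
  congr (leb _); apply/seteqP; split=> x /=; rewrite !in_itv /=.
    move=> [/andP[h1 h2] Yx]; have [xc|cx] := ltP x c; [left|right];
    by split=> //; rewrite ?h1 ?h2.
  by case=> -[/andP[h1 h2] Yx]; split=> //; apply/andP; split=> //; lra.
rewrite (split_itv _ _ _ e1 e2) (split_itv _ _ _ e2 e3).
rewrite addeC; congr (_ + _)%E.
rewrite -(@lebesgue_shiftS ((`[- a, 0[ : set R) `&` Y) 1) //; congr (leb _).
apply/seteqP; split=> x [h Yx]; (split; [move: h; rewrite /= !in_itv /=; lra|]).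
  by apply: pY Yx; exists (-1); rewrite intrN.
by apply: pY Yx; exists 1; ring.
Qed.

Lemma circ_shift_sum Y (s : nat -> R) n (e : \bar R) :
  measurable Y -> periodic Y -> (circ Y <= e)%E ->
  (circ (\bigcup_(i in `I_n) shiftS Y (s i)) <= n%:R%:E * e)%E.
Proof.
move=> mY pY Ye; have mS i : measurable (shiftS Y (s i)) by apply: measurable_shiftS.
apply: le_trans (circ_bigcup_ord _ mS) _.
under eq_bigr do rewrite circ_shiftS //.
rewrite big_const_nat subn0.
rewrite (_ : iter _ _ _ = n%:R%:E * circ Y)%E; first by apply: lee_wpmul2l.
elim: n => [|n IH] /=; first by rewrite mul0e.
by rewrite IH -natr1 EFinD ge0_muleDl // mul1e addeC.
Qed.

Lemma open_arc_open b c : open (open_arc b c).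
Proof.
rewrite (_ : open_arc b c = \bigcup_(k in [set: int]) shiftS `]b, c[%classic (- k%:~R)).
  apply: bigcup_open => k _.
  rewrite (_ : shiftS _ _ = `]b - k%:~R, c - k%:~R[%classic); first exact: interval_open.
  by apply/seteqP; split=> x; rewrite /shiftS /= !in_itv /= opprK ltrBlDr ltrBrDr.
apply/seteqP; split=> x.
  by case=> k h; exists k => //; rewrite /shiftS /= in_itv /= opprK.
by case=> k _; rewrite /shiftS /= in_itv /= opprK => h; exists k.
Qed.

Lemma closed_arc_measurable b c : measurable (closed_arc b c).
Proof.
rewrite (_ : closed_arc b c = \bigcup_(k in [set: int]) shiftS `[b, c]%classic (- k%:~R)).
  apply: countable_bigcupT_measurable => [|k]; first exact: countableP.
  by apply: measurable_shiftS; apply: measurable_itv.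
apply/seteqP; split=> x.
  by case=> k h; exists k => //; rewrite /shiftS /= in_itv /= opprK.
by case=> k _; rewrite /shiftS /= in_itv /= opprK => h; exists k.
Qed.

Lemma circ_open_arc b c : b < c -> (circ (open_arc b c) <= (c - b)%:E)%E.
Proof.
move=> bc; have mO x y : measurable (open_arc x y) by apply: open_measurable; apply: open_arc_open.
have [c1|c1] := leP 1 (c - b); first by apply: le_trans (circ_le1 (mO _ _)) _; rewrite lee_fin.
have -> : open_arc b c = shiftS (open_arc 0 (c - b)) b.
  by apply/seteqP; split=> x [k h]; exists k; move: h => /andP[h1 h2]; apply/andP; split; lra.
rewrite circ_shiftS //; last by move=> x y; apply: open_arc_eqZ.
rewrite /circ; apply: le_trans (_ : leb (`]0%R, (c - b)%R[%classic : set R) <= _)%E.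
  apply: le_measure; [rewrite inE; exact: (measurableI _ _ m01 (mO 0 (c - b)))
                     |rewrite inE; exact: measurable_itv|].
  move=> x [/=]; rewrite !in_itv /= => /andP[x0 x1] [k /andP[h1 h2]].
  suff k0 : k = 0 by move: h1 h2; rewrite k0 addr0 => -> ->.
  by apply: (@int_abs_lt1 R); rewrite ltr_norml; apply/andP; split; lra.
by rewrite lebesgue_measure_itv /= lte_fin subr_gt0 bc sube0.
Qed.

Section UnionArcs.
Variables (Y : set R) (N : nat) (e : R).
Hypothesis YN : union_arcs Y N e.

Lemma union_arcs_open : open Y.
Proof.
have [b [c [_ [_ ->]]]] := YN.
rewrite (_ : [set x | _] = \bigcup_(i in `I_N) open_arc (b i) (c i)).
  by apply: bigcup_open => i _; apply: open_arc_open.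
by apply/seteqP; split=> x [i iN h]; exists i.
Qed.

Lemma union_arcs_periodic : periodic Y.
Proof.
have [b [c [_ [_ ->]]]] := YN => x y xy [i iN h]; exists i => //.
exact: open_arc_eqZ xy h.
Qed.

Lemma union_arcs_circ : (circ Y <= (N%:R * e)%:E)%E.
Proof.
have [b [c [h [_ E]]]] := YN.
have mO i : measurable (open_arc (b i) (c i)) by apply: open_measurable; apply: open_arc_open.
rewrite (_ : Y = \bigcup_(i in `I_N) open_arc (b i) (c i)); last first.
  by rewrite E; apply/seteqP; split=> x [i iN hx]; exists i.
apply: le_trans (circ_bigcup_ord _ mO) _; rewrite big_mkord.
apply: le_trans (_ : (\sum_(i < N) e%:E <= _)%E).
  apply: lee_sum => i _; have [h1 h2] := h i (ltn_ord i).
  by apply: le_trans (circ_open_arc h1) _; rewrite lee_fin ltW.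
by rewrite sumEFin lee_fin sumr_const card_ord mulr_natl.
Qed.

End UnionArcs.

(** * Recurrence from ergodicity of the rotation *)

Section Ergodic.
Variables (omega rho : R).
Hypothesis rhoE : rho = omega \/ rho = - omega.
Hypothesis ergodic : forall Y, measurable Y -> periodic Y ->
  (forall t, Y t <-> Y (t + omega)) -> circ Y = 0%E \/ circ Y = 1%E.

(** The set Y of points whose backward orbit misses G is only one-sidedly invariant. The
    intersection Z of its translates is fully invariant and has the same measure, since the
    translates decrease and share one measure. Measure 1 would force G to be null. *)
Lemma ergodic_cover (G : set R) : measurable G -> periodic G -> circ G != 0%E ->
  circ [set t | forall k : nat, ~ G (t - k%:R * rho)] = 0%E.
Proof.
move=> mG pG G0; set Y := [set t | _].
have YE : Y = \bigcap_(k in [set: nat]) ~` shiftS G (k%:R * rho).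
  by apply/seteqP; split=> t h k; [move=> _; apply: h|apply: (h k)].
have mY : measurable Y.
  rewrite YE; apply: bigcap_measurable; first by exists 0%N.
  by move=> k _; apply: measurableC; apply: measurable_shiftS.
have pY : periodic Y.
  move=> x y [k ->] h n Gy; apply: (h n); apply: pG Gy; exists (- k); rewrite intrN; ring.
have Ydec t n : Y (t + n.+1%:R * rho) -> Y (t + n%:R * rho).
  move=> h k; have := h k.+1; congr (~ G _); rewrite -!natr1; ring.
pose Yn n := shiftS Y (- (n%:R * rho)).
pose Z := \bigcap_n Yn n.
have mYn n : measurable (Yn n) by apply: measurable_shiftS.
have mZ : measurable Z by apply: bigcap_measurable => //; exists 0%N.
have pZ : periodic Z.
  by move=> x y xy h n _; apply: (periodic_shiftS pY xy); apply: h.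
have Zrho t : Z t <-> Z (t + rho).
  split=> h n _.
    by have := h n.+1 Logic.I; rewrite /Yn /shiftS /= !opprK; congr Y; rewrite -natr1; ring.
  have : Y (t + n.+1%:R * rho).
    by have := h n Logic.I; rewrite /Yn /shiftS /= opprK; congr Y; rewrite -natr1; ring.
  by move/Ydec; rewrite /Yn /shiftS /= opprK.
have Zom t : Z t <-> Z (t + omega).
  case: rhoE => E; first by rewrite -E.
  have := Zrho (t + omega); rewrite E addrK => H.
  by split => /H.
have ZY : circ Z = circ Y.
  have cvgZ : circ (Yn n) @[n --> \oo] --> circ Z.
    have E : (`[0, 1[ : set R) `&` Z = \bigcap_n ((`[0, 1[ : set R) `&` Yn n).
      apply/seteqP; split=> t; first by case=> t01 Zt n _; split=> //; apply: Zt.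
      by move=> h; split; [have [] := h 0%N Logic.I|move=> n _; have [] := h n Logic.I].
    rewrite /circ E; apply: (@nonincreasing_cvg_mu _ _ _ leb).
    - by apply: le_lt_trans (circ_le1 (mYn 0%N)) _; rewrite ltry.
    - by move=> n; exact: (measurableI _ _ m01 (mYn n)).
    - by rewrite -E; exact: (measurableI _ _ m01 mZ).
    - apply/nonincreasing_seqP => n; apply/subsetPset; apply: setIS => t.
      by rewrite /Yn /shiftS /= !opprK; apply: Ydec.
  have E n : circ (Yn n) = circ Y by apply: circ_shiftS.
  by have := cvg_lim _ cvgZ; under eq_fun do rewrite E; rewrite lim_cst // => ->.
rewrite -ZY; have [//|Z1] := ergodic mZ pZ Zom.
have YG : Y `<=` ~` G by move=> t /(_ 0%N); rewrite mul0r subr0.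
have G1 : (circ G + circ Y <= 1)%E.
  have dis : ((`[0, 1[ : set R) `&` G) `&` ((`[0, 1[ : set R) `&` Y) = set0.
    by apply/seteqP; split=> // t [[_ Gt] [_ /YG]].
  rewrite /circ -(measureU leb (measurableI _ _ m01 mG) (measurableI _ _ m01 mY) dis).
  by rewrite -setIUr; apply: circ_le1; exact: measurableU.
exfalso; move/negP: G0; apply; apply/eqP.
move: G1; rewrite -ZY Z1 -leeBrDr // subee // => G1.
by apply/eqP; rewrite eq_le G1 circ_ge0.
Qed.

End Ergodic.

End CircleMeasure.

Section RawIntegral.
Context d (T : measurableType d) (R : realType) (m : set T -> \bar R).
Import HBNNSimple.

(* Valid without measurability: the integral of a nonnegative function is a
   supremum over the simple functions below it. *)
Lemma le_integral_raw (D : set T) (f g : T -> \bar R) :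
  (forall x, D x -> (f x <= g x)%E) -> (\int[m]_(x in D) f x <= \int[m]_(x in D) g x)%E.
Proof.
move=> fg.
pose nn (f : T -> \bar R) := ereal_sup
  [set sintegral m k | k in [set k : {nnsfun T >-> R} | forall x, ((k x)%:E <= f x)%E]].
have mono (u v : T -> \bar R) : (forall x, (u x <= v x)%E) -> (nn u <= nn v)%E.
  move=> uv; apply: ub_ereal_sup => _ [k ku <-]; apply: ereal_sup_ubound; exists k => // x.
  exact: le_trans (ku x) (uv x).
have fgD x : ((f \_ D) x <= (g \_ D) x)%E.
  rewrite !patchE; case: ifP => // /set_mem; exact: fg.
apply: leeB; apply: mono => x; rewrite ?funeposE ?funenegE.
  by rewrite ge_max !le_max fgD lexx orbT.
by rewrite ge_max !le_max leeN2 fgD lexx orbT.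
Qed.

End RawIntegral.

Section IntegralBound.
Variable R : realType.
Local Notation leb := (@lebesgue_measure R).

Lemma integral_two_values (B : set R) (a b : R) : measurable B ->
  (\int[leb]_(t in `[0%R, 1%R]) (a + b * \1_B t)%:E = a%:E + b%:E * circ B)%E.
Proof.
move=> mB; have m01 : measurable (`[0%R, 1%R]%classic : set R) by exact: measurable_itv.
have leb01 : leb `[0%R, 1%R]%classic = 1%E by rewrite lebesgue_measure_itv /= lte_fin ltr01 sube0.
have ind : leb.-integrable `[0%R, 1%R] (fun t => (\1_B t : R)%:E).
  apply/integrableP; split; first by apply/measurable_EFinP; exact: measurable_indic.
  under eq_integral do rewrite gee0_abs ?lee_fin //.
  rewrite integral_indic //; apply: le_lt_trans (_ : leb `[0%R, 1%R]%classic < +oo)%E.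
    by apply: le_measure; rewrite ?inE //; exact: measurableI.
  by rewrite leb01 ltry.
have cst_int : leb.-integrable `[0%R, 1%R] (fun=> a%:E).
  apply/integrableP; split; first exact: measurable_cst.
  by rewrite integral_cst //= leb01 mule1 ltry.
under eq_integral do rewrite EFinD EFinM.
rewrite integralD //; last exact: integrableZl.
rewrite integral_cst //= leb01 mule1 integralZl //= integral_indic //=.
congr (_ + _ * _)%E; rewrite /circ setIC.
have E : `[0%R, 1%R]%classic = (`[0%R, 1%R[%classic : set R) `|` [set 1] by rewrite setUitv1 // bnd_simp.
have mI : measurable ((`[0%R, 1%R[%classic : set R) `&` B).
  by apply: measurableI => //; exact: measurable_itv.
have m1 : measurable ([set (1 : R)] `&` B) by exact: measurableI.
have dis : ((`[0%R, 1%R[%classic : set R) `&` B) `&` ([set 1] `&` B) = set0.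
  by apply/seteqP; split=> // x [[/= h _] [/= h1 _]]; move: h; rewrite h1 in_itv /= ltxx andbF.
rewrite E setIUl (measureU leb mI m1 dis) /= (_ : leb ([set (1 : R)%R] `&` B) = 0%E) ?adde0 //.
apply/eqP; rewrite -measure_le0; apply: le_trans (_ : leb [set (1 : R)%R] <= _)%E; last first.
  by rewrite lebesgue_measure_set1.
by apply: le_measure; rewrite ?inE.
Qed.

End IntegralBound.

(** * Rectifiability of trapped graphs *)

Section TrappedGraph.
Variables (R : realType) (omega rho : R) (F : R -> R -> R) (J : nat -> set R) (cm cp : R)
  (Eo : set R) (p q K M : nat -> nat) (a S eta : R) (fst_step : bool).
Hypothesis sys : trapping rho F J cm cp Eo p q K M a S eta fst_step.
Local Notation leb := (@lebesgue_measure R).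
Local Notation C := (closed_arc cm cp).
Local Notation wand := (wandering rho J q).
Local Notation safe := (safe rho J p).
Local Notation good := (good rho J K M).

Variable e : nat -> R.
Hypothesis J_open : forall n, open (J n).
Hypothesis J_periodic : forall n, periodic (J n).
Hypothesis J_small : forall n, (circ (J n) <= (e n)%:E)%E.
Hypothesis e_sum :
  (\sum_(0 <= n <oo) ((2 * K n * M n + 1)%:R * e n)%:E < (1 / 16)%:E)%E.

Variable phi : R -> R.
Hypothesis mphi : measurable_fun setT phi.
Hypothesis phi_periodic : forall t, eqZ (phi (t + 1)) (phi t).
Hypothesis phi_inv : {ae leb, forall t, eqZ (F t (phi t)) (phi (t + rho))}.

Let mJ n : measurable (J n). Proof. exact: open_measurable. Qed.

Let e_ge0 n : 0 <= e n.
Proof. by rewrite -lee_fin; apply: le_trans (J_small n); apply: circ_ge0. Qed.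

Lemma phi_eqZ t u : eqZ t u -> eqZ (phi t) (phi u).
Proof.
have H (n : nat) v : eqZ (phi (v + n%:R)) (phi v).
  elim: n => [|n IH]; first by rewrite addr0; apply: eqZ_refl.
  by apply: eqZ_trans IH; rewrite -natr1 addrA.
case=> k ->; case: k => n; first exact: H.
rewrite NegzE intrN; apply: eqZ_sym.
by have := H n.+1 (u - n.+1%:R); rewrite subrK.
Qed.

(** The base points from which [trapped] can be applied to the graph itself. *)
Definition landing : set R := [set t | safe t /\ C (phi t)].

Lemma safe_measurable : measurable (safe : set R).
Proof.
rewrite (_ : (safe : set R) = \bigcap_j \bigcap_(l in `I_(p j)) ~` shiftS (J j) (- (l%:R * rho))).
  apply: bigcapT_measurable => j; apply: fin_bigcap_measurable => // l _.
  by apply: measurableC; apply: measurable_shiftS.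
apply/seteqP; split=> t h j.
  by move=> _ l /= lp; rewrite /shiftS /= opprK; apply: h.
by move=> l lp; have := h j Logic.I l lp; rewrite /shiftS /= opprK.
Qed.

Lemma landing_measurable : measurable landing.
Proof.
apply: measurableI; first exact: safe_measurable.
rewrite -[X in measurable X]setTI; apply: mphi => //; exact: closed_arc_measurable.
Qed.

Lemma landing_periodic : periodic landing.
Proof.
move=> x y xy [sx Cx]; split; last exact: closed_arc_eqZ (phi_eqZ xy) Cx.
move=> j l lp Jy; apply: (sx j l lp); apply: J_periodic Jy.
by have [k ->] := eqZ_sym xy; exists k; ring.
Qed.

(** If [phi t] were outside [Eo] at a point off the critical windows, the next point of the graph
    would lie in C over a safe base point, that is, in [landing]. Hence a null landing set confines
    the graph to [Eo] off a small set, which will contradict the sign of the exponent. *)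
Lemma no_landing : circ landing = 0%E -> exists B, [/\ measurable B,
  (circ B <= (1 / 16)%:E)%E & forall t, 0 <= t < 1 -> ~ B t -> Eo (phi t)].
Proof.
move=> G0; have [Nn [mN N0 Ninv]] := phi_inv.
(* Index 0 is for trapping at t, indices 1 to [p j] for safety of t + rho. *)
pose V j := \bigcup_(i in `I_(p j).+1) shiftS (J j) (- (i%:R * rho)).
have mV j : measurable (V j) by apply: bigcup_measurable => i _; apply: measurable_shiftS.
have mVV : measurable (\bigcup_j V j) by apply: bigcup_measurable => i _; apply: mV.
have mG := landing_measurable; have pG := landing_periodic.
have mSG : measurable (shiftS landing (- rho)) by apply: measurable_shiftS.
exists (\bigcup_j V j `|` (shiftS landing (- rho) `|` Nn)); split.
- by apply: measurableU => //; apply: measurableU.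
- apply: le_trans (circU mVV _) _; first exact: measurableU.
  rewrite -[leRHS]adde0; apply: leeD; last first.
    apply: le_trans (circU mSG mN) _; rewrite circ_shiftS // G0 add0e.
    rewrite -N0; apply: le_measure; rewrite ?inE //.
    by apply: measurableI; [exact: measurable_itv|exact: mN].
  apply: le_trans (circ_bigcup mV) _; apply: ltW; apply: le_lt_trans e_sum.
  apply: lee_nneseries => [i _ _|i _]; first exact: circ_ge0.
  apply: le_trans (circ_shift_sum _ _ (mJ i) (@J_periodic i) (J_small i)) _.
  rewrite -EFinM lee_fin ler_wpM2r // ler_nat.
  have := tr_p_le sys i; have := tr_M_ge sys i; have := tr_K_gt0 sys i; nia.
- move=> t t01 /not_orP[nV /not_orP[nG nN]].
  have inv : eqZ (F t (phi t)) (phi (t + rho)) by apply: contrapT => h; apply: nN; apply: Ninv.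
  apply: contrapT => nE; apply: nG; rewrite /shiftS /= opprK.
  have nJ j i : (i < (p j).+1)%N -> ~ J j (t + i%:R * rho).
    by move=> ip Jt; apply: nV; exists j => //; exists i => //; rewrite /shiftS /= opprK.
  split.
    move=> j l lp Jl; apply: (nJ j l.+1) => //.
    by move: Jl; congr (J j _); rewrite -natr1; ring.
  apply: closed_arc_eqZ inv _; apply: (tr_trap sys) => // J0.
  by apply: (nJ 0%N 0%N) => //; rewrite mul0r addr0.
Qed.

Lemma good_measurable j : measurable (good j).
Proof.
rewrite (_ : good j = \bigcap_(i in [set i | (j <= i)%N]) \bigcap_(l in `I_(2 * K i * M i).+1)
   (~` shiftS (J i) (l%:R * rho) `&` ~` shiftS (J i) (- (l%:R * rho)))).
  apply: bigcap_measurable; first by exists j => /=.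
  move=> i _; apply: fin_bigcap_measurable => // l _.
  by apply: measurableI; apply: measurableC; apply: measurable_shiftS.
apply/seteqP; split=> t h i.
  move=> /= ji l /= lK; have [h1 h2] := h i l ji lK.
  by split; rewrite /shiftS /= ?opprK.
by move=> l ji lK; have [] := h i ji l lK; rewrite /shiftS /= opprK.
Qed.

Lemma eventually_good : circ (\bigcap_j ~` good j) = 0%E.
Proof.
set X := \bigcap_j _.
have mX : measurable X.
  by apply: bigcapT_measurable => j; apply: measurableC; apply: good_measurable.
pose b i := ((2 * K i * M i + 1)%:R * e i)%:E.
pose W (sg : R) i := \bigcup_(l in `I_(2 * K i * M i + 1)) shiftS (J i) (sg * (l%:R * rho)).
have mW sg i : measurable (W sg i) by apply: bigcup_measurable => l _; apply: measurable_shiftS.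
have b0 i : (0 <= b i)%E by rewrite lee_fin mulr_ge0.
have Wb sg i : (circ (W sg i) <= b i)%E.
  rewrite /b EFinM; apply: (@circ_shift_sum R (J i) (fun l => sg * (l%:R * rho)) _ (e i)%:E).
  - exact: mJ.
  - exact: J_periodic.
  - exact: J_small.
have tail : (\sum_(n <= k <oo) b k)%E @[n --> \oo] --> 0%E.
  apply: nneseries_tail_cvg => //.
  by apply: lt_trans e_sum _; rewrite ltry.
have Wtail sg n : (circ (\bigcup_i W sg (i + n)%N) <= \sum_(n <= k <oo) b k)%E.
  apply: le_trans (circ_bigcup _) _ => //.
  rewrite -(nneseries_addn (f := b)) //.
  by apply: lee_nneseries => [i _ _|i _]; [exact: circ_ge0|exact: Wb].
have Xle n : (circ X <= \sum_(n <= k <oo) b k + \sum_(n <= k <oo) b k)%E.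
  have m1 sg : measurable (\bigcup_i W sg (i + n)%N) by apply: bigcup_measurable.
  apply: le_trans (leeD (Wtail 1 n) (Wtail (-1) n)).
  apply: le_trans (circU (m1 _) (m1 _)); apply: le_circ => //; first exact: measurableU.
  move=> t /(_ n Logic.I) /= /existsNP[i /existsNP[l /not_implyP[ni /not_implyP[lK]]]].
  have lK' : (l < 2 * K i * M i + 1)%N by rewrite addn1.
  move=> /not_andP[/contrapT Jt|/contrapT Jt]; [left|right];
    exists (i - n)%N => //; rewrite subnK //; exists l => //; rewrite /shiftS /=.
    by rewrite mul1r.
  by rewrite mulN1r opprK.
have lim : (\sum_(n <= k <oo) b k + \sum_(n <= k <oo) b k)%E @[n --> \oo] --> (0 + 0)%E.
  exact: cvgeD.
apply/eqP; rewrite eq_le circ_ge0 andbT -[leRHS]add0e -(cvg_lim _ lim) //.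
apply: lime_ge; first by apply/cvg_ex; exists (0 + 0)%E.
by near=> n; apply: Xle.
Unshelve. all: by end_near. Qed.

Hypothesis rhoE : rho = omega \/ rho = - omega.
Hypothesis ergodic : forall Y, measurable Y -> periodic Y ->
  (forall t, Y t <-> Y (t + omega)) -> circ Y = 0%E \/ circ Y = 1%E.

Lemma tracked_ae : circ landing != 0%E ->
  exists N, [/\ measurable N, leb N = 0%E &
    forall t, 0 <= t < 1 -> ~ N t -> tracked rho F J cm cp q phi t /\ exists j, good j t].
Proof.
move=> G0; have mG := landing_measurable; have pG := landing_periodic.
have Z0 := ergodic_cover rhoE ergodic mG pG G0; set Z := [set t | _] in Z0.
have mZ : measurable Z.
  rewrite (_ : Z = \bigcap_k ~` shiftS landing (k%:R * rho)); last first.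
    by apply/seteqP; split=> t h k; [move=> _; apply: h|apply: (h k)].
  by apply: bigcapT_measurable => k; apply: measurableC; apply: measurable_shiftS.
have pZ : periodic Z.
  by move=> x y [k ->] h n Gy; apply: (h n); apply: pG Gy; exists (- k); rewrite intrN; ring.
pose bad := \bigcup_s (`[0, 1[%classic `&` shiftS Z (s%:R * rho)) `|`
  (\bigcup_s shiftS [set t | ~ eqZ (F t (phi t)) (phi (t + rho))] (s.+1%:R * rho) `|`
   (`[0, 1[%classic `&` \bigcap_j ~` good j)).
have : leb.-negligible bad.
  apply: negligibleU; last apply: negligibleU.
  - apply: negligible_bigcup => s.
    have mI : measurable ((`[0, 1[%classic : set R) `&` shiftS Z (s%:R * rho)).
      by apply: measurableI; [exact: measurable_itv|exact: measurable_shiftS].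
    by eexists; split; [exact: mI|rewrite -[LHS]/(circ _) circ_shiftS|].
  - by apply: negligible_bigcup => s; apply: negligible_shiftS; apply: phi_inv.
  - have mI : measurable ((`[0, 1[%classic : set R) `&` \bigcap_j ~` good j).
      apply: measurableI; first exact: measurable_itv.
      by apply: bigcapT_measurable => j; apply: measurableC; apply: good_measurable.
    by eexists; split; [exact: mI|exact: eventually_good|].
case=> N [mN N0 badN]; exists N; split=> // t t01 nN.
have t01' : (`[0, 1[%classic : set R) t by rewrite /= in_itv.
have nb : ~ bad t by move=> /badN.
move: nb => /not_orP[nZ /not_orP[nI nG]]; split; last first.
  apply: contrapT => h; apply: nG; split=> // j _ gj; apply: h; by exists j.
have inv s : eqZ (phi (t - s%:R * rho)) (F (t - s.+1%:R * rho) (phi (t - s.+1%:R * rho))).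
  apply: contrapT => h; apply: nI; exists s => //; rewrite /shiftS /= => h2; apply: h.
  by apply: eqZ_sym; move: h2; congr (eqZ _ (phi _)); rewrite -natr1; ring.
move=> s; split; first exact: inv.
have : ~ Z (t - s%:R * rho) by move=> h; apply: nZ; exists s.
(* A landing k steps further back; from there the orbit of the graph is trapped up to time s. *)
move=> /existsNP[k /contrapT[sk Ck]].
have := trapped sys k sk Ck; rewrite subrK => -[Co|]; [left|by right].
apply: closed_arc_eqZ Co; apply: eqZ_sym; apply: (invariant_orb sys) => i.
by have := inv (s + i)%N; rewrite -!addrA -!opprD -!mulrDl -!natrD addnS.
Qed.

Theorem trapped_rectifiable : circ landing != 0%E -> rectifiable_measure (muphi phi).
Proof.
move=> G0; have [N [mN N0 NT]] := tracked_ae G0.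
have [rL rLP] : {rL : nat -> R * R & forall j, 0 < (rL j).1 /\ forall t t',
    good j t -> good j t' -> tracked rho F J cm cp q phi t -> tracked rho F J cm cp q phi t' ->
    `|t - t'| < (rL j).1 -> dT (phi t) (phi t') <= (rL j).2 * `|t - t'|}.
  apply: (@choice _ _ (fun j (rL : R * R) => 0 < rL.1 /\ forall t t', good j t -> good j t' ->
    tracked rho F J cm cp q phi t -> tracked rho F J cm cp q phi t' ->
    `|t - t'| < rL.1 -> dT (phi t) (phi t') <= rL.2 * `|t - t'|)) => j.
  by have [r [L H]] := tracked_lipschitz sys phi j; exists (r, L).
(* The Lipschitz bound at level j holds only at distances below [(rL j).1], so each good set is cut
   into intervals of that length. *)
pose P (jk : nat * nat) : set R := (`[0, 1[%classic `\` N) `&` (good jk.1 `&`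
  `[jk.2%:R * (rL jk.1).1, jk.2.+1%:R * (rL jk.1).1[%classic).
pose D n : set R := if unpickle n is Some jk then P jk else set0.
pose L n : R := if @unpickle (nat * nat)%type n is Some jk then `|(rL jk.1).2| else 0.
have mP jk : measurable (P jk).
  apply: measurableI; first by apply: measurableD => //; exact: measurable_itv.
  by apply: measurableI; [exact: good_measurable|exact: measurable_itv].
have mD n : measurable (D n) by rewrite /D; case: unpickle.
have PT jk t : P jk t -> [/\ 0 <= t < 1, good jk.1 t & tracked rho F J cm cp q phi t].
  move=> [[t01 nN] [gt _]]; rewrite /= in_itv /= in t01; split=> //.
  by have [] := NT t t01 nN.
apply: (@rectifiable_muphi R phi mphi D L) => //.
- by move=> n t; rewrite /D; case: unpickle => // jk /PT[].
- by move=> n; rewrite /L; case: unpickle.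
- move=> n u v; rewrite /D /L; case: unpickle => // jk Pu Pv.
  have [_ gu Tu] := PT _ _ Pu; have [_ gv Tv] := PT _ _ Pv.
  have uv : `|u - v| < (rL jk.1).1.
    case: Pu => _ [_]; case: Pv => _ [_]; rewrite /= !in_itv /= -!natr1 !mulrDl !mul1r.
    by move=> /andP[h1 h2] /andP[h3 h4]; rewrite ltr_norml; apply/andP; split; lra.
  apply: le_trans ((rLP jk.1).2 u v gu gv Tu Tv uv) _.
  by rewrite ler_wpM2r // ler_norm.
- apply/eqP; rewrite eq_le measure_ge0 andbT -N0; apply: le_measure; rewrite ?inE //.
    by apply: measurableD; [exact: measurable_itv|by apply: bigcup_measurable => n _; exact: mD].
  move=> t [/= t01 nD]; rewrite in_itv /= in t01; apply: contrapT => nN; apply: nD.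
  have [Tt [j gj]] := NT t t01 nN; have /andP[t0 _] := t01; have [r0 _] := rLP j.
  pose k := Num.truncn (t / (rL j).1).
  have /andP[k1 k2] := truncn_itv (divr_ge0 t0 (ltW r0)).
  exists (pickle (j, k)) => //; rewrite /D pickleK; split.
    by split=> //; rewrite /= in_itv.
  by split=> //; rewrite /= in_itv /= -ler_pdivlMr // k1 -ltr_pdivrMr.
Qed.

End TrappedGraph.

(** * The two trapping systems *)

Section DerivativeBounds.
Variables (R : realType) (f : R -> R) (lo hi : R).
Hypothesis f_deriv : forall x : R, derivable f x 1.
Hypothesis f_bilip : forall x y, lo * dT x y <= dT (f x) (f y) <= hi * dT x y.

Lemma derive_dT_bounds (x : R) : lo <= `|derive1 f x| <= hi.
Proof.
have cq : (fun h => h^-1 *: (f (h + x) - f x)) @ 0^' --> derive1 f x.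
  have dfx : derivable f x 1 := @f_deriv x.
  rewrite derive1E (_ : (fun h => _) =
      (fun h => h^-1 *: ((f \o shift x) (h *: 1) - f x))); first exact: dfx.
  by apply/funext => h /=; rewrite [h%:A]mulr1.
have cn : `|h^-1 *: (f (h + x) - f x)| @[h --> 0^'] --> `|derive1 f x| by exact: cvg_norm cq.
have fc : {for x, continuous f}.
  by apply/differentiable_continuous; apply/derivable1_diffP; exact: (@f_deriv x).
have nearq : \forall h \near 0^', lo <= `|h^-1 *: (f (h + x) - f x)| <= hi.
  have n1 : \forall h \near (0 : R)^', `|f (h + x) - f x| < 1 / 2.
    have : \forall y \near x, `|f y - f x| < 1 / 2.
      move/cvgrPdist_lt : fc => /(_ (1 / 2) ltac:(lra)).
      by apply: filterS => y; rewrite distrC.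
    move=> /nbhs_ballP[r /= r0 H]; near=> h; apply: H; rewrite /ball /=.
    rewrite opprD addrCA subrr addr0 normrN; near: h.
    by apply: dnbhs0_lt.
  have n2 : \forall h \near (0 : R)^', `|h| < 1 / 2 by apply: dnbhs0_lt; lra.
  near=> h.
  have h0 : h != 0 by near: h; exact: nbhs_dnbhs_neq.
  have h2 : `|h| < 1 / 2 by near: h.
  have h1 : `|f (h + x) - f x| < 1 / 2 by near: h.
  have := f_bilip (h + x) x; rewrite !dT_small ?addrK ?(ltW h1) ?(ltW h2) //.
  have hp : 0 < `|h| by rewrite normr_gt0.
  have -> : `|h^-1 *: (f (h + x) - f x)| = `|f (h + x) - f x| / `|h|.
    by rewrite normrZ normfV mulrC.
  by rewrite ler_pdivlMr // ler_pdivrMr.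
rewrite -(cvg_lim _ cn) //; apply/andP; split.
  apply: limr_ge; first by apply/cvg_ex; eexists; exact: cn.
  by near=> h; have /andP[] : lo <= `|h^-1 *: (f (h + x) - f x)| <= hi by near: h.
apply: limr_le; first by apply/cvg_ex; eexists; exact: cn.
by near=> h; have /andP[] : lo <= `|h^-1 *: (f (h + x) - f x)| <= hi by near: h.
Unshelve. all: by end_near. Qed.

Lemma mean_value (u v : R) : exists c, [/\ Num.min u v <= c <= Num.max u v &
  f u - f v = derive1 f c * (u - v)].
Proof.
wlog uv : u v / u < v.
  move=> H; case: (boolP (u < v)) => [uv|nuv]; first exact: H.
  case: (boolP (v < u)) => [vu|nvu].
    have [c [h1 h2]] := H v u vu; exists c; split; first by rewrite minC maxC.
    by rewrite -opprB h2 -mulrN opprB.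
  have -> : u = v by apply/eqP; rewrite eq_le !leNgt nuv nvu.
  by exists v; rewrite minxx maxxx lexx !subrr mulr0.
have [|c cuv E] := @MVT R f (derive1 f) u v uv _ (derivable_within_continuous (fun x _ => @f_deriv x)).
  by move=> x _; rewrite derive1E; apply: DeriveDef.
move: cuv; rewrite in_itv /= => /andP[uc cv]; exists c; split.
  by rewrite min_l ?max_r ?(ltW uv) // !ltW.
by rewrite -opprB E -mulrN opprB.
Qed.

End DerivativeBounds.

Section ConstantK.
Variable R : realType.

(* 1 + 191/2000 is slightly larger than sqrt (6/5), and the product of the 1 - x_i
   times 1 + the sum of the x_i is at most 1. *)
Lemma sum_inv_K (K0 kappa : nat) : (2 <= kappa)%N -> (1 <= K0)%N ->
  Num.sqrt (5 / 6) < limn (Defs.bseq R K0 kappa) ->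
  forall n, \sum_(i < n) (Kseq K0 kappa i)%:R^-1 <= 191 / 2000 :> R.
Proof.
move=> k2 K1 hb n; set b := (Defs.bseq R K0 kappa) in hb *.
pose x i : R := (Kseq K0 kappa i)%:R^-1.
have x01 i : 0 <= x i <= 1.
  rewrite /x invr_ge0 ler0n /= invf_le1 ?ler1n ?ltr0n /Kseq muln_gt0 expn_gt0; lia.
have bS i : b i.+1 = b i * (1 - x i) by rewrite /b /Defs.bseq big_ord_recr.
have b0 i : 0 <= b i.
  elim: i => [|i IH]; first by rewrite /b /Defs.bseq big_ord0.
  by rewrite bS mulr_ge0 // subr_ge0; have /andP[] := x01 i.
have bdec : nonincreasing_seq b.
  by apply/nonincreasing_seqP => i; rewrite bS ler_piMr //; have /andP[] := x01 i; lra.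
have bcvg : cvgn b.
  by apply: nonincreasing_is_cvgn => //; exists 0 => _ [i _ <-].
have bn : Num.sqrt (5 / 6) < b n by apply: lt_le_trans hb (nonincreasing_cvgn_ge bdec bcvg n).
have key : b n * (1 + \sum_(i < n) x i) <= 1.
  elim: (n) => [|i IH]; first by rewrite big_ord0 addr0 mulr1 /b /Defs.bseq big_ord0.
  rewrite bS big_ord_recr /=; apply: le_trans IH; rewrite -mulrA ler_wpM2l //.
  have s0 : 0 <= \sum_(j < i) x j by apply: sumr_ge0 => j _; have /andP[] := x01 j.
  have /andP[xi0 xi1] := x01 i; move: s0 xi0; set s := \sum_(j < i) _; set y := x i.
  by move=> s0 y0; rewrite -subr_ge0; have := mulr_ge0 s0 y0; have := sqr_ge0 y; rewrite expr2; lra.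
have sq : (5 / 6 : R) < b n ^+ 2.
  rewrite -[ltLHS](@sqr_sqrtr R); last lra.
  by rewrite ltrXn2r ?sqrtr_ge0.
rewrite -/x; move: key sq (b0 n); set s := \sum_(i < n) _; set y := b n => key sq y0.
rewrite leNgt; apply/negP => hs; have s0 : 0 < 1 + s by lra.
have h1 : (y * (1 + s)) ^+ 2 <= 1.
  by rewrite expr_le1 // mulr_ge0 // ltW.
rewrite exprMn in h1.
have h2 : (6 / 5 : R) < (1 + s) ^+ 2.
  have : 0 < (s - 191 / 2000) * (s + 191 / 2000) by apply: mulr_gt0; lra.
  by rewrite expr2; lra.
have : (5 / 6) * (6 / 5) < y ^+ 2 * (1 + s) ^+ 2 by apply: ltr_pM => //; lra.
by move: h1; set z := _ * _; lra.
Qed.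

Lemma sixth_root (alpha : R) : 4 < alpha -> exists a, [/\ 1 < a, 2 <= a ^+ 3 & a ^+ 6 = alpha].
Proof.
move=> a4; have a0 : 0 < alpha by lra.
pose a := alpha `^ (6^-1); exists a.
have E : a ^+ 6 = alpha.
  by rewrite -powR_mulrn ?powR_ge0 // -powRrM mulVf // powRr1 // ltW.
have ap : 0 < a by apply: powR_gt0.
have a3 : 2 <= a ^+ 3.
  rewrite leNgt; apply/negP => h; have : (a ^+ 3) ^+ 2 < 2 ^+ 2.
    by rewrite ltrXn2r // ?exprn_ge0 // ltW.
  by rewrite -exprM E; lra.
split=> //; rewrite ltNge; apply/negP => h.
have : a ^+ 3 <= 1 by rewrite expr_le1 // ltW.
by lra.
Qed.

End ConstantK.

Section Instances.
Variables (R : realType) (omega : R) (g h : R -> R -> R) (cm cp em ep : R) (I0 : set R)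
  (N : nat) (alpha S : R) (kappa K0 : nat) (M : nat -> nat) (eps : nat -> R).
Local Notation C := (closed_arc cm cp).
Local Notation E := (closed_arc em ep).
Local Notation I := (Iseq omega g C E M I0).
Local Notation K := (Kseq K0 kappa).

Hypothesis gh : skew_C1_diffeo g h.
Hypotheses (cp_lt : cp - cm < 1) (ep_lt : ep - em < 1).
Hypothesis CE0 : C `&` E = set0.
Hypotheses (alpha4 : 4 < alpha) (S_gt0 : 0 < S).
Hypothesis trap : forall t x, ~ open_arc em ep x -> ~ I0 t -> open_arc cm cp (g t x).
Hypothesis bilip : forall t t' x x', alpha ^- 2 * dT x x' <= dT (g t x) (g t x') /\
  dT (g t x) (g t x') <= alpha ^+ 2 * dT x x' /\ dT (g t x) (g t' x) <= S * dT t t'.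
Hypothesis contrC : forall t x, C x -> `|dx g t x| <= alpha^-1.
Hypothesis expE : forall t x, E x -> alpha <= `|dx g t x|.
Hypotheses (kappa2 : (2 <= kappa)%N) (K01 : (1 <= K0)%N).
Hypothesis K_prod : Num.sqrt (5 / 6) < limn (Defs.bseq R K0 kappa).
Hypotheses (M_inc : forall n, (M n < M n.+1)%N) (M02 : (2 <= M 0%N)%N).
Hypothesis eps_sum :
  (\sum_(0 <= n <oo) (((2 * K n * M n + 1) * N)%:R * eps n)%:E < (1 / 16)%:E)%E.
Hypothesis returns : forall j, I j `&` [set t | exists k, (1 <= k <= 2 * K j * M j)%N /\
  shiftS (I j) (k%:R * omega) t] = set0.
Hypothesis apart : forall j, (1 <= j)%N ->
  ([set t | I j (t + ((M j)%:R - 1) * omega)] `|`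
   [set t | I j (t - ((M j)%:R + 1) * omega)]) `&`
  (Wplus omega g C E M I0 j.-1 `|` Wminus omega g C E M I0 j.-1) = set0.
Hypothesis arcs : forall n, union_arcs (I n) N (eps n).

Let alpha0 : 0 < alpha. Proof. by apply: lt_trans alpha4. Qed.

Let alpha1 : 1 <= alpha. Proof. by apply: ltW; apply: lt_trans alpha4; rewrite ltr1n. Qed.

Lemma C1_derivable u t x : @C1_2 R u -> derivable (u t) x 1.
Proof. by move=> [u1 [u2 [_ [_ [_ H]]]]]; apply: (@ex_derive _ _ _ _ _ _ _ (H t x)). Qed.

Let g_deriv t (x : R) : derivable (g t) x 1.
Proof. by apply: C1_derivable; case: gh => _ [_ []]. Qed.

Let hg t x : h t (g t x) = x. Proof. by case: gh => _ [_ [_ [_ []]]]. Qed.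
Let gK t x : g t (h t x) = x. Proof. by case: gh => _ [_ [_ [_ []]]]. Qed.

Lemma g_eqZ t x y : eqZ x y -> eqZ (g t x) (g t y).
Proof.
move=> xy; apply: dT_eq0; apply/eqP; rewrite eq_le dT_ge0 andbT.
by have [_ [H _]] := bilip t t x y; rewrite (dT_eqZ0 xy) mulr0 in H.
Qed.

Let alpha2V x : alpha ^- 2 * x * alpha ^+ 2 = x.
Proof. by rewrite mulrAC mulVf ?mul1r // expf_neq0 // gt_eqF. Qed.

Lemma h_lip t x y : dT (h t x) (h t y) <= alpha ^+ 2 * dT x y.
Proof.
have [H _] := bilip t t (h t x) (h t y); rewrite !gK in H.
by rewrite mulrC -[leLHS](alpha2V) ler_wpM2r // exprn_ge0 // ltW.
Qed.

Lemma h_lip_base t t' x : dT (h t x) (h t' x) <= alpha ^+ 2 * (S * dT t t').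
Proof.
rewrite -{1}(gK t' x); set w := h t' x.
have -> : dT (h t (g t' w)) w = dT (h t (g t' w)) (h t (g t w)) by rewrite hg.
apply: le_trans (h_lip _ _ _) _; rewrite ler_wpM2l ?exprn_ge0 ?(ltW alpha0) //.
by rewrite dT_sym; have [_ [_]] := bilip t t' w w.
Qed.

Lemma h_eqZ t x y : eqZ x y -> eqZ (h t x) (h t y).
Proof.
move=> xy; apply: dT_eq0; apply/eqP; rewrite eq_le dT_ge0 andbT.
by apply: le_trans (h_lip _ _ _) _; rewrite (dT_eqZ0 xy) mulr0.
Qed.

Lemma dx_bounds t x : alpha ^- 2 <= `|dx g t x| <= alpha ^+ 2.
Proof.
apply: derive_dT_bounds => [y|y z]; first exact: g_deriv.
by have [-> [-> _]] := bilip t t y z.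
Qed.

Lemma closed_arc_between b c u v x : b <= u <= c -> b <= v <= c ->
  Num.min u v <= x <= Num.max u v -> @closed_arc R b c x.
Proof.
move=> /andP[h1 h2] /andP[h3 h4] /andP[h5 h6]; exists 0; rewrite addr0; apply/andP; split.
  by apply: le_trans h5; rewrite le_min h1.
by apply: le_trans h6 _; rewrite ge_max h2.
Qed.

Lemma contraction_C t t' x x' : C x -> C x' -> dT x x' < 1 - (cp - cm) ->
  dT (g t x) (g t' x') <= alpha^-1 * dT x x' + S * dT t t'.
Proof.
move=> [k hk] [l hl] small; set u := x + k%:~R in hk; set v := x' + l%:~R in hl.
have xu : eqZ x u by apply: eqZ_sym; exists k.
have xv : eqZ x' v by apply: eqZ_sym; exists l.
apply: le_trans (dT_tri (g t x') _ _) _; apply: lerD; last first.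
  by have [_ [_]] := bilip t t' x' x'.
have E1 : dT x x' = `|u - v|.
  rewrite (dT_eqZl _ xu) (dT_eqZr _ xv); apply: (@dT_lift_small _ _ _ (1 - (cp - cm))).
    by rewrite ler_norml; apply/andP; split; lra.
  by rewrite -(dT_eqZl _ xu) -(dT_eqZr _ xv).
rewrite (dT_eqZl _ (g_eqZ t xu)) (dT_eqZr _ (g_eqZ t xv)) E1.
apply: le_trans (dT_le0 _ _) _.
have [c [cuv ->]] := mean_value (@g_deriv t) u v.
by rewrite normrM ler_wpM2r //; apply: contrC; apply: closed_arc_between cuv.
Qed.

(** The first bound identifies circle distance with the distance of lifts in E; the second keeps the
    images under g, expanded by at most [alpha ^+ 2], within 1/2 of each other. *)
Let delta := Num.min (1 - (ep - em)) (alpha ^- 2 / 2).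
Let etaE := delta / (alpha ^+ 2 * (1 + S)).

Let etaE_gt0 : 0 < etaE.
Proof.
have a2 : 0 < alpha ^+ 2 by rewrite exprn_gt0.
apply: divr_gt0; first by rewrite lt_min divr_gt0 ?invr_gt0 // andbT subr_gt0.
by apply: mulr_gt0 => //; apply: addr_gt0.
Qed.

(** The expansion of g on the arc between the two images is read backwards. As E is where h lands,
    closeness of the images must first be derived from the Lipschitz bounds on h, which explains
    [etaE]. *)
Lemma contraction_E t t' x x' : E (h t x) -> E (h t' x') -> dT x x' < etaE -> dT t t' < etaE ->
  dT (h t x) (h t' x') <= alpha^-1 * dT x x' + alpha ^+ 2 * S * dT t t'.
Proof.
move=> [k hk] [l hl] dxx dtt; set y := h t x in hk *; set y' := h t' x' in hl *.
have a2 : 0 < alpha ^+ 2 by rewrite exprn_gt0.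
set u := y + k%:~R in hk; set v := y' + l%:~R in hl.
have yu : eqZ y u by apply: eqZ_sym; exists k.
have yv : eqZ y' v by apply: eqZ_sym; exists l.
have small : dT y y' < delta.
  apply: le_lt_trans (dT_tri (h t x') _ _) _.
  apply: le_lt_trans (lerD (h_lip _ _ _) (h_lip_base _ _ _)) _.
  have -> : delta = alpha ^+ 2 * etaE + alpha ^+ 2 * (S * etaE).
    have D0 : alpha ^+ 2 * (1 + S) != 0 by rewrite gt_eqF // mulr_gt0 // addr_gt0.
    by rewrite -mulrDr -{1}[etaE]mul1r -mulrDl mulrA mulrC /etaE mulfVK.
  apply: ltrD; first by rewrite ltr_pM2l.
  by rewrite ltr_pM2l // ltr_pM2l.
have [d1 d2] : dT y y' < 1 - (ep - em) /\ dT y y' < alpha ^- 2 / 2.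
  by move: small; rewrite /delta lt_min => /andP[].
have E1 : dT y y' = `|u - v|.
  rewrite (dT_eqZl _ yu) (dT_eqZr _ yv); apply: (@dT_lift_small _ _ _ (1 - (ep - em))).
    by rewrite ler_norml; apply/andP; split; lra.
  by rewrite -(dT_eqZl _ yu) -(dT_eqZr _ yv).
have [c [cuv Ec]] := mean_value (@g_deriv t) u v.
have /andP[_ c2] := dx_bounds t c.
have c1 : alpha <= `|dx g t c| by apply: expE; apply: closed_arc_between cuv.
have guv : `|g t u - g t v| = `|dx g t c| * dT y y' by rewrite Ec normrM E1.
have E2 : dT (g t u) (g t v) = `|g t u - g t v|.
  apply: dT_small; rewrite guv; apply: le_trans (ler_wpM2r (dT_ge0 _ _) c2) _.
  apply: le_trans (ler_wpM2l (ltW a2) (ltW d2)) _.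
  by rewrite mulrA divff ?mul1r // gt_eqF.
have h1 : alpha * dT y y' <= dT x x' + S * dT t t'.
  apply: le_trans (ler_wpM2r (dT_ge0 _ _) c1) _; rewrite -guv -E2.
  rewrite -(dT_eqZl _ (g_eqZ t yu)) -(dT_eqZr _ (g_eqZ t yv)) /y gK.
  apply: le_trans (dT_tri x' _ _) _; rewrite lerD2l -{1}(gK t' x') -/y'.
  by have [_ [_]] := bilip t' t y' y'; rewrite (dT_sym t').
have h2 : dT y y' <= alpha^-1 * dT x x' + alpha^-1 * (S * dT t t').
  by rewrite -mulrDr mulrC ler_pdivlMr // mulrC.
apply: le_trans h2 _; rewrite lerD2l -mulrA ler_wpM2r ?mulr_ge0 ?dT_ge0 ?(ltW S_gt0) //.
by apply: le_trans (_ : 1 <= _); [rewrite invf_le1|rewrite exprn_ege1].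
Qed.

Let I_open n : open (I n). Proof. exact: union_arcs_open (arcs n). Qed.
Let I_per n : periodic (I n). Proof. exact: union_arcs_periodic (arcs n). Qed.

Lemma fit_orb n t x : fit omega g n (t, x) = (t + n%:R * omega, orb omega g t x n).
Proof.
elim: n => [|n IH] /=; first by rewrite mul0r addr0.
by rewrite IH /= -natr1 mulrDl mul1r addrA.
Qed.

Let M_ge n : (n + 2 <= M n)%N.
Proof. by elim: n => [|n IH]; [rewrite add0n|move: (M_inc n) IH; clear; lia]. Qed.

Let M1 n : (M n - 1)%:R = (M n)%:R - 1 :> R.
Proof. by rewrite natrB //; move: (M_ge n); clear; lia. Qed.

(* I_{n+1} is the interior of a projection, so base points of I_n outside I_{n+1}
   may still have orbits that reach the boundary of E. Only the interior of E is
   excluded, which is enough because [trap] needs x outside the open arc. *)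
Lemma Iseq_nbhs n t : (\forall t' \near t, exists x z y,
    [/\ I n t', fit omega g (M n - 1) (t' - ((M n)%:R - 1) * omega, z) = (t', x), C z,
        fit omega g (M n + 1) (t', x) = (t' + ((M n)%:R + 1) * omega, y) & E y]) ->
  I n.+1 t.
Proof.
apply: filterS => t' [x [z [y [It' Ez Cz Ey Eyy]]]]; exists x; split.
  exists (t' - ((M n)%:R - 1) * omega, z); first by split=> //=; rewrite subrK.
  by rewrite Ez; split; apply: eqZ_refl.
by rewrite Ey; split=> //=; rewrite addrK.
Qed.

Lemma orb_base_continuous rho F (c d : R) t0 x n : 0 <= c -> 0 <= d ->
  (forall t t' x x', dT (F t x) (F t' x') <= c * dT x x' + d * dT t t') ->
  forall b e y, y = orb rho F t0 x n -> @open_arc R b e y ->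
  \forall t' \near t0, open_arc b e (orb rho F t' x n).
Proof.
move=> c0 d0 Fl b e y -> [k /andP[k1 k2]].
have [L [L0 HL]] : exists L, 0 <= L /\ forall t', dT (orb rho F t0 x n) (orb rho F t' x n) <= L * dT t0 t'.
  elim: n {k1 k2} => [|n [L [L0 IH]]] /=; first by exists 0; split=> // t'; rewrite dT_xx mul0r.
  exists (c * L + d); split; first by rewrite addr_ge0 // mulr_ge0.
  move=> t'; apply: le_trans (Fl _ _ _ _) _; rewrite dT_add mulrDl -mulrA lerD2r.
  by rewrite ler_wpM2l.
set z := orb rho F t0 x n in k1 k2 HL.
pose r := Num.min (z + k%:~R - b) (e - (z + k%:~R)).
have r0 : 0 < r by rewrite lt_min !subr_gt0 k1 k2.
have rL : 0 < r / (L + 1) by rewrite divr_gt0 //; lra.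
near=> t'.
have tt : `|t0 - t'| < r / (L + 1) by near: t'; apply: cvgr_dist_lt.
have zt : dT z (orb rho F t' x n) < r.
  apply: le_lt_trans (HL t') _; apply: le_lt_trans (ler_wpM2l L0 (dT_le0 _ _)) _.
  have : `|t0 - t'| * (L + 1) < r by rewrite -ltr_pdivlMr //; lra.
  by have := normr_ge0 (t0 - t'); rewrite mulrDr mulr1 mulrC; lra.
have [w ww dw] := dT_near (orb rho F t' x n) z.
apply: open_arc_eqZ ww _; exists k.
rewrite dT_sym dw in zt; move: zt; rewrite /r lt_min !ltr_norml => /andP[/andP[h1 h2] /andP[h3 h4]].
by apply/andP; split; lra.
Unshelve. all: by end_near. Qed.

Let apart_plus j i t l : (i < j)%N -> (1 <= l <= M i + 1)%N ->
  I j (t + ((M j)%:R - 1) * omega) \/ I j (t - ((M j)%:R + 1) * omega) ->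
  ~ I i (t - l%:R * omega).
Proof.
move=> ij lM It Ii; have : (1 <= j)%N by apply: leq_ltn_trans ij.
move/apart => /seteqP[/(_ t) + _]; apply; split=> //.
by left; exists i, l; split=> //; move: ij; clear; lia.
Qed.

Let apart_minus j i t l : (i < j)%N -> (l <= M i - 1)%N ->
  I j (t + ((M j)%:R - 1) * omega) \/ I j (t - ((M j)%:R + 1) * omega) ->
  ~ I i (t + l%:R * omega).
Proof.
move=> ij lM It Ii; have : (1 <= j)%N by apply: leq_ltn_trans ij.
move/apart => /seteqP[/(_ t) + _]; apply; split=> //.
by right; exists i, l; split; [move: ij; clear; lia|split=> //; rewrite /shiftS /= opprK].
Qed.

Let Isq_return j t k : (1 <= k <= 2 * K j * M j)%N -> I j t -> ~ I j (t + k%:R * omega).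
Proof.
move=> hk It Itk; have := returns j => /seteqP[/(_ (t + k%:R * omega)) + _]; apply; split=> //.
by exists k; split=> //; rewrite /shiftS /= addrK.
Qed.

Let open_C_sub := @open_arc_sub R cm cp.
Let open_E_sub := @open_arc_sub R em ep.

Lemma g_lip t t' x x' : dT (g t x) (g t' x') <= alpha ^+ 2 * dT x x' + S * dT t t'.
Proof.
apply: le_trans (dT_tri (g t x') _ _) _; apply: lerD.
  by have [_ []] := bilip t t x x'.
by have [_ [_]] := bilip t t' x' x'.
Qed.

Definition backward t x : R := h (t - omega) x.

Lemma backward_lip t t' x x' :
  dT (backward t x) (backward t' x') <= alpha ^+ 2 * dT x x' + alpha ^+ 2 * S * dT t t'.
Proof.
apply: le_trans (dT_tri (h (t - omega) x') _ _) _; apply: lerD; first exact: h_lip.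
by rewrite -mulrA -(dT_add t t' (- omega)); apply: h_lip_base.
Qed.

(** The run-up M - 1 and the exit time M + 1 are those of the sets A_n and B_n defining the critical
    regions. *)
Lemma forward_trapping (a : R) : 1 < a -> 2 <= a ^+ 3 -> a ^+ 6 = alpha ->
  trapping omega g I cm cp (open_arc em ep) (fun n => M n - 1)%N (fun n => M n + 1)%N K M
    a S (1 - (cp - cm)) true.
Proof.
move=> a1 a3 a6; split => //.
- by move=> n; move: (M_inc n); clear; lia.
- by rewrite addn1.
- by move=> n; rewrite leq_subr.
- move=> i j t l ij lM It; rewrite natrD mulrDl opprD addrA.
  by apply: (apart_plus ij lM); left; rewrite M1 subrK.
- move=> i j t l ij lM It; apply: (apart_plus ij lM); right.
  by rewrite natrD addrK.
- move=> i j t l ij lM It; apply: (apart_minus ij lM); right.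
  by rewrite natrD addrK.
- by move=> x Cx /open_E_sub Ex; have : (C `&` E) x by []; rewrite CE0.
- by move=> t x nI nE; apply: open_C_sub; apply: trap.
- move=> n t y It nIt Cy Ey; apply: nIt; apply: Iseq_nbhs.
  have near_E := orb_base_continuous (sqr_ge0 alpha) (ltW S_gt0) g_lip erefl Ey.
  have near_I : \forall t' \near t, I n t' by apply: open_nbhs_nbhs; split.
  have near_E' : \forall t' \near t,
      open_arc em ep (orb omega g (t' - (M n - 1)%:R * omega) y ((M n - 1) + (M n + 1))).
    have cts : {for t, continuous (fun t' : R => t' - (M n - 1)%:R * omega)}.
      by apply: cvgB => //; apply: cvg_cst.
    exact: cts near_E.
  near=> t'.
  have It' : I n t' by near: t'.
  have Et' : open_arc em ep (orb omega g (t' - (M n - 1)%:R * omega) y ((M n - 1) + (M n + 1))).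
    by near: t'.
  exists (orb omega g (t' - (M n - 1)%:R * omega) y (M n - 1)), y,
    (orb omega g (t' - (M n - 1)%:R * omega) y ((M n - 1) + (M n + 1))).
  split=> //; last exact: open_E_sub.
    by rewrite -M1 fit_orb subrK.
  by rewrite fit_orb [in RHS]orb_add subrK natrD.
- by apply: sum_inv_K.
- by move=> n; rewrite /Kseq muln_gt0 expn_gt0 K01 (ltnW kappa2).
- exact: ltW.
- exact: ltW.
- by rewrite subr_gt0.
- by move=> t t' x x'; rewrite (exprM a 6 2) a6; apply: g_lip.
- by move=> t t' x x' [Cx Cx'] dxx _; rewrite a6; apply: contraction_C.
Unshelve. all: by end_near. Qed.

Lemma orb_backward_cancel t x n :
  orb omega g (t - n%:R * omega) (orb (- omega) backward t x n) n = x.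
Proof.
elim: n => [//|n IH].
rewrite orb_recl /= /backward mulrN.
have -> : t - n%:R * omega - omega = t - n.+1%:R * omega by rewrite -natr1; ring.
rewrite gK (_ : t - n.+1%:R * omega + omega = t - n%:R * omega) //.
by rewrite -natr1; ring.
Qed.

Lemma orb_backward_add t x m n :
  orb omega g (t - (n + m)%:R * omega) (orb (- omega) backward t x (n + m)) m =
  orb (- omega) backward t x n.
Proof.
rewrite orb_add -[RHS](orb_backward_cancel (t + n%:R * - omega) _ m).
by congr (orb _ _ _ _ _); rewrite natrD; ring.
Qed.

(** The inverse over t undoes g over t - omega, so the critical sets move by omega. Seen from there,
    B_n lies M steps before and A_n lies M steps after, and both times become M. *)
Lemma backward_trapping (a : R) : 1 < a -> 2 <= a ^+ 3 -> a ^+ 6 = alpha ->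
  trapping (- omega) backward (fun n => shiftS (I n) omega) em ep (open_arc cm cp) M M K M
    a (alpha ^+ 2 * S) etaE false.
Proof.
move=> a1 a3 a6; split => //.
- by apply: leq_trans M02.
- by move=> n; rewrite leq_addr.
- move=> j t k kK It; rewrite /shiftS /= => Itk; apply: (Isq_return kK Itk).
  by move: It; rewrite /shiftS /=; congr (I j _); ring.
- move=> i j t l ij lM It; rewrite /shiftS /=.
  pose u := t - omega + ((M j)%:R + 1) * omega.
  have Iu : I j (u + ((M j)%:R - 1) * omega) \/ I j (u - ((M j)%:R + 1) * omega).
    by right; rewrite /u addrK.
  have l1 : (l - 1 <= M i - 1)%N by move: lM; clear; lia.
  have := apart_minus ij l1 Iu; congr (~ I i _).
  by rewrite /u natrB ?natrD; [ring|case/andP: lM].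
- move=> i j t l ij lM It; rewrite /shiftS /=.
  pose u := t - omega - ((M j)%:R - 1) * omega.
  have Iu : I j (u + ((M j)%:R - 1) * omega) \/ I j (u - ((M j)%:R + 1) * omega).
    by left; rewrite /u subrK.
  have l1 : (l - 1 <= M i - 1)%N by move: lM; clear; lia.
  have := apart_minus ij l1 Iu; congr (~ I i _).
  by rewrite /u natrB; [ring|case/andP: lM].
- move=> i j t l ij lM It; rewrite /shiftS /=.
  pose u := t - omega - ((M j)%:R - 1) * omega.
  have Iu : I j (u + ((M j)%:R - 1) * omega) \/ I j (u - ((M j)%:R + 1) * omega).
    by left; rewrite /u subrK.
  have l1 : (1 <= l + 1 <= M i + 1)%N by move: lM; clear; lia.
  have := apart_plus ij l1 Iu; congr (~ I i _).
  by rewrite /u natrD; ring.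
- by move=> x Ex /open_C_sub Cx; have : (C `&` E) x by []; rewrite CE0.
- move=> t x nI nC; apply: open_E_sub; apply: contrapT => nE; apply: nC.
  by rewrite -(gK (t - omega) x); apply: trap.
- move=> n t y It nIt Ey Cz; apply: nIt; apply: Iseq_nbhs.
  have aS0 : 0 <= alpha ^+ 2 * S by rewrite mulr_ge0 ?sqr_ge0 // ltW.
  have near_C := orb_base_continuous (sqr_ge0 alpha) aS0 backward_lip erefl Cz.
  have near_I : \forall t' \near t - omega, I n t' by apply: open_nbhs_nbhs; split.
  have near_C' : \forall t' \near t - omega,
      open_arc cm cp (orb (- omega) backward (t' + ((M n)%:R + 1) * omega) y (M n + M n)).
    have cts : {for t - omega, continuous (fun t' : R => t' + ((M n)%:R + 1) * omega)}.
      by apply: cvgD => //; apply: cvg_cst.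
    have near_C2 : \forall s \near t - omega + ((M n)%:R + 1) * omega,
        open_arc cm cp (orb (- omega) backward s y (M n + M n)).
      by rewrite (_ : _ + _ = t - (M n)%:R * - omega); [exact: near_C|ring].
    exact: cts near_C2.
  near=> t'.
  have It' : I n t' by near: t'.
  have Ct' : open_arc cm cp (orb (- omega) backward (t' + ((M n)%:R + 1) * omega) y (M n + M n)).
    by near: t'.
  set s := t' + ((M n)%:R + 1) * omega in Ct' *.
  (* The backward orbit from E passes over [t'] after M + 1 steps and reaches C after M - 1 more. *)
  have MM : (M n + M n = (M n + 1) + (M n - 1))%N by move: (M_ge n); clear; lia.
  rewrite MM in Ct'.
  exists (orb (- omega) backward s y (M n + 1)),
    (orb (- omega) backward s y ((M n + 1) + (M n - 1))), y.
  split=> //.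
  + rewrite -M1 fit_orb subrK -(orb_backward_add s y (M n - 1) (M n + 1)).
    by congr (_, orb _ _ _ _ _); rewrite /s natrD M1 natrD; ring.
  + exact: open_C_sub.
  + rewrite fit_orb natrD; congr (_, _).
    rewrite -[RHS](orb_backward_cancel s y (M n + 1)).
    by congr (orb _ _ _ _ _); rewrite /s natrD; ring.
- by apply: sum_inv_K.
- by move=> n; rewrite /Kseq muln_gt0 expn_gt0 K01 (ltnW kappa2).
- exact: ltW.
- by rewrite mulr_ge0 ?sqr_ge0 // ltW.
- by move=> t t' x x'; rewrite (exprM a 6 2) a6; apply: backward_lip.
- move=> t t' x x' [Ex Ex'] dxx dtt; rewrite a6.
  by have := @contraction_E (t - omega) (t' - omega) x x' Ex Ex' dxx; rewrite dT_add; apply.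
Unshelve. all: by end_near. Qed.

End Instances.

(** * Proof of the theorem *)

Section LyapunovSign.
Variables (R : realType) (g : R -> R -> R) (phi : R -> R) (alpha : R) (B : set R).
Local Notation leb := (@lebesgue_measure R).
Hypothesis alpha1 : 1 < alpha.
Hypothesis bounds : forall t x, alpha ^- 2 <= `|dx g t x| <= alpha ^+ 2.
Hypotheses (mB : measurable B) (B_small : (circ B <= (1 / 16)%:E)%E).

(** The exponent integrates over the closed unit interval, whereas the graph is controlled on the
    half-open one. *)
Let B1 : set R := B `|` [set 1].

Let mB1 : measurable B1. Proof. exact: measurableU. Qed.

Let B1_small : (circ B1 <= (1 / 16)%:E)%E.
Proof.
apply: le_trans (circU mB _) _; first exact: measurable_set1.
rewrite -[leRHS]adde0; apply: leeD => //.
rewrite /circ (_ : _ `&` _ = set0) ?measure0 // -subset0 => t [/= t01 t1].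
by move: t01; rewrite t1 in_itv /= ltxx andbF.
Qed.

Let l := ln alpha.
Let l_gt0 : 0 < l. Proof. exact: ln_gt0. Qed.

Let alpha0 : 0 < alpha. Proof. exact: lt_trans alpha1. Qed.

Let ln_bounds t x : - (2 * l) <= ln `|dx g t x| <= 2 * l.
Proof.
have /andP[h1 h2] := bounds t x.
have p2 : 0 < alpha ^- 2 by rewrite invr_gt0 exprn_gt0.
have p : 0 < `|dx g t x| by apply: lt_le_trans h1.
have E : ln (alpha ^+ 2) = 2 * l by rewrite lnXn // mulr_natl.
apply/andP; split.
  by rewrite -E -lnV ?posrE ?exprn_gt0 // ler_ln.
by rewrite -E ler_ln // posrE exprn_gt0.
Qed.

(** With l = ln alpha, the integrand is at least l off [B1] and at least -2l on it, so the integral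
    is at least l(1 - 3/16). *)
Lemma lyap_ge0 : (forall t, 0 <= t < 1 -> ~ B t -> alpha <= `|dx g t (phi t)|) ->
  (0 <= lyap g phi)%E.
Proof.
move=> expanding; apply: le_trans (_ : (\int[leb]_(t in `[0%R, 1%R])
    (l + (- (3 * l)) * \1_B1 t)%:E <= _)%E); last first.
  apply: le_integral_raw => t /=; rewrite in_itv /= => /andP[t0 t1]; rewrite lee_fin indicE.
  have [tB|tB] := boolP (t \in B1).
    by have /andP[h _] := ln_bounds t (phi t); rewrite mulr1; lra.
  rewrite mulr0 addr0; move/negP: tB; rewrite inE => /not_orP[nB /eqP t1'].
  have h : alpha <= `|dx g t (phi t)| by apply: expanding => //; rewrite t0 lt_neqAle t1' t1.
  by rewrite /l ler_ln // posrE; apply: lt_le_trans h.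
rewrite integral_two_values //.
move: B1_small; rewrite -(fineK (circ_fin mB1)); set r := fine _.
by rewrite -EFinM -EFinD !lee_fin => hr; have := ler_wpM2l (ltW l_gt0) hr; have := l_gt0; lra.
Qed.

Lemma lyap_le0 : (forall t, 0 <= t < 1 -> ~ B t -> `|dx g t (phi t)| <= alpha^-1) ->
  (lyap g phi <= 0)%E.
Proof.
move=> contracting; apply: le_trans (_ : _ <= (\int[leb]_(t in `[0%R, 1%R])
    (- l + (3 * l) * \1_B1 t)%:E))%E _.
  apply: le_integral_raw => t /=; rewrite in_itv /= => /andP[t0 t1]; rewrite lee_fin indicE.
  have [tB|tB] := boolP (t \in B1).
    by have /andP[_ h] := ln_bounds t (phi t); rewrite mulr1; lra.
  rewrite mulr0 addr0; move/negP: tB; rewrite inE => /not_orP[nB /eqP t1'].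
  have h : `|dx g t (phi t)| <= alpha^-1 by apply: contracting => //; rewrite t0 lt_neqAle t1' t1.
  have p : 0 < `|dx g t (phi t)|.
    by have /andP[h' _] := bounds t (phi t); apply: lt_le_trans h'; rewrite invr_gt0 exprn_gt0.
  by rewrite /l -lnV ?posrE // ler_ln // posrE invr_gt0.
rewrite integral_two_values //.
move: B1_small; rewrite -(fineK (circ_fin mB1)); set r := fine _.
by rewrite -EFinM -EFinD !lee_fin => hr; have := ler_wpM2l (ltW l_gt0) hr; have := l_gt0; lra.
Qed.

End LyapunovSign.

Section RotationErgodic.
Variable R : realType.

Lemma dom2_measurable : measurable (@dom2 R).
Proof.
rewrite (_ : @dom2 R = (fst @^-1` `[0%R, 1%R[%classic) `&` (snd @^-1` `[0%R, 1%R[%classic)).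
  apply: measurableI; rewrite -[X in measurable X]setTI.
    by apply: measurable_fst => //; exact: measurable_itv.
  by apply: measurable_snd => //; exact: measurable_itv.
by apply/seteqP; split=> p /= [h1 h2]; split; move: h1 h2; rewrite /= !in_itv.
Qed.

(* The ergodicity of the graph measure is tested on cylinders over Y. *)
Lemma rotation_ergodic (omega : R) g phi : inv_erg_prob omega g (muphi phi) ->
  forall Y : set R, measurable Y -> periodic Y -> (forall t, Y t <-> Y (t + omega)) ->
  circ Y = 0%E \/ circ Y = 1%E.
Proof.
move=> [_ [_ [_ erg]]] Y mY pY YE.
pose B : set (R * R) := [set p | dom2 p /\ Y p.1].
have -> : circ Y = muphi phi B.
  rewrite /circ /muphi; congr (lebesgue_measure _); apply/seteqP; split=> t /=.
    by rewrite in_itv /= => -[t01 Yt]; split=> //; split=> //; split=> //; apply: fracR_itv.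
  by rewrite in_itv /= => -[t01 [_ Yt]].
apply: erg.
- apply: measurableI; first exact: dom2_measurable.
  by rewrite -[X in measurable X]setTI; apply: measurable_fst.
- by move=> p [].
- apply/seteqP; split=> p.
    move=> [dp [_ /= Yp]]; split=> //; apply/YE; apply: pY Yp; exact: eqZ_fracR.
  move=> [dp Yp]; split=> //; split; first by split; apply: fracR_itv.
  by move/YE: Yp; apply: pY; apply: eqZ_sym; apply: eqZ_fracR.
Qed.

End RotationErgodic.

Theorem theorem2p10 (R : realType) (omega : R) (g h : R -> R -> R)
    (cm cp em ep : R) (I0 : set R) (N : nat) (alpha S : R) (kappa K0 : nat)
    (M : nat -> nat) (eps : nat -> R) (s : R) (phip phim : R -> R) :
  (forall q : rat, omega <> ratr q) ->
  skew_C1_diffeo g h ->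
  V_data omega g h cm cp em ep I0 N alpha S kappa K0 M eps s phip phim ->
  rectifiable_measure (muphi phip) /\ rectifiable_measure (muphi phim).
Proof.
move=> _ gh [[_ cp_lt _ ep_lt CE0] [_ [alpha4 [S_gt0 [trap [bilip [contrC [expE
  [kappa2 [K01 [K_prod [[M_inc _] [M02 [_ [_ [_ [_ [_ [_ [sum1 [sum2 [crit
  [snap [snam [ergp _]]]]]]]]]]]]]]]]]]]]]]]]].
have eps_sum := le_lt_trans sum1 sum2.
have arcs n : union_arcs (Iseq omega g (closed_arc cm cp) (closed_arc em ep) M I0 n) N (eps n).
  by have [_ [_ [_ ?]]] := crit n.
have returns j := (crit j).2.1 j (leqnn j).
have apart j (j1 : (1 <= j)%N) := (crit j).2.2.1 j (introT andP (conj j1 (leqnn j))).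
have ergodic := rotation_ergodic ergp.
have [a [a1 a3 a6]] := sixth_root alpha4.
have alpha1 : 1 < alpha by lra.
have bounds := dx_bounds gh bilip.
have I_open n := union_arcs_open (arcs n).
have I_per n := union_arcs_periodic (arcs n).
have I_small n := union_arcs_circ (arcs n).
have e_sum : (\sum_(0 <= n <oo) ((2 * Kseq K0 kappa n * M n + 1)%:R * (N%:R * eps n))%:E
    < (1 / 16)%:E)%E.
  by apply: le_lt_trans eps_sum; under eq_eseriesr do rewrite mulrA -natrM.
split.
- have [[mphi [phi_per phi_inv]] [lyap_neg _]] := snap.
  have sys := forward_trapping gh cp_lt CE0 S_gt0 trap bilip contrC kappa2 K01
    K_prod M_inc M02 returns apart arcs a1 a3 a6.
  apply: (trapped_rectifiable sys I_open I_per I_small e_sum mphi phi_per phi_inv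
    (or_introl erefl) ergodic).
  apply/eqP => G0.
  have [B [mB B_small BE]] := no_landing sys I_open I_per I_small e_sum mphi phi_per phi_inv G0.
  have := lyap_ge0 alpha1 bounds mB B_small (phi := phip).
  rewrite leNgt lyap_neg => /(_ _)/negP; apply=> // t t01 nB.
  by apply: expE; apply: open_arc_sub; apply: BE.
- have [[mphi [phi_per phi_inv]] [lyap_pos _]] := snam.
  have sys := backward_trapping gh ep_lt CE0 alpha4 S_gt0 trap bilip expE
    kappa2 K01 K_prod M_inc M02 returns apart arcs a1 a3 a6.
  pose J n := shiftS (Iseq omega g (closed_arc cm cp) (closed_arc em ep) M I0 n) omega.
  have J_open n : open (J n).
    have c : continuous (fun t : R => t - omega) by move=> t; apply: cvgB => //; apply: cvg_cst.
    by move/continuousP : c; apply.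
  have J_per n : periodic (J n) by apply: periodic_shiftS.
  have J_small n : (circ (J n) <= (N%:R * eps n)%:E)%E.
    by rewrite circ_shiftS //; apply: open_measurable.
  (* Apply h to the invariance relation at t - omega; the exceptional null set is translated by
     omega. *)
  have phi_inv' : {ae (@lebesgue_measure R), forall t, eqZ (backward omega h t (phim t)) (phim (t + - omega))}.
    apply: negligibleS (negligible_shiftS omega phi_inv) => t /= nt; rewrite /shiftS /= => H.
    apply: nt; rewrite subrK in H; apply: eqZ_sym.
    have := h_eqZ gh alpha4 bilip (t - omega) H.
    by have [_ [_ [_ [_ [-> _]]]]] := gh.
  apply: (trapped_rectifiable sys J_open J_per J_small e_sum mphi phi_per phi_inv'
    (or_intror erefl) ergodic).
  apply/eqP => G0.
  have [B [mB B_small BE]] := no_landing sys J_open J_per J_small e_sum mphi phi_per phi_inv' G0.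
  have := lyap_le0 alpha1 bounds mB B_small (phi := phim).
  rewrite leNgt lyap_pos => /(_ _)/negP; apply=> // t t01 nB.
  by apply: contrC; apply: open_arc_sub; apply: BE.
Qed.
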